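(* Fix $t$ and $j\in\{1,\dots,m\}$. Under Assumptions (A1)–(A2), the boundary value problem $$\nabla\cdot(p(x,t)\nabla\phi_j(x,t))=-(h_j(x)-\hat h_j)\,p(x,t),\qquad \int\phi_j(x,t)p(x,t)\,\mathrm{d}x=0,$$ possesses a unique weak solution $\phi_j\in H^1_0(\mathbb{R}^d;p)$, satisfying $$\int|\nabla\phi_j(x)|^2p(x,t)\,\mathrm{d}x\le\frac1\lambda\int|h_j(x)-\hat h_j|^2p(x,t)\,\mathrm{d}x .$$ If in addition Assumptions (A3)–(A4) hold, then $\phi_j\in H^2(\mathbb{R}^d;p)$ with $$\int\left|(D^2\phi_j)(\nabla\phi_j)\right|p(x,t)\,\mathrm{d}x\le C(\lambda;p)\int|\nabla h_j|^2p(x,t)\,\mathrm{d}x,$$ where $$C(\lambda;p)=\frac{1}{\lambda^{3/2}}\left(\frac{\|D^2(\log p)\|_{L^\infty}}{\lambda}+1\right)^{1/2}$$ and $\lambda>0$ is the spectral gap (Poincaré) constant of $p(\cdot,t)$.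
   Context: $h=(h_1,\dots,h_m)^T:\mathbb{R}^d\to\mathbb{R}^m$ is a $C^1$ function, $p(\cdot,t)$ is a probability density on $\mathbb{R}^d$, and $\hat h_j=\int h_j(x)p(x,t)\,\mathrm{d}x$. The time $t$ is fixed. Function spaces: $L^2(\mathbb{R}^d;p)$ is the space of functions square-integrable with respect to the density $p(\cdot,t)$; $H^k(\mathbb{R}^d;p)$ is the Hilbert space of functions in $L^2(\mathbb{R}^d;p)$ whose first $k$ weak derivatives are in $L^2(\mathbb{R}^d;p)$; $H^1_0(\mathbb{R}^d;p)=\{\phi\in H^1(\mathbb{R}^d;p):\int\phi(x)p(x,t)\,\mathrm{d}x=0\}$. Weak solution: $\phi_j\in H^1_0(\mathbb{R}^d;p)$ is a weak solution if $\int\nabla\phi_j\cdot\nabla\psi\,p\,\mathrm{d}x=\int(h_j-\hat h_j)\psi\,p\,\mathrm{d}x$ for all $\psi\in H^1(\mathbb{R}^d;p)$. Assumptions: (A1) $p(x,t)=e^{-\mathcal{G}(x,t)}$ with $\mathcal{G}$ twice continuously differentiable and $|\nabla\mathcal{G}|^2-2\Delta\mathcal{G}\to\infty$ as $|x|\to\infty$. (A2) $\int|h(x)|^2p(x,t)\,\mathrm{d}x<\infty$, where $|h|^2=\sum_j|h_j|^2$. (A3) The second derivatives of $\mathcal{G}$ in $x$ are uniformly bounded at each $t$: $|\partial^2\mathcal{G}/\partial x_j\partial x_k(x,t)|\le c_2(t)$ for all $x\in\mathbb{R}^d$. (A4) The first (weak) derivatives of $h$ satisfy $\int|\nabla h(x)|^2p(x,t)\,\mathrm{d}x<\infty$,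 where $|\nabla h|^2=\sum_{j,k}|\partial h_j/\partial x_k|^2$. Spectral gap constant: under (A1) it is known that $p$ satisfies a Poincaré inequality; $\lambda>0$ denotes a constant such that $\int|\phi|^2p\,\mathrm{d}x\le\frac1\lambda\int|\nabla\phi|^2p\,\mathrm{d}x$ for all $\phi\in H^1_0(\mathbb{R}^d;p)$. $D^2$ denotes the Hessian matrix in $x$, $|v|$ is the Euclidean norm of a vector, $|M|^2=\sum_{j,k}M_{jk}^2$ for a matrix $M$, and $\|D^2(\log p)\|_{L^\infty}$ is the essential supremum over $x$ of $|D^2(\log p)(x)|$. *)

(* Defs.v *)
From HB Require Import structures.
From mathcomp Require Import all_boot all_order all_algebra.
From mathcomp Require Import all_classical all_reals all_analysis.
From mathcomp Require Import ess_sup_inf.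

Set Implicit Arguments.
Unset Strict Implicit.
Unset Printing Implicit Defensive.

Import Order.TTheory GRing.Theory Num.Theory.
Import numFieldNormedType.Exports.

Local Open Scope classical_set_scope.
Local Open Scope ring_scope.

(* Product sigma-algebra on row vectors, as for tuples; it is the Borel one
   on R^n. *)
Definition measure_rV_display : measure_display -> measure_display.
Proof. exact. Qed.

Section measurable_rV.
Context {d} {T : sigmaRingType d}.
Variable n : nat.

Let coors : 'I_n -> 'rV[T]_n -> T := fun i x => x ord0 i.

Let rV_set0 : g_sigma_preimage coors set0.
Proof. exact: sigma_algebra0. Qed.

Let rV_setC A : g_sigma_preimage coors A -> g_sigma_preimage coors (~` A).
Proof. exact: sigma_algebraC. Qed.

Let rV_bigcup (F : _^nat) : (forall i, g_sigma_preimage coors (F i)) ->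
  g_sigma_preimage coors (\bigcup_i (F i)).
Proof. exact: sigma_algebra_bigcup. Qed.

HB.instance Definition _ := @isMeasurable.Build (measure_rV_display d)
  'rV[T]_n (g_sigma_preimage coors) rV_set0 rV_setC rV_bigcup.

End measurable_rV.

Lemma measurable_coord (R : realType) n (i : 'I_n) :
  measurable_fun [set: 'rV[R]_n] (fun x : 'rV[R]_n => x ord0 i).
Proof.
move=> _ Y mY; rewrite setTI; apply: sub_sigma_algebra => /=.
rewrite -bigcup_seq/=; exists i => /=; first by rewrite mem_index_enum.
by exists Y => //; rewrite setTI.
Qed.

Lemma measurable_fun_coordP (R : realType) d (T : measurableType d) n
    (f : T -> 'rV[R]_n) :
  (forall i, measurable_fun [set: T] (fun t => f t ord0 i)) ->
  measurable_fun [set: T] f.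
Proof.
move=> mf.
suff H : g_sigma_preimage (fun (i : 'I_n) (x : 'rV[R]_n) => x ord0 i) `<=`
    [set A | measurable (f @^-1` A)].
  by move=> _ A /H; rewrite setTI.
apply: smallest_sub.
  split => /=.
  - by rewrite preimage_set0.
  - by move=> A mA; rewrite setTD preimage_setC; exact: measurableC.
  - by move=> F mF; rewrite preimage_bigcup; exact: bigcupT_measurable.
rewrite -bigcup_seq/=; apply: bigcup_sub => i _ A [B mB <-]/=.
by rewrite setTI; have := mf i measurableT B mB; rewrite setTI.
Qed.

Definition consv (R : realType) n (xv : measurableTypeR R * 'rV[R]_n) : 'rV[R]_n.+1 :=
  row_mx (const_mx xv.1 : 'rV_1) xv.2.

Lemma consv0 (R : realType) n (xv : measurableTypeR R * 'rV[R]_n) :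
  consv xv ord0 ord0 = xv.1.
Proof.
rewrite (_ : ord0 = lshift n (ord0 : 'I_1)); last exact/val_inj.
by apply: etrans (row_mxEl _ _ _ _) _; rewrite mxE.
Qed.

Lemma consvS (R : realType) n (xv : measurableTypeR R * 'rV[R]_n) i :
  consv xv ord0 (lift ord0 i) = xv.2 ord0 i.
Proof.
rewrite (_ : lift ord0 i = rshift 1 i); last exact/val_inj.
exact: row_mxEr.
Qed.

Lemma measurable_consv (R : realType) n :
  measurable_fun [set: measurableTypeR R * 'rV[R]_n] (@consv R n).
Proof.
apply: measurable_fun_coordP => i; case: (unliftP ord0 i) => [j ->|->].
  rewrite [X in measurable_fun _ X](_ : _ =
      (fun v : 'rV[R]_n => v ord0 j) \o snd).
    exact: (measurableT_comp (measurable_coord j) measurable_snd).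
  by apply/funext => xv; exact: consvS.
rewrite [X in measurable_fun _ X](_ : _ = fst); first exact: measurable_fst.
by apply/funext => xv; exact: consv0.
Qed.

Definition unconsv (R : realType) n (v : 'rV[R]_n.+1) : measurableTypeR R * 'rV[R]_n :=
  (v ord0 ord0, @rsubmx _ 1 1 n v).

Lemma consvK (R : realType) n : cancel (@consv R n) (@unconsv R n).
Proof.
move=> [x v]; rewrite /unconsv consv0; congr pair.
exact: row_mxKr.
Qed.

Lemma measurable_unconsv (R : realType) n :
  measurable_fun [set: 'rV[R]_n.+1] (@unconsv R n).
Proof.
apply/measurable_fun_pair; first exact: measurable_coord.
apply: measurable_fun_coordP => i; rewrite /rsubmx.
rewrite [X in measurable_fun _ X](_ : _ = fun v : 'rV[R]_n.+1 => v ord0 (rshift 1 i)); last first.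
  by apply/funext => v; rewrite mxE.
exact: measurable_coord.
Qed.

(* Lebesgue measure on R^n as an iterated product measure; cf. lebesgue_rV_rect. *)
Fixpoint lebesgue_rV (R : realType) (n : nat) : set 'rV[R]_n -> \bar R :=
  match n return set 'rV[R]_n -> \bar R with
  | 0 => \d_(0 : 'rV[R]_0)
  | n'.+1 => pushforward (@lebesgue_measure R \x @lebesgue_rV R n')%E (@consv R n')
  end.

(* The sigma-finite instance inferred for a product measure requires both
   factors to be sub-probabilities, hence this lemma. *)
Lemma product_measure1_sigma_finite d1 d2 (T1 : measurableType d1)
    (T2 : measurableType d2) (R : realType)
    (m1 : {sigma_finite_measure set T1 -> \bar R})
    (m2 : {sigma_finite_measure set T2 -> \bar R}) :
  sigma_finite setT (m1 \x m2)%E.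
Proof.
have /sigma_finiteP[F [TF ndF Foo]] := sigma_finiteT m1.
have /sigma_finiteP[G [TG ndG Goo]] := sigma_finiteT m2.
exists (fun n => F n `*` G n).
  rewrite -setXTT TF TG predeqE => -[x y]; split; last first.
    by move=> [n _ []/= ? ?]; split; exists n.
  move=> [/= [n _ Fnx] [k _ Gky]]; exists (maxn n k) => //; split.
  - by move: x Fnx; exact/subsetPset/ndF/leq_maxl.
  - by move: y Gky; exact/subsetPset/ndG/leq_maxr.
move=> k; have [? ?] := Foo k; have [? ?] := Goo k.
split; first exact: measurableX.
by rewrite product_measure1E// lte_mul_pinfty// ge0_fin_numE.
Qed.

Lemma pushforward_sigma_finite d1 d2 (T1 : measurableType d1)
    (T2 : measurableType d2) (R : realType)
    (m : {measure set T1 -> \bar R}) (f : T1 -> T2) (g : T2 -> T1) :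
    sigma_finite setT m ->
    measurable_fun [set: T1] f -> measurable_fun [set: T2] g -> cancel f g ->
  exists m' : {sigma_finite_measure set T2 -> \bar R}, pushforward m f = m'.
Proof.
move=> [F UF mF] mf mg fK.
pose pf : {measure set T2 -> \bar R} :=
  @measure_function_pushforward__canonical__measure_function_Measure
    _ _ _ _ _ m _ mf.
have sf : sigma_finite setT pf.
  exists (fun k => g @^-1` F k).
    by rewrite -preimage_bigcup -UF preimage_setT.
  move=> k; have [mFk Fk] := mF k; split.
    by rewrite -[X in measurable X]setTI; exact: mg.
  rewrite /pf /= /pushforward -comp_preimage.
  by rewrite (_ : _ \o _ = id) ?preimage_id//; exact/funext.
pose pf' : {sigma_finite_measure set T2 -> \bar R} := HB.pack
  (pf : set _ -> \bar R) (Measure.on pf)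
  (@Measure_isSigmaFinite.Build _ _ _ pf sf).
by exists pf'.
Qed.

Arguments lebesgue_rV {R n}.

Lemma lebesgue_rV_ex (R : realType) n :
  exists m : {sigma_finite_measure set 'rV[R]_n -> \bar R}, lebesgue_rV = m.
Proof.
elim: n => [|n [m mE]]; first by exists \d_(0 : 'rV[R]_0).
rewrite /= mE.
have [m' m'E] := pushforward_sigma_finite
  (product_measure1_sigma_finite (@lebesgue_measure R) m)
  (@measurable_consv R n) (@measurable_unconsv R n) (@consvK R n).
by exists m'; rewrite -m'E.
Qed.

Section lebesgue_rV_measure.
Context {R : realType} (n : nat).
Local Notation leb := (@lebesgue_rV R n).

Let leb0 : leb set0 = 0%E.
Proof. by have [m ->] := lebesgue_rV_ex R n; exact: measure0. Qed.

Let leb_ge0 A : (0 <= leb A)%E.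
Proof. by have [m ->] := lebesgue_rV_ex R n; exact: measure_ge0. Qed.

Let leb_sigma_additive : semi_sigma_additive leb.
Proof.
by have [m ->] := lebesgue_rV_ex R n; exact: measure_semi_sigma_additive.
Qed.

HB.instance Definition _ := isMeasure.Build _ _ _ leb
  leb0 leb_ge0 leb_sigma_additive.

Let leb_sigma_finite : sigma_finite setT leb.
Proof. by have [m ->] := lebesgue_rV_ex R n; exact: sigma_finiteT. Qed.

HB.instance Definition _ := @Measure_isSigmaFinite.Build _ _ _ leb
  leb_sigma_finite.

End lebesgue_rV_measure.

Lemma lebesgue_rV_rect (R : realType) n (A : 'I_n -> set R) :
    (forall i, measurable (A i)) ->
  (lebesgue_rV [set v : 'rV[R]_n | forall i, A i (v ord0 i)] =
   \prod_(i < n) lebesgue_measure (A i))%E.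
Proof.
elim: n A => [|n IHn] A mA.
  by rewrite big_ord0 /= diracE mem_set// => -[].
rewrite big_ord_recl -IHn//= /pushforward.
have [m mE] := lebesgue_rV_ex R n.
rewrite mE -product_measure1E//; last 2 first.
- exact: mA.
- rewrite (_ : [set _ | _] =
      \bigcap_i ((fun v : 'rV[R]_n => v ord0 i) @^-1` (A (lift ord0 i)))).
    apply: fin_bigcap_measurable => // i _; rewrite -[X in measurable X]setTI.
    exact: measurable_coord.
  apply/seteqP; split => v /= vA i; first by move=> _; exact: vA.
  exact: vA.
congr product_measure1; apply/seteqP; split => -[x v] /=.
  move=> xvA; split => [|i].
    by have := xvA ord0; rewrite consv0.
  by have := xvA (lift ord0 i); rewrite consvS.
move=> [xA vA] i; case: (unliftP ord0 i) => [j ->|->].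
  by rewrite consvS; exact: vA.
by rewrite consv0.
Qed.

Section calculus.
Context {R : realType} {d : nat}.
Implicit Types (f g eta : 'rV[R]_d -> R) (i : 'I_d) (x : 'rV[R]_d).

(* The Euclidean norm: the library norm `|M| of a matrix is the sup norm. *)
Definition norm2 m n (M : 'M[R]_(m, n)) : R :=
  Num.sqrt (\sum_i \sum_j M i j ^+ 2).

Definition dot (u v : 'rV[R]_d) : R := \sum_i u ord0 i * v ord0 i.

Definition partial i f : 'rV[R]_d -> R := 'D_(delta_mx ord0 i) f.

Definition grad f x : 'rV[R]_d := \row_i partial i f x.

Definition hess f x : 'M[R]_d := \matrix_(i, k) partial k (partial i f) x.

Definition laplacian f x : R := \tr (hess f x).

Fixpoint Ck (k : nat) f : Prop :=
  continuous f /\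
  match k with
  | 0 => True
  | k'.+1 => forall i,
      (forall x, derivable f x (delta_mx ord0 i)) /\ Ck k' (partial i f)
  end.

Definition test_function eta : Prop :=
  (forall k, Ck k eta) /\ compact (closure [set x | eta x != 0]).

Definition locally_integrable_rV f : Prop :=
  measurable_fun [set: 'rV[R]_d] f /\
  forall K : set 'rV[R]_d, compact K ->
    lebesgue_rV.-integrable K (EFin \o f).

Definition is_weak_partial i f g : Prop :=
  [/\ locally_integrable_rV f, locally_integrable_rV g &
    forall eta, test_function eta ->
      \int[lebesgue_rV]_x (f x * partial i eta x) =
      - \int[lebesgue_rV]_x (g x * eta x)].

(* Unique up to a null set; an arbitrary function when f has no weak partial
   derivative. *)
Definition weak_partial i f : 'rV[R]_d -> R := get [set g | is_weak_partial i f g].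

Definition weak_grad f x : 'rV[R]_d := \row_i weak_partial i f x.

Definition weak_hess f x : 'M[R]_d :=
  \matrix_(i, k) weak_partial k (weak_partial i f) x.

End calculus.

Section weighted_spaces.
Context {R : realType} {d : nat}.
Implicit Types (p f g : 'rV[R]_d -> R).

Definition probability_density p : Prop :=
  [/\ measurable_fun [set: 'rV[R]_d] p, forall x, 0 <= p x &
    (\int[lebesgue_rV]_x (p x)%:E = 1)%E].

Definition mean p f : R := \int[lebesgue_rV]_x (f x * p x).

Definition L2 p f : Prop :=
  measurable_fun [set: 'rV[R]_d] f /\
  (\int[lebesgue_rV]_x (f x ^+ 2 * p x)%:E < +oo)%E.

(* Membership is a.e.-invariant: elements are represented by Borel functions,
   and their equality is equality almost everywhere. *)
Fixpoint sobolev p (k : nat) f : Prop :=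
  L2 p f /\
  match k with
  | 0 => True
  | k'.+1 => forall i, exists g, is_weak_partial i f g /\ sobolev p k' g
  end.

Definition sobolev10 p f : Prop :=
  sobolev p 1 f /\ mean p f = 0.

(* Weak form of div (p grad f) = - (g - mean p g) p. *)
Definition weak_solution p g f : Prop :=
  sobolev10 p f /\
  forall psi, sobolev p 1 psi ->
    \int[lebesgue_rV]_x (dot (weak_grad f x) (weak_grad psi x) * p x) =
    \int[lebesgue_rV]_x ((g x - mean p g) * psi x * p x).

(* Any admissible Poincare constant, not only the optimal one. *)
Definition spectral_gap p (lambda : R) : Prop :=
  0 < lambda /\
  forall f, sobolev10 p f ->
    (\int[lebesgue_rV]_x (f x ^+ 2 * p x)%:E <=
     lambda^-1%:E *
       \int[lebesgue_rV]_x (norm2 (weak_grad f x) ^+ 2 * p x)%:E)%E.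

(* fine is harmless when the second derivatives of ln p are bounded. *)
Definition ess_sup_hess_log p : R :=
  fine (ess_sup lebesgue_rV (fun x => (norm2 (hess (fun y => ln (p y)) x))%:E)).

Definition hess_constant (lambda : R) p : R :=
  (lambda `^ (3 / 2))^-1 * (ess_sup_hess_log p / lambda + 1) `^ (1 / 2).

End weighted_spaces.

(* Main.v *)
Require Import Defs.
From HB Require Import structures.
From mathcomp Require Import all_boot all_order all_algebra.
From mathcomp Require Import ring lra.
From mathcomp Require Import all_classical all_reals all_analysis.
From mathcomp Require Import measurable_realfun ess_sup_inf.

Set Implicit Arguments.
Unset Strict Implicit.
Unset Printing Implicit Defensive.

Import Order.TTheory GRing.Theory Num.Theory.
Import numFieldNormedType.Exports.

Local Open Scope classical_set_scope.
Local Open Scope ring_scope.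

(** Write p = exp (- G), f = h_j - mean h_j, M for the essential supremum of
    |D^2 log p| = |D^2 G|, N for the integral of |grad phi|^2 p and H for the
    integral of |grad h_j|^2 p.

    By the Poincare inequality the Dirichlet form is coercive on the functions
    of zero mean, so the weak solution phi is the Riesz representative of
    psi |-> \int f psi p (weak_solution_exists). Testing the equation with the
    difference of two solutions gives uniqueness, and testing it with phi
    itself gives N <= lambda^-1 \int f^2 p, by Cauchy-Schwarz and the Poincare
    inequality for phi.

    The second order estimate rests on the Bochner identity
      \int |D^2 phi|^2 p = - \int D^2 G (grad phi, grad phi) p
                            + \int grad h_j . grad phi p,
    which is what the equation, differentiated in each direction and tested
    with the derivatives of phi, amounts to. It bounds the left-hand side by
    M N + sqrt (H N) (second_order). As N <= lambda^-1 \int f^2 p and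
    \int f^2 p <= lambda^-1 H, this is at most (H / lambda) (M / lambda + 1),
    and the Cauchy-Schwarz inequality
      (\int |D^2 phi (grad phi)| p)^2 <= (\int |D^2 phi|^2 p) N
    yields the square of the announced constant (weak_solution_hess_grad).

    A weak solution cannot be differentiated twice beforehand, so the identity
    is proved for difference quotients of step s. Testing the equation with
    the backward difference quotient of chi^2 p D_s phi, divided by p, gives
    an exact identity for each cutoff chi and each s (discrete_bochner) whose
    error terms are absorbed (energy_step) or vanish as s tends to 0
    (energy_limit). The resulting bound is uniform in s and chi; by duality
    between the weights p and 1 / p it provides the weak second derivatives
    together with their norm (l2_duality).

    Two facts on weak derivatives carry this argument. They are unique almost
    everywhere, because smooth bumps approximate the indicator functions of
    boxes and boxes determine measures (fundamental_lemma); this is what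
    relates them to the chosen representatives. And the difference quotients
    of f are bounded in the weighted norm by the weak derivative of f
    (dq_bound): the pairing y |-> \int f(x) xi(x + y) dx with a test function
    xi is smooth, and the mean value theorem applies to it. *)

(** * Lebesgue measure on row vectors *)

Section rV_norm.
Context {R : realType} {d : nat}.
Implicit Types x : 'rV[R]_d.

Lemma rV_normP x r : 0 <= r -> reflect (forall i, `|x ord0 i| <= r) (`|x| <= r).
Proof.
move=> r0; rewrite [`|x|]/Num.norm/= mx_normrE; apply: (iffP (bigmax_leP _ _ _ _)) => /=.
  by move=> [_ H] i; exact: (H (ord0, i)).
by move=> H; split => // -[i j] _ /=; rewrite (ord1 i).
Qed.

Lemma coord_le_norm x i : `|x ord0 i| <= `|x|.
Proof. by move: i; apply/rV_normP. Qed.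

Lemma rV_ltP x r : 0 < r -> reflect (forall i, `|x ord0 i| < r) (`|x| < r).
Proof.
move=> r0; rewrite [`|x|]/Num.norm/= mx_normrE; apply: (iffP (bigmax_ltP _ _ _ _)) => /=.
  by move=> [_ H] i; exact: (H (ord0, i)).
by move=> H; split => // -[i j] _ /=; rewrite (ord1 i).
Qed.

End rV_norm.

Section rV_measure.
Context {R : realType} {d : nat}.
Local Notation T := 'rV[R]_d.
Local Notation leb := (@lebesgue_rV R d).

Lemma measurable_box (A : 'I_d -> set R) : (forall i, measurable (A i)) ->
  measurable [set v : T | forall i, A i (v ord0 i)].
Proof.
move=> mA; rewrite (_ : [set _ | _] =
    \bigcap_i ((fun v : T => v ord0 i) @^-1` (A i))).
  apply: fin_bigcap_measurable => // i _; rewrite -[X in measurable X]setTI.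
  exact: measurable_coord.
by apply/seteqP; split => v /= vA i; [move=> _; exact: vA|exact: vA].
Qed.

(** The sigma-algebra is generated by the coordinates; open sets belong to it
    because they are countable unions of rational cubes. *)
Lemma open_measurable_rV (U : set T) : open U -> measurable U.
Proof.
move=> oU.
pose B (k : 'rV[rat]_d * nat) : set T :=
  [set v | forall i, (fun z : R => `|ratr (k.1 ord0 i) - z| < k.2.+1%:R^-1) (v ord0 i)].
have mB k : measurable (B k).
  apply: (@measurable_box (fun i => [set z : R | `|ratr (k.1 ord0 i) - z| < k.2.+1%:R^-1])) => i.
  rewrite (_ : [set x | _] = ball (ratr (k.1 ord0 i) : R) k.2.+1%:R^-1) //.
  exact: measurable_ball.
pose D := [set k : 'rV[rat]_d * nat | B k `<=` U].
rewrite (_ : U = \bigcup_(k in D) B k).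
  rewrite bigcup_mkcond; apply: countable_bigcupT_measurable; first exact: countableP.
  by move=> k; case: ifP => // _; exact: mB.
apply/seteqP; split => [v Uv|v [k Dk Bkv]]; last exact: Dk.
have /nbhs_ballP[e /= e0 eU] := open_nbhs_nbhs (conj oU Uv).
have [n /= ne] : exists n : nat, n.+1%:R^-1 < e / 2.
  have e20 : 0 < e / 2 by rewrite divr_gt0.
  have /cvgrPdist_lt/(_ _ e20)[N _ H] := @cvg_harmonic R.
  exists N; have := H N (leqnn N); rewrite sub0r normrN /harmonic /= gtr0_norm//.
have n0 : 0 < n.+1%:R^-1 :> R by rewrite invr_gt0.
have H i : exists q : rat, `|ratr q - v ord0 i| < n.+1%:R^-1.
  have : v ord0 i - n.+1%:R^-1 < v ord0 i + n.+1%:R^-1 by rewrite ltrD2l gtrN.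
  move=> /rat_in_itvoo[q]; rewrite in_itv/= => /andP[q1 q2]; exists q.
  by rewrite ltr_distl q1 q2.
have [q qv] := choice H.
exists ((\row_i q i), n); last by move=> i /=; rewrite mxE; exact: qv.
move=> w /= Bw; apply: eU; rewrite -ball_normE /=.
apply/rV_ltP => // i; rewrite !mxE.
have := Bw i; rewrite mxE /= => h1; have := qv i => h2.
rewrite (_ : v ord0 i - w ord0 i = (ratr (q i) - w ord0 i) - (ratr (q i) - v ord0 i)); last by ring.
apply: le_lt_trans (ler_normB _ _) _.
by rewrite [e]splitr ltrD ?(lt_trans h1) ?(lt_trans h2).
Qed.

Lemma continuous_measurable_rV (f : T -> R) : continuous f ->
  measurable_fun [set: T] f.
Proof.
move=> /continuousP cf; apply: (measurability _ (RGenOpens.measurableE R)).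
move=> _ [_ [a [b ->] <-]]; rewrite setTI; apply: open_measurable_rV.
exact/cf/interval_open.
Qed.

Lemma compact_measurable_rV (K : set T) : compact K -> measurable K.
Proof.
move=> cK; rewrite -[K]setCK; apply: measurableC; apply: open_measurable_rV.
rewrite openC; apply: compact_closed => //; exact: norm_hausdorff.
Qed.

Lemma cubeE r : 0 <= r ->
  [set x : T | `|x| <= r] = [set v : T | forall i, `[- r, r]%classic (v ord0 i)].
Proof.
move=> r0; apply/seteqP; split => x /=.
  by move/(rV_normP _ r0) => H i; rewrite in_itv/= -ler_norml.
by move=> H; apply/rV_normP => // i; have := H i; rewrite in_itv/= -ler_norml.
Qed.

Lemma cube_set0 r : r < 0 -> [set x : T | `|x| <= r] = set0.
Proof.
by move=> r0; apply/seteqP; split => // x /= /le_lt_trans/(_ r0); rewrite normr_lt0.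
Qed.

Lemma measurable_cube r : measurable [set x : T | `|x| <= r].
Proof.
have [r0|/cube_set0->//] := leP 0 r.
by rewrite cubeE//; exact: (@measurable_box (fun=> `[- r, r]%classic)).
Qed.

Lemma lebesgue_rV_bounded (r : R) : (leb [set x | (`|x| <= r)%R] < +oo)%E.
Proof.
have [r0|/cube_set0->//] := leP 0 r; last by rewrite measure0.
have lebE := @lebesgue_rV_rect R d (fun=> `[- r, r]%classic) (fun=> measurable_itv _).
rewrite -ge0_fin_numE ?measure_ge0// cubeE// lebE.
elim/big_ind : _ => //=; first exact: fin_numM.
by move=> i _; rewrite lebesgue_measure_itv/=; case: ifP.
Qed.

Definition obox (a b : 'I_d -> R) : set T :=
  [set v | forall i, a i < v ord0 i < b i].

Lemma measurable_obox a b : measurable (obox a b).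
Proof.
apply: (@measurable_box (fun i => `]a i, b i[%classic)) => i; exact: measurable_itv.
Qed.

Lemma obox_bounded a b : exists r, forall v, obox a b v -> `|v| <= r.
Proof.
exists (\sum_i (`|a i| + `|b i|)) => v abv; apply/rV_normP.
  by apply: sumr_ge0 => i _; rewrite addr_ge0.
move=> i; rewrite (bigD1 i)//= -[leLHS]addr0 lerD//; last first.
  by apply: sumr_ge0 => k _; rewrite addr_ge0.
have /andP[h1 h2] := abv i.
rewrite ler_norml; apply/andP; split.
  have := ler_norm (- a i); rewrite normrN; have := normr_ge0 (b i); lra.
have := ler_norm (b i); have := normr_ge0 (a i); lra.
Qed.

Let rV_sigma_obox : @measurable _ T = <<s [set A | exists a b, A = obox a b] >>.
Proof.
set G := [set A | _].
apply/seteqP; split; last first.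
  apply: smallest_sub; first exact: sigma_algebra_measurable.
  by move=> _ [a [b ->]]; exact: measurable_obox.
have [G0 GC GU] : sigma_algebra setT <<s G >> by exact: smallest_sigma_algebra.
apply: smallest_sub => //.
rewrite -bigcup_seq/=; apply: bigcup_sub => i _ A [B mB <-]/=; rewrite setTI.
have {mB} : (RGenOpens.G (R := R)).-sigma.-measurable B by rewrite -RGenOpens.measurableE.
suff : <<s RGenOpens.G (R := R) >> `<=` [set B | <<s G >> ((fun x : T => x ord0 i) @^-1` B)].
  by apply.
apply: smallest_sub.
  split => /=; first by rewrite preimage_set0.
    by move=> C /GC; rewrite !setTD preimage_setC.
  by move=> F /GU; rewrite preimage_bigcup.
move=> _ [x [y ->]] /=.
rewrite (_ : _ @^-1` _ = \bigcup_n
   obox (fun j => if j == i then x else - n%:R) (fun j => if j == i then y else n%:R)).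
  by apply: GU => n; apply: sub_sigma_algebra; eexists; eexists.
apply/seteqP; split => [v /=|v [n _ /(_ i)]]; last by rewrite eqxx /= in_itv.
rewrite in_itv /= => vxy; exists (Num.truncn `|v|).+1 => // j /=.
case: eqP => [->//|_]; rewrite -ltr_norml.
by rewrite (le_lt_trans (coord_le_norm v j))// truncnS_gt.
Qed.

(** Open boxes form a generating pi-system that exhausts the space. *)
Lemma rV_measure_unique (m1 m2 : {measure set T -> \bar R}) :
    (forall a b, m1 (obox a b) = m2 (obox a b)) ->
    (forall a b, m1 (obox a b) < +oo)%E ->
  forall A, measurable A -> m1 A = m2 A.
Proof.
move=> m12 m1oo A mA.
apply: (measure_unique [set A | exists a b, A = obox a b]
  (fun n => obox (fun=> - n%:R) (fun=> n%:R))) => //.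
- move=> _ _ [a [b ->]] [a' [b' ->]].
  exists (fun i => Num.max (a i) (a' i)), (fun i => Num.min (b i) (b' i)).
  apply/seteqP; split => v /=.
    by move=> [h h'] i; rewrite gt_max lt_min; have /andP[-> ->] := h i; have /andP[-> ->] := h' i.
  by move=> h; split => i; have := h i; rewrite gt_max lt_min => /andP[/andP[? ?] /andP[? ?]]; apply/andP.
- by move=> n; eexists; eexists.
- apply/seteqP; split => // v _; exists (Num.truncn `|v|).+1 => // j /=.
  by rewrite -ltr_norml (le_lt_trans (coord_le_norm v j))// truncnS_gt.
- by move=> _ [a [b ->]].
Qed.

Lemma measurable_shift (v : T) : measurable_fun [set: T] (fun x => x + v).
Proof.
apply: measurable_fun_coordP => i.
rewrite (_ : (fun _ => _) = (fun x : T => x ord0 i) \+ cst (v ord0 i)).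
  by apply: measurable_funD => //; exact: measurable_coord.
by apply/funext => x; rewrite mxE.
Qed.

Lemma lebesgue_rV_shift (v : T) A : measurable A ->
  leb ((fun x => x + v) @^-1` A) = leb A.
Proof.
move=> mA.
pose pf : {measure set T -> \bar R} :=
  @measure_function_pushforward__canonical__measure_function_Measure
    _ _ _ _ _ leb _ (measurable_shift v).
have lebE a b := @lebesgue_rV_rect R d (fun i => `]a i, b i[%classic) (fun=> measurable_itv _).
suff : pf A = leb A by [].
have pfE a b : pf (obox a b) = leb (obox a b).
  have -> : pf (obox a b) = leb (obox (fun i => a i - v ord0 i) (fun i => b i - v ord0 i)).
    rewrite /pf /= /pushforward; congr (leb _); apply/seteqP; split => x /= h i; have := h i;
      by rewrite mxE ltrBlDr ltrBrDr.
  rewrite [LHS]lebE [RHS]lebE; apply: eq_bigr => i _.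
  rewrite !lebesgue_measure_itv /= !lte_fin ltrD2r; case: ifP => // _.
  by rewrite -!EFinB; congr EFin; ring.
apply: rV_measure_unique => // a b; rewrite pfE.
have [r rab] := obox_bounded a b.
apply: le_lt_trans (lebesgue_rV_bounded r); apply: le_measure => //; rewrite ?inE.
- exact: measurable_obox.
- exact: measurable_cube.
Qed.

End rV_measure.

(** * Real-valued integrals *)

Lemma le_of_eq d (T : porderType d) (x y : T) : x = y -> (x <= y)%O.
Proof. by move=> ->. Qed.

Section integral.
Context {R : realType} {d : nat}.
Local Notation T := 'rV[R]_d.
Local Notation leb := (@lebesgue_rV R d).
Implicit Types (f g h : T -> R).

(** Integrability of a real-valued function over the whole space, where the
    integral is a real number and behaves linearly. *)
Definition integ f := leb.-integrable setT (EFin \o f).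

Lemma integ_meas f : integ f -> measurable_fun [set: T] f.
Proof. by move=> /measurable_int /measurable_EFinP. Qed.

Lemma integD f g : integ f -> integ g -> integ (fun x => f x + g x).
Proof. by move=> fi gi; exact: (integrableD measurableT fi gi). Qed.

Lemma integZ r f : integ f -> integ (fun x => r * f x).
Proof. by move=> fi; exact: (integrableZl measurableT r fi). Qed.

Lemma integ_ext f g : f =1 g -> integ f -> integ g.
Proof. by move=> /funext ->. Qed.

Lemma integN f : integ f -> integ (fun x => - f x).
Proof. by move=> /(integZ (-1)); apply: integ_ext => x; rewrite mulN1r. Qed.

Lemma integB f g : integ f -> integ g -> integ (fun x => f x - g x).
Proof. by move=> fi /integN; exact: integD. Qed.

Lemma integ0 : integ (fun _ => 0).
Proof. exact: integrable0. Qed.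

Lemma integ_sum (J : Type) (s : seq J) (F : J -> T -> R) :
  (forall i, integ (F i)) -> integ (fun x => \sum_(i <- s) F i x).
Proof.
move=> Fi; elim: s => [|i s IH].
  by apply: integ_ext integ0 => x; rewrite big_nil.
by apply: integ_ext (integD (Fi i) IH) => x; rewrite big_cons.
Qed.

Lemma integ_le f g : measurable_fun [set: T] f -> integ g ->
  (forall x, `|f x| <= g x) -> integ f.
Proof.
move=> mf gi fg; apply: (le_integrable measurableT _ _ gi).
  exact/measurable_EFinP.
by move=> x _ /=; rewrite lee_fin (le_trans (fg x)) ?ler_norm.
Qed.

Lemma IntD f g : integ f -> integ g ->
  \int[leb]_x (f x + g x) = \int[leb]_x f x + \int[leb]_x g x.
Proof. by move=> fi gi; exact: RintegralD. Qed.

Lemma IntZ r f : integ f -> \int[leb]_x (r * f x) = r * \int[leb]_x f x.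
Proof. by move=> fi; exact: RintegralZl. Qed.

Lemma eq_Int f g : f =1 g -> \int[leb]_x f x = \int[leb]_x g x.
Proof. by move=> /funext ->. Qed.

Lemma IntN f : integ f -> \int[leb]_x (- f x) = - \int[leb]_x f x.
Proof.
by move=> fi; rewrite -mulN1r -IntZ//; apply: eq_Int => x; rewrite mulN1r.
Qed.

Lemma IntB f g : integ f -> integ g ->
  \int[leb]_x (f x - g x) = \int[leb]_x f x - \int[leb]_x g x.
Proof. by move=> fi gi; exact: RintegralB. Qed.

Lemma Int0 : \int[leb]_x (0 : R) = 0.
Proof. by rewrite Rintegral_cst// mul0r. Qed.

Lemma Int_sum (J : Type) (s : seq J) (F : J -> T -> R) :
  (forall i, integ (F i)) ->
  \int[leb]_x (\sum_(i <- s) F i x) = \sum_(i <- s) \int[leb]_x F i x.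
Proof.
move=> Fi; elim: s => [|i s IH].
  by rewrite big_nil -[RHS]Int0; apply: eq_Int => x; rewrite big_nil.
rewrite big_cons -IH -IntD//; last exact: integ_sum.
by apply: eq_Int => x; rewrite big_cons.
Qed.

Lemma le_Int f g : integ f -> integ g -> (forall x, f x <= g x) ->
  \int[leb]_x f x <= \int[leb]_x g x.
Proof. by move=> fi gi fg; apply: le_Rintegral. Qed.

Lemma Int_ge0 f : (forall x, 0 <= f x) -> 0 <= \int[leb]_x f x.
Proof. by move=> f0; apply: Rintegral_ge0. Qed.

Lemma integ_norm f : integ f -> integ (fun x => `|f x|).
Proof. by move=> fi; exact: (integrable_norm fi). Qed.

Lemma le_norm_Int f : integ f -> `|\int[leb]_x f x| <= \int[leb]_x `|f x|.
Proof. by move=> fi; exact: le_normr_Rintegral. Qed.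

Lemma EFin_Int f : integ f ->
  (\int[leb]_x (f x)%:E = (\int[leb]_x f x)%R%:E)%E.
Proof. by move=> fi; rewrite /Rintegral fineK//; exact: integrable_fin_num. Qed.

Lemma ge0_integ f : measurable_fun [set: T] f -> (forall x, 0 <= f x) ->
  (\int[leb]_x (f x)%:E < +oo)%E -> integ f.
Proof.
move=> mf f0 foo; apply/integrableP; split; first exact/measurable_EFinP.
apply: le_lt_trans foo; apply: le_of_eq.
by apply: eq_integral => x _; rewrite /= ger0_norm.
Qed.

Lemma integ_lt_pinfty f : integ f -> (\int[leb]_x (f x)%:E < +oo)%E.
Proof. by move=> /EFin_Int ->; rewrite ltry. Qed.

Lemma ae_eq_Int f g : measurable_fun [set: T] f -> measurable_fun [set: T] g ->
  {ae leb, forall x, f x = g x} -> \int[leb]_x f x = \int[leb]_x g x.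
Proof.
move=> mf mg fg; congr fine; apply: ae_eq_integral => //; try exact/measurable_EFinP.
by apply: filterS fg => x /= ->.
Qed.

Lemma ae_eq_integ f g : integ f -> measurable_fun [set: T] g ->
  {ae leb, forall x, f x = g x} -> integ g.
Proof.
move=> fi mg fg; apply/integrableP; split; first exact/measurable_EFinP.
have mf := integ_meas fi; have /integrableP[_] := fi.
rewrite (ae_eq_integral (fun x => `|(EFin \o g) x|)%E) //.
- by apply/measurable_EFinP; exact: measurableT_comp.
- by apply/measurable_EFinP; exact: measurableT_comp.
- by apply: filterS fg => x /= ->.
Qed.

Lemma ae_le_Int f g : integ f -> integ g -> {ae leb, forall x, f x <= g x} ->
  \int[leb]_x f x <= \int[leb]_x g x.
Proof.
move=> fi gi fg.
rewrite (@ae_eq_Int g (fun x => Num.max (f x) (g x))).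
- apply: le_Int => //; last by move=> x; rewrite le_max lexx.
  apply: (@integ_le _ (fun x => `|f x| + `|g x|)).
  + exact: (measurable_maxr (integ_meas fi) (integ_meas gi)).
  + by apply: integD; exact: integ_norm.
  + by move=> x; rewrite /Num.max; case: ifP => _; rewrite ?lerDl ?lerDr.
- exact: integ_meas.
- exact: (measurable_maxr (integ_meas fi) (integ_meas gi)).
- by apply: filterS fg => x fgx; apply/esym/max_idPr.
Qed.

Lemma Int_eq0_ae f : integ f -> (forall x, 0 <= f x) ->
  \int[leb]_x f x = 0 -> {ae leb, forall x, f x = 0}.
Proof.
move=> fi f0 If0.
have : ae_eq leb setT (EFin \o f) (cst 0%E).
  apply/(ae_eq_integral_abs _ measurableT); first by apply/measurable_EFinP; exact: integ_meas.
  transitivity (\int[leb]_x (f x)%:E)%E.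
    by apply: eq_integral => x _ /=; rewrite ger0_norm.
  by rewrite EFin_Int// If0.
by apply: filterS => x /(_ Logic.I) /= [].
Qed.

Lemma integ_shift v f : integ f -> integ (fun x => f (x + v)).
Proof.
move=> fi; have mf := integ_meas fi; apply/integrableP; split.
  by apply/measurable_EFinP; exact: (measurableT_comp mf (measurable_shift v)).
pose pf := @measure_function_pushforward__canonical__measure_function_Measure
    _ _ _ _ _ leb _ (measurable_shift v).
have /integrableP[_] := fi.
rewrite [X in (X < _)%E -> _](_ : _ = (\int[pf]_x `|(f x)%:E|)%E).
  rewrite ge0_integral_pushforward//.
    exact: measurable_shift.
  by apply/measurable_EFinP; exact: measurableT_comp.
apply: eq_measure_integral => A mA _; rewrite -[LHS](lebesgue_rV_shift v)//.
Qed.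

Lemma Int_shift v f : integ f -> \int[leb]_x f (x + v) = \int[leb]_x f x.
Proof.
move=> fi; have mf := integ_meas fi.
pose pf := @measure_function_pushforward__canonical__measure_function_Measure
    _ _ _ _ _ leb _ (measurable_shift v).
rewrite /Rintegral; congr fine; symmetry.
transitivity (\int[pf]_x (f x)%:E)%E.
  apply: eq_measure_integral => A mA _; rewrite -[LHS](lebesgue_rV_shift v)//.
rewrite integral_pushforward//.
- exact: measurable_shift.
- exact/measurable_EFinP.
- exact: integ_shift.
Qed.

Lemma Int_dct (f_ : nat -> T -> R) f g :
  (forall n, measurable_fun [set: T] (f_ n)) ->
  (forall x, f_ ^~ x @ \oo --> f x) -> integ g ->
  (forall n x, `|f_ n x| <= g x) ->
  integ f /\ \int[leb]_x f_ n x @[n --> \oo] --> \int[leb]_x f x.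
Proof.
move=> mf_ f_f gi fg.
have mf : measurable_fun [set: T] f.
  by apply: (measurable_fun_cvg (h := f_)) => // x _; exact: f_f.
have := @dominated_convergence _ _ _ leb setT measurableT
  (fun n => EFin \o f_ n) (EFin \o f) (EFin \o g).
move=> [].
- by move=> n; exact/measurable_EFinP.
- exact/measurable_EFinP.
- by apply: aeW => x _; apply: cvg_EFin; [exact: nearW|exact: f_f].
- exact: gi.
- by apply: aeW => x n _; rewrite lee_fin.
- move=> fi _ cf; split => //.
  apply: fine_cvg; rewrite -EFin_Int//.
Qed.

(** Optimizing in t; when a = 0 no choice of t is bounded unless b = 0. *)
Lemma discriminant_le (a b c : R) : 0 <= a ->
  (forall t, 2 * t * b <= t ^+ 2 * a + c) -> b ^+ 2 <= a * c.
Proof.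
rewrite le_eqVlt => /predU1P[<-|a0] H.
  have [->|b0] := eqVneq b 0; first by rewrite expr0n mul0r.
  have := H ((c + 1) / (2 * b)); rewrite mulr0 add0r mul0r.
  rewrite (_ : 2 * _ * b = c + 1); last by field.
  by move=> ?; exfalso; lra.
have := H (b / a); rewrite (_ : 2 * _ * b = 2 * (b ^+ 2 / a)); last by field; lra.
rewrite (_ : _ ^+ 2 * a = b ^+ 2 / a); last by field; lra.
by move=> h; rewrite mulrC -ler_pdivrMr//; lra.
Qed.

(** Cauchy-Schwarz under the integral sign, from the nonnegativity of the
    quadratic polynomial in t; keeping F and G abstract lets the same lemma
    serve for sums over finite index sets and for weights. *)
Lemma Int_CauchySchwarz F G h : measurable_fun [set: T] h ->
    integ F -> integ G -> (forall x, 0 <= F x) -> (forall x, 0 <= G x) ->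
    (forall x, h x ^+ 2 <= F x * G x) ->
  integ h /\ (\int[leb]_x h x) ^+ 2 <= \int[leb]_x F x * \int[leb]_x G x.
Proof.
move=> mh Fi Gi F0 G0 hFG.
have young t x : 2 * t * h x <= t ^+ 2 * F x + G x.
  have FG0 : 0 <= t ^+ 2 * F x + G x.
    by apply: addr_ge0 => //; apply: mulr_ge0 => //; exact: sqr_ge0.
  have [th|th] := leP (t * h x) 0.
    by apply: le_trans FG0; rewrite -mulrA pmulr_rle0.
  have th0 : 0 <= 2 * t * h x.
    by rewrite -mulrA; apply: mulr_ge0 => //; exact: ltW.
  rewrite -ler_sqr ?nnegrE//.
  rewrite (_ : (2 * t * h x) ^+ 2 = 4 * t ^+ 2 * (h x) ^+ 2); last by ring.
  apply: (@le_trans _ _ (4 * t ^+ 2 * (F x * G x))).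
    by rewrite ler_wpM2l//; apply: mulr_ge0 => //; exact: sqr_ge0.
  rewrite -subr_ge0 (_ : _ - _ = (t ^+ 2 * F x - G x) ^+ 2) ?sqr_ge0//; ring.
have hi : integ h.
  apply: (@integ_le _ (fun x => F x + G x)) => //; first exact: integD.
  move=> x; have := young 1 x; have := young (-1) x; have := F0 x; have := G0 x.
  by rewrite expr1n sqrrN expr1n !mul1r => *; rewrite ler_norml; apply/andP; split; lra.
split => //; apply: discriminant_le; first exact: Int_ge0.
move=> t; rewrite -!IntZ// -IntD//; last exact: integZ.
by apply: le_Int => //; [exact: integZ|apply: integD => //; exact: integZ].
Qed.

End integral.

(** * Continuous functions and local integrability *)

Section local_spaces.
Context {R : realType} {d : nat}.
Local Notation T := 'rV[R]_d.
Local Notation leb := (@lebesgue_rV R d).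
Implicit Types (f g a : T -> R).

Lemma contM f g : continuous f -> continuous g -> continuous (fun x => f x * g x).
Proof. by move=> cf cg x; apply: (cvgM (cf x) (cg x)). Qed.

Lemma contD f g : continuous f -> continuous g -> continuous (fun x => f x + g x).
Proof. by move=> cf cg x; apply: (cvgD (cf x) (cg x)). Qed.

Lemma contB f g : continuous f -> continuous g -> continuous (fun x => f x - g x).
Proof. by move=> cf cg x; apply: (cvgB (cf x) (cg x)). Qed.

Lemma contZ k f : continuous f -> continuous (fun x => k * f x).
Proof. by apply: contM; exact: cst_continuous. Qed.

Lemma contX2 f : continuous f -> continuous (fun x => f x ^+ 2).
Proof. by move=> cf; exact: contM. Qed.

Lemma cont_shift (v : T) f : continuous f -> continuous (fun x : T => f (x + v)).
Proof.
move=> cf x; have h : (fun y : T => y + v) @ x --> x + v.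
  exact: (@cvgD R _ T (nbhs x) _ id (cst v) _ _ cvg_id (cvg_cst v)).
exact: (cvg_comp _ _ h (cf (x + v))).
Qed.

Lemma compact_cube r : compact [set x : T | `|x| <= r].
Proof.
have [r0|/cube_set0->] := leP 0 r; last exact: compact0.
rewrite cubeE//; apply: (@rV_compact _ _ (fun=> `[- r, r]%classic)) => _.
exact: segment_compact.
Qed.

Lemma continuous_bounded f r : continuous f ->
  exists2 M, 0 <= M & forall x, `|x| <= r -> `|f x| <= M.
Proof.
move=> cf.
have : compact (f @` [set x : T | `|x| <= r]).
  apply: continuous_compact; last exact: compact_cube.
  exact: continuous_subspaceT.
move=> /compact_bounded[M [_ HM]].
exists (Num.max 0 (M + 1)); first by rewrite le_max lexx.
move=> x xr; apply: (le_trans (HM (M + 1) _ (f x) _)); last 1 first.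
- by rewrite le_max lexx orbT.
- by rewrite ltrDl.
- by exists x.
Qed.

Definition csupp f := exists r, forall x, r < `|x| -> f x = 0.

Lemma csupp_bounded f : continuous f -> csupp f ->
  exists2 M, 0 <= M & forall x, `|f x| <= M.
Proof.
move=> cf [r fr]; have [M M0 HM] := continuous_bounded r cf.
by exists M => // x; have [/HM//|/fr->] := leP `|x| r; rewrite normr0.
Qed.

Lemma csuppM f a : csupp a -> csupp (fun x => f x * a x).
Proof. by move=> [r ar]; exists r => x /ar ->; rewrite mulr0. Qed.

Lemma csuppMl f a : csupp a -> csupp (fun x => a x * f x).
Proof. by move=> [r ar]; exists r => x /ar ->; rewrite mul0r. Qed.

Lemma csuppD f g : csupp f -> csupp g -> csupp (fun x => f x + g x).
Proof.
move=> [r fr] [s gs]; exists (Num.max r s) => x; rewrite gt_max => /andP[rx sx].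
by rewrite fr// gs// addr0.
Qed.

Lemma csupp_shift v f : csupp f -> csupp (fun x => f (x + v)).
Proof.
move=> [r fr]; exists (r + `|v|) => x rx; apply: fr.
have := ler_normB (x + v) v; rewrite addrK; lra.
Qed.

Local Notation loc := (@locally_integrable_rV R d).

(** Restriction to a cube, so that global integrability lemmas apply. *)
Lemma loc_elim f r : loc f ->
  exists g, [/\ integ g, forall x, 0 <= g x & forall x, `|x| <= r -> `|f x| <= g x].
Proof.
move=> [mf /(_ _ (compact_cube (r := r))) fi].
exists (fun x => `|(f \_ [set x | `|x| <= r]) x|); split => // [|x xr].
  apply: integ_norm; rewrite /integ -restrict_EFin.
  by apply/(integrable_mkcond _ (measurable_cube r)).
by rewrite patchE mem_set.
Qed.

Lemma loc_intro f : measurable_fun [set: T] f ->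
  (forall r, exists2 g, integ g & forall x, `|x| <= r -> `|f x| <= g x) -> loc f.
Proof.
move=> mf H; split => // K cK.
have [M [_ HM]] := compact_bounded cK.
have [g gi fg] := H (M + 1).
have mK := compact_measurable_rV cK.
apply: (le_integrable mK (g := EFin \o g)).
- by apply/measurable_EFinP; exact: measurable_funS mf.
- move=> x Kx; rewrite /= lee_fin (le_trans (fg _ _)) ?ler_norm//.
  by apply: HM => //; rewrite ltrDl.
- exact: integrableS gi.
Qed.

Lemma integ_loc f : integ f -> loc f.
Proof.
move=> fi; apply: loc_intro; first exact: integ_meas.
by move=> r; exists (fun x => `|f x|) => //; exact: integ_norm.
Qed.

Lemma integ_indic_cube r : integ (\1_[set x : T | `|x| <= r]).
Proof.
apply: ge0_integ => //; first exact: measurable_indic (measurable_cube r).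
by rewrite integral_indic// ?setIT; [exact: lebesgue_rV_bounded|exact: measurable_cube].
Qed.

Lemma loc_continuous f : continuous f -> loc f.
Proof.
move=> cf; apply: loc_intro; first exact: continuous_measurable_rV.
move=> r; have [M M0 HM] := continuous_bounded r cf.
exists (fun x => M * \1_[set x : T | `|x| <= r] x); first exact/integZ/integ_indic_cube.
by move=> x xr; rewrite indicE mem_set//= mulr1 HM.
Qed.

Lemma loc_meas f : loc f -> measurable_fun [set: T] f.
Proof. by case. Qed.

Lemma locD f g : loc f -> loc g -> loc (fun x => f x + g x).
Proof.
move=> fl gl; apply: loc_intro; first by apply: measurable_funD; exact: loc_meas.
move=> r; have [F [Fi _ fF]] := loc_elim r fl; have [G [Gi _ gG]] := loc_elim r gl.
exists (fun x => F x + G x); first exact: integD.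
by move=> x xr; rewrite (le_trans (ler_normD _ _))// lerD ?fF ?gG.
Qed.

Lemma locM f a : loc f -> continuous a -> loc (fun x => f x * a x).
Proof.
move=> fl ca; apply: loc_intro.
  by apply: measurable_funM; [exact: loc_meas|exact: continuous_measurable_rV].
move=> r; have [F [Fi F0 fF]] := loc_elim r fl.
have [M M0 HM] := continuous_bounded r ca.
exists (fun x => M * F x); first exact: integZ.
by move=> x xr; rewrite normrM mulrC ler_pM ?fF ?HM.
Qed.

Lemma loc_ext f g : f =1 g -> loc f -> loc g.
Proof. by move=> /funext ->. Qed.

Lemma locZ k f : loc f -> loc (fun x => k * f x).
Proof.
move=> fl; apply: (@loc_ext (fun x => f x * k) (fun x => k * f x)) => [x|]; first exact: mulrC.
by apply: (@locM f (fun=> k)) => //; exact: cst_continuous.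
Qed.

Lemma loc_le f g : measurable_fun [set: T] f -> loc g ->
  (forall x, `|f x| <= g x) -> loc f.
Proof.
move=> mf gl fg; apply: loc_intro => // r; have [G [Gi _ gG]] := loc_elim r gl.
by exists G => // x xr; rewrite (le_trans (fg x))// (le_trans (ler_norm _))// gG.
Qed.

Lemma loc_shift v f : loc f -> loc (fun x => f (x + v)).
Proof.
move=> fl; apply: loc_intro.
  exact: (measurableT_comp (loc_meas fl) (measurable_shift v)).
move=> r; have [F [Fi F0 fF]] := loc_elim (r + `|v|) fl.
exists (fun x => F (x + v)); first exact: integ_shift.
by move=> x xr; rewrite fF// (le_trans (ler_normD _ _))// lerD2r.
Qed.

Lemma loc_csupp f : loc f -> csupp f -> integ f.
Proof.
move=> fl [r fr]; have [F [Fi F0 fF]] := loc_elim r fl.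
apply: (integ_le _ Fi); first exact: loc_meas.
by move=> x; have [/fF//|/fr->] := leP `|x| r; rewrite normr0.
Qed.

Lemma integM_csupp f a : loc f -> continuous a -> csupp a ->
  integ (fun x => f x * a x).
Proof. by move=> fl ca sa; apply: loc_csupp (csuppM _ sa); exact: locM. Qed.

Lemma integ_continuous f : continuous f -> csupp f -> integ f.
Proof. by move=> cf; apply: loc_csupp; exact: loc_continuous. Qed.

Definition l2loc f := measurable_fun [set: T] f /\ loc (fun x => f x ^+ 2).

Lemma l2loc_loc f : l2loc f -> loc f.
Proof.
move=> [mf fl]; apply: (@loc_le _ (fun x => f x ^+ 2 + 1)) => //.
  by apply: locD => //; apply: loc_continuous ; exact: cst_continuous.
move=> x; rewrite -real_normK ?num_real//; have := normr_ge0 (f x).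
move: `|f x| => y y0; nra.
Qed.

Lemma l2loc_mul f g : l2loc f -> l2loc g -> loc (fun x => f x * g x).
Proof.
move=> [mf fl] [mg gl]; apply: (@loc_le _ (fun x => f x ^+ 2 + g x ^+ 2)).
- exact: measurable_funM.
- exact: locD.
- move=> x; rewrite normrM -[f x ^+ 2]real_normK ?num_real// -[g x ^+ 2]real_normK ?num_real//.
  move: `|f x| `|g x| => y z; nra.
Qed.

Lemma l2loc_le f F : measurable_fun [set: T] f -> loc F ->
  (forall x, f x ^+ 2 <= F x) -> l2loc f.
Proof.
move=> mf Fl fF; split => //; apply: (loc_le _ Fl) => [|x].
  exact: measurable_funX.
by rewrite ger0_norm ?sqr_ge0.
Qed.

Lemma l2locD f g : l2loc f -> l2loc g -> l2loc (fun x => f x + g x).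
Proof.
move=> [mf fl] [mg gl].
apply: (@l2loc_le _ (fun x => 2 * (f x ^+ 2) + 2 * (g x ^+ 2))).
- exact: measurable_funD.
- by apply: locD; exact: locZ.
- move=> x; rewrite -subr_ge0 (_ : _ - _ = (f x - g x) ^+ 2) ?sqr_ge0//; ring.
Qed.

Lemma l2locM f a : l2loc f -> continuous a -> l2loc (fun x => f x * a x).
Proof.
move=> [mf fl] ca; split.
  by apply: measurable_funM => //; exact: continuous_measurable_rV.
apply: (@loc_ext (fun x => f x ^+ 2 * a x ^+ 2) (fun x => (f x * a x) ^+ 2)) => [x|].
  by rewrite exprMn.
by apply: (locM fl); exact: contX2.
Qed.

Lemma l2loc_ext f g : f =1 g -> l2loc f -> l2loc g.
Proof. by move=> /funext ->. Qed.

Lemma l2locZ k f : l2loc f -> l2loc (fun x => k * f x).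
Proof.
move=> fl; apply: (@l2loc_ext (fun x => f x * k) (fun x => k * f x)) => [x|]; first exact: mulrC.
by apply: (@l2locM f (fun=> k)) => //; exact: cst_continuous.
Qed.

Lemma l2locB f g : l2loc f -> l2loc g -> l2loc (fun x => f x - g x).
Proof.
by move=> fl /(l2locZ (-1)) /(l2locD fl); apply: l2loc_ext => x; rewrite mulN1r.
Qed.

Lemma l2loc_shift v f : l2loc f -> l2loc (fun x => f (x + v)).
Proof.
move=> [mf fl]; split; first exact: (measurableT_comp mf (measurable_shift v)).
exact: loc_shift fl.
Qed.

Lemma l2loc_continuous f : continuous f -> l2loc f.
Proof.
move=> cf; split; first exact: continuous_measurable_rV.
by apply: loc_continuous; exact: contX2.
Qed.

Lemma l2loc_sum (J : Type) (s : seq J) (F : J -> T -> R) :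
  (forall i, l2loc (F i)) -> l2loc (fun x => \sum_(i <- s) F i x).
Proof.
move=> Fi; elim: s => [|i s IH].
  apply: (@l2loc_ext (fun=> 0) _) => [x|]; first by rewrite big_nil.
  by apply: l2loc_continuous ; exact: cst_continuous.
by apply: l2loc_ext (l2locD (Fi i) IH) => x; rewrite big_cons.
Qed.

(** Dominated convergence is a statement on sequences; this turns it into
    continuity of integrals with a vector parameter. *)
Lemma seq_continuous f x :
  (forall u : nat -> T, u n @[n --> \oo] --> x -> f (u n) @[n --> \oo] --> f x) ->
  {for x, continuous f}.
Proof.
move=> H; apply/(@cvgrPdist_lt R R T (nbhs x) (nbhs_filter x)) => e e0.
apply: contrapT => /nbhs_ballP nH.
have E (n : nat) : exists y : T, ball x n.+1%:R^-1 y /\ e <= `|f x - f y|.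
  apply: contrapT => nE; apply: nH; exists n.+1%:R^-1 => /=; first by rewrite invr_gt0.
  move=> y xy; rewrite ltNge; apply/negP => h; apply: nE; exists y; split => //.
have [u Hu] := choice E.
have : f (u n) @[n --> \oo] --> f x.
  apply: H; apply/cvgrPdist_lt => r r0.
  have /cvgrPdist_lt/(_ _ r0)[N _ HN] := @cvg_harmonic R.
  exists N => // n /HN; rewrite sub0r normrN /harmonic/= gtr0_norm//.
  by apply: lt_trans; have [+ _] := Hu n; rewrite -ball_normE.
move=> /cvgrPdist_lt/(_ _ e0)[N _ /(_ N (leqnn N))].
by have [_] := Hu N; rewrite leNgt => /negP.
Qed.

End local_spaces.

(** * Calculus of C^k functions *)

Section Ck_calculus.
Context {R : realType} {d : nat}.
Local Notation T := 'rV[R]_d.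
Implicit Types (f g : T -> R) (x : T) (i : 'I_d).

Local Notation e_ i := (delta_mx ord0 i : T).

Lemma norm_scale_delta (s : R) i : `|s *: e_ i| <= `|s|.
Proof.
apply/rV_normP => // j; rewrite !mxE eqxx /=.
by case: (j == i); rewrite ?mulr1// mulr0 normr0.
Qed.

(** A directional derivative is a derivative along a line, which gives access
    to the one-variable chain rule and mean value theorem. *)
Lemma is_derive_ray f x v s l :
  is_derive (x + s *: v) v f l <-> is_derive s 1 (fun r : R => f (x + r *: v)) l.
Proof.
pose g1 := (fun h : R => h^-1 *: ((f \o shift (x + s *: v)) (h *: v) - f (x + s *: v))).
pose g2 := (fun h : R => h^-1 *: (((fun r : R => f (x + r *: v)) \o shift s) (h *: (1:R)) - f (x + s *: v))).
have E : g1 = g2.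
  apply/funext => h; rewrite /g1 /g2 /= [h *: 1]mulr1 scalerDl.
  by rewrite [h *: v + _]addrC -addrA [s *: v + _]addrC.
split => -[dfx <-].
- apply: DeriveDef; first by move: dfx; rewrite /derivable -/g1 -/g2 E.
  by rewrite /derive -/g1 -/g2 E.
- apply: DeriveDef; first by move: dfx; rewrite /derivable -/g1 -/g2 E.
  by rewrite /derive -/g1 -/g2 E.
Qed.

Lemma is_derive_quotient f x v l : is_derive x v f l ->
  (fun h : R => h^-1 * (f (x + h *: v) - f x)) @ 0^' --> l.
Proof.
move=> [dfx <-]; move: dfx; rewrite /derivable.
rewrite /derive; set g1 := (fun h : R => _); set g2 := (fun h : R => _).
by have -> : g1 = g2 by apply/funext => h; rewrite /g1 /g2 /= [_ + x]addrC.
Qed.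

Lemma quotient_is_derive f x v l :
  (fun h : R => h^-1 * (f (x + h *: v) - f x)) @ 0^' --> l -> is_derive x v f l.
Proof.
set g2 := (fun h : R => _) => H.
have E : (fun h => h^-1 *: ((f \o shift x) (h *: v) - f x)) = g2.
  by apply/funext => h; rewrite /g2 /= [_ + x]addrC.
apply: DeriveDef; rewrite /derivable /derive E; first by apply/cvg_ex; exists l.
exact: cvg_lim.
Qed.

Lemma is_derive_comp1 (phi : R -> R) f x v a l :
  is_derive (f x) 1 phi a -> is_derive x v f l -> is_derive x v (phi \o f) (a * l).
Proof.
move=> phia fl; rewrite -[x](addr0 x) -(scale0r v); apply/is_derive_ray.
apply: (@is_derive1_comp _ phi (fun r : R => f (x + r *: v))).
  by rewrite scale0r addr0.
by apply/is_derive_ray; rewrite scale0r addr0.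
Qed.

Lemma is_derive_prodM f g x v a b : is_derive x v f a -> is_derive x v g b ->
  is_derive x v (fun x => f x * g x) (f x * b + g x * a).
Proof. by move=> fa gb; exact: is_deriveM. Qed.

Lemma is_derive_addD f g x v a b : is_derive x v f a -> is_derive x v g b ->
  is_derive x v (fun x => f x + g x) (a + b).
Proof. by move=> fa gb; exact: is_deriveD. Qed.

Lemma is_derive_scaleZ k f x v a : is_derive x v f a ->
  is_derive x v (fun x => k * f x) (k * a).
Proof.
move=> fa; have := is_derive_prodM (is_derive_cst k x v) fa.
by rewrite mulr0 addr0.
Qed.

Lemma is_derive_translate f x v w l : is_derive (x + w) v f l ->
  is_derive x v (fun x => f (x + w)) l.
Proof.
move=> fl; rewrite -[x](addr0 x) -(scale0r v); apply/is_derive_ray.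
apply: (@is_derive_eq _ _ _ _ _ _ _ l) => //.
have : is_derive ((x + w) + 0 *: v) v f l by rewrite scale0r addr0.
move=> /is_derive_ray; congr is_derive.
by apply/funext => r; rewrite addrAC.
Qed.

Lemma is_derive_scale f x v (c l : R) : is_derive (c *: x) v f l ->
  is_derive x v (fun x => f (c *: x)) (c * l).
Proof.
move=> fl; rewrite -[x](addr0 x) -(scale0r v); apply/is_derive_ray.
have fl' : is_derive (c * 0) 1 (fun r : R => f (c *: x + r *: v)) l.
  by apply/is_derive_ray; rewrite mulr0 scale0r addr0.
have cl : is_derive (0 : R) 1 (fun r : R => c * r) c.
  have := is_deriveM (is_derive_cst c (0:R) 1) (is_derive_id (0:R) 1).
  by rewrite scaler0 addr0 [_ *: _]mulr1.
rewrite mulrC.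
have := @is_derive1_comp _ (fun r : R => f (c *: x + r *: v)) (fun r => c * r) 0 _ _ fl' cl.
rewrite mulrC; congr is_derive.
by apply/funext => r /=; rewrite scalerDr scalerA.
Qed.

Lemma CkS k f : Ck k.+1 f -> Ck k f.
Proof.
elim: k f => [|k IH] f [cf Hf]; first by [].
by split=> // i; have [df Hi] := Hf i; split=> //; exact: IH.
Qed.

Lemma Ck_continuous k f : Ck k f -> continuous f.
Proof. by case: k => [|k] []. Qed.

Lemma Ck_partial k f i : Ck k.+1 f -> Ck k (partial i f).
Proof. by move=> [_ /(_ i)[]]. Qed.

Lemma Ck_partial_continuous f i : Ck 1 f -> continuous (partial i f).
Proof. by move=> /(Ck_partial i); exact: Ck_continuous. Qed.

Lemma Ck_is_derive k f i x : Ck k.+1 f -> is_derive x (e_ i) f (partial i f x).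
Proof. by move=> [_ /(_ i)[+ _]] => /(_ x) /derivableP. Qed.

Lemma CkI k f (F : 'I_d -> T -> R) : continuous f ->
  (forall i x, is_derive x (e_ i) f (F i x)) -> (forall i, Ck k (F i)) -> Ck k.+1 f.
Proof.
move=> cf dF FC; split => // i.
have -> : partial i f = F i by apply/funext => x; apply: derive_val.
by split => // x; have [] := dF i x.
Qed.

Lemma partialE f (i : 'I_d) F : (forall x, is_derive x (e_ i) f (F x)) -> partial i f = F.
Proof. by move=> dF; apply/funext => x; apply: derive_val. Qed.

Lemma Ck_cst k (c : R) : Ck k (fun _ : T => c).
Proof.
elim: k c => [|k IH] c; first by split => //; exact: cst_continuous.
apply: (@CkI _ _ (fun _ _ => 0)) => //; first exact: cst_continuous.
Qed.

Lemma CkD k f g : Ck k f -> Ck k g -> Ck k (fun x => f x + g x).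
Proof.
elim: k f g => [|k IH] f g fC gC.
  by split => //; apply: contD; exact: (@Ck_continuous 0).
apply: (@CkI _ _ (fun i x => partial i f x + partial i g x)).
- by apply: contD; exact: (@Ck_continuous k.+1).
- by move=> i x; apply: is_derive_addD; [exact: Ck_is_derive fC|exact: Ck_is_derive gC].
- by move=> i; apply: IH; exact: Ck_partial.
Qed.

Lemma CkM k f g : Ck k f -> Ck k g -> Ck k (fun x => f x * g x).
Proof.
elim: k f g => [|k IH] f g fC gC.
  by split => //; apply: contM; exact: (@Ck_continuous 0).
apply: (@CkI _ _ (fun i x => f x * partial i g x + g x * partial i f x)).
- by apply: contM; exact: (@Ck_continuous k.+1).
- by move=> i x; apply: is_derive_prodM; [exact: Ck_is_derive fC|exact: Ck_is_derive gC].
- by move=> i; apply: CkD; apply: IH; try exact: CkS; exact: Ck_partial.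
Qed.

Lemma CkZ k c f : Ck k f -> Ck k (fun x => c * f x).
Proof. by apply: CkM; exact: Ck_cst. Qed.

Lemma Ck_prod k (J : Type) (s : seq J) (F : J -> T -> R) :
  (forall j, Ck k (F j)) -> Ck k (fun x => \prod_(j <- s) F j x).
Proof.
move=> FC; elim: s => [|j s IH].
  rewrite (_ : (fun _ => _) = (fun=> 1)); first exact: Ck_cst.
  by apply/funext => x; rewrite big_nil.
rewrite (_ : (fun _ => _) = (fun x => F j x * \prod_(j <- s) F j x)).
  exact: CkM.
by apply/funext => x; rewrite big_cons.
Qed.

Lemma Ck_shift k w f : Ck k f -> Ck k (fun x => f (x + w)).
Proof.
elim: k f => [|k IH] f fC.
  by split => //; apply: cont_shift; exact: (@Ck_continuous 0).
apply: (@CkI _ _ (fun i x => partial i f (x + w))).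
- by apply: cont_shift; exact: (@Ck_continuous k.+1).
- by move=> i x; apply: is_derive_translate; exact: Ck_is_derive fC.
- by move=> i; apply: IH; exact: Ck_partial.
Qed.

Lemma cont_scale c f : continuous f -> continuous (fun x => f (c *: x)).
Proof.
move=> cf x; have h : (fun y : T => c *: y) @ x --> c *: x.
  exact: scaler_continuous.
exact: (cvg_comp _ _ h (cf (c *: x))).
Qed.

Lemma Ck_scale k c f : Ck k f -> Ck k (fun x => f (c *: x)).
Proof.
elim: k f => [|k IH] f fC.
  by split => //; apply: cont_scale; exact: (@Ck_continuous 0).
apply: (@CkI _ _ (fun i x => c * partial i f (c *: x))).
- by apply: cont_scale; exact: (@Ck_continuous k.+1).
- by move=> i x; apply: is_derive_scale; exact: Ck_is_derive fC.
- by move=> i; apply: CkZ; apply: IH; exact: Ck_partial.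
Qed.

Lemma cont_coord i : continuous (fun x : T => x ord0 i).
Proof. by move=> x; exact: coord_continuous. Qed.

Lemma is_derive_coord i k x :
  is_derive x (e_ i) (fun x : T => x ord0 k) (k == i)%:R.
Proof.
apply: quotient_is_derive; apply: cvg_near_cst.
near=> h; have h0 : h != 0 by near: h; exact: nbhs_dnbhs_neq.
rewrite !mxE eqxx /=; case: (k == i); rewrite ?mulr1 ?mulr0 ?addr0 ?subrr ?mulr0//.
by rewrite addrAC subrr add0r mulVf.
Unshelve. all: by end_near. Qed.

(** The mean value theorem along a coordinate line; it makes difference
    quotients bounded by the partial derivative. *)
Lemma partial_MVT f i x s : Ck 1 f ->
  exists2 r, `|r| <= `|s| & f (x + s *: e_ i) - f x = s * partial i f (x + r *: e_ i).
Proof.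
move=> fC.
have dr (r : R) : is_derive r 1 (fun r : R => f (x + r *: e_ i)) (partial i f (x + r *: e_ i)).
  by apply/is_derive_ray; exact: (Ck_is_derive _ _ fC).
have cr (a b : R) : {within `[a, b], continuous (fun r : R => f (x + r *: e_ i))}.
  apply: continuous_subspaceT => r.
  by apply/differentiable_continuous/derivable1_diffP; case: (dr r).
have [s0|s0] := leP 0 s.
  have [r + E] := MVT_segment s0 (fun r _ => dr r) (cr _ _).
  rewrite in_itv /= => /andP[r0 rs]; exists r; first by rewrite !ger0_norm.
  by move: E; rewrite scale0r addr0 subr0 mulrC.
have [r + E] := MVT_segment (ltW s0) (fun r _ => dr r) (cr _ _).
rewrite in_itv /= => /andP[r0 rs]; exists r.
  by rewrite (ler0_norm rs) (ltr0_norm s0) lerN2.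
move: E; rewrite scale0r addr0 sub0r mulrN mulrC => E.
by rewrite -opprB E opprK.
Qed.

Lemma test_csupp f : test_function f -> csupp f.
Proof.
move=> [_ /compact_bounded[M [_ HM]]]; exists (M + 1) => x Mx.
apply: contrapT => /eqP fx.
have : `|x| <= M + 1 by apply: (HM (M + 1)); [rewrite ltrDl|exact: subset_closure].
by rewrite leNgt Mx.
Qed.

(** Vanishing outside a cube replaces compactness of the closure of the
    support, and is easier to propagate through operations. *)
Lemma csupp_test f : (forall k, Ck k f) -> csupp f -> test_function f.
Proof.
move=> fC [r fr]; split => //.
apply: (subclosed_compact _ (compact_cube (r := r))); first exact: closed_closure.
have : closed [set x : T | `|x| <= r].
  by apply: compact_closed; [exact: norm_hausdorff|exact: compact_cube].
move=> cc; rewrite [X in _ `<=` X](closure_id _).1//.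
apply: closure_subset => x /= fx; rewrite leNgt; apply/negP => /fr /eqP.
by rewrite (negbTE fx).
Qed.

Lemma csupp_partial f i : Ck 1 f -> csupp f -> csupp (partial i f).
Proof.
move=> fC [r fr]; exists r => x rx.
have : is_derive x (e_ i) f 0; last by move=> h; exact: derive_val.
apply: (@near_eq_is_derive _ _ _ (fun=> 0)) => //.
have : nbhs x [set x : T | r < `|x|].
  have : closed [set x : T | `|x| <= r].
    by apply: compact_closed; [exact: norm_hausdorff|exact: compact_cube].
  rewrite -openC => oC; apply: open_nbhs_nbhs; split; last exact: rx.
  rewrite (_ : [set x | _] = ~` [set x : T | `|x| <= r])//.
  by apply/seteqP; split => y /=; rewrite ltNge => /negP.
by apply: filterS => y /fr ->.
Qed.

Lemma test_partial f i : test_function f -> test_function (partial i f).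
Proof.
move=> tf; have fC := tf.1; apply: csupp_test.
  by move=> k; apply: Ck_partial; exact: fC.
exact: csupp_partial (fC 1%N) (test_csupp tf).
Qed.

Lemma testM f g : (forall k, Ck k f) -> test_function g -> test_function (fun x => f x * g x).
Proof.
move=> fC tg; apply: csupp_test; last exact/csuppM/test_csupp.
by move=> k; apply: CkM => //; exact: tg.1.
Qed.

Lemma testD f g : test_function f -> test_function g -> test_function (fun x => f x + g x).
Proof.
move=> tf tg; apply: csupp_test; last by apply: csuppD; exact: test_csupp.
by move=> k; apply: CkD; [exact: tf.1|exact: tg.1].
Qed.

Lemma test_shift w f : test_function f -> test_function (fun x => f (x + w)).
Proof.
move=> tf; apply: csupp_test; last exact/csupp_shift/test_csupp.
by move=> k; apply: Ck_shift; exact: tf.1.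
Qed.

Lemma test_continuous f : test_function f -> continuous f.
Proof. by move=> tf; apply: (@Ck_continuous 0); exact: tf.1. Qed.

Lemma test_C1 f : test_function f -> Ck 1 f.
Proof. by move=> [+ _]; exact. Qed.

Lemma integM_test f eta : locally_integrable_rV f -> test_function eta ->
  integ (fun x => f x * eta x).
Proof.
by move=> fl te; apply: integM_csupp; [|exact: test_continuous|exact: test_csupp].
Qed.

End Ck_calculus.

(** * Smooth bumps and cutoffs *)

Section smooth_bumps.
Context {R : realType}.

(** x ^- n * exp (- 1 / x) extended by 0: the derivatives of the flat function
    exp (- 1 / x) are combinations of these, so that the family is closed
    under differentiation. *)
Definition expinv (n : nat) (x : R) : R :=
  if 0 < x then x^-1 ^+ n * expR (- x^-1) else 0.

(** Keeping one term of the exponential series of h^-1 is enough for the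
    quadratic decay that gives a zero derivative at 0. *)
Lemma expinv_le n h : 0 < h -> expinv n h <= n.+2`!%:R * h ^+ 2.
Proof.
move=> h0; rewrite /expinv h0.
have y0 : 0 < h^-1 by rewrite invr_gt0.
have := expR_ge1Dxn n.+1 (ltW y0); set F := n.+2`!%:R; rewrite exprS exprS => H.
have F0 : 0 < F by rewrite ltr0n fact_gt0.
have {}H : h^-1 * (h^-1 * h^-1 ^+ n) <= F * expR h^-1.
  by rewrite [leRHS]mulrC -ler_pdivrMr// (le_trans _ H)// lerDr.
rewrite expRN ler_pdivrMr ?expR_gt0//.
rewrite -(ler_pM2l y0) -(ler_pM2l y0) (le_trans H)// expr2 le_eqVlt; apply/orP; left.
apply/eqP; field; exact: lt0r_neq0.
Qed.

Lemma expinv_ge0 n x : 0 <= expinv n x.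
Proof.
rewrite /expinv; case: ifP => // x0.
by rewrite mulr_ge0 ?expR_ge0// exprn_ge0// invr_ge0 ltW.
Qed.

Lemma expinv_gt0 n x : 0 < x -> 0 < expinv n x.
Proof. by move=> x0; rewrite /expinv x0 mulr_gt0 ?expR_gt0// exprn_gt0// invr_gt0. Qed.

Lemma is_derive_expinv n (x : R) :
  is_derive x 1 (expinv n) (expinv n.+2 x - n%:R * expinv n.+1 x).
Proof.
have [x0|x0|->] := ltgtP x 0.
- rewrite /expinv !ifN ?mulr0 ?subr0 -?leNgt ?(ltW x0)//.
  have dc : is_derive x 1 (fun _ : R => 0 : R) 0 by exact: is_derive_cst.
  apply: near_eq_is_derive dc.
  by near=> y; rewrite ifN// -leNgt ltW//; near: y; exact: lt_nbhsl.
- rewrite /expinv !x0.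
  pose phi := fun y : R => y ^+ n * expR (- y).
  have dphi : is_derive x^-1 1 phi
      (x^-1 ^+ n * (- expR (- x^-1)) + expR (- x^-1) * (n%:R * x^-1 ^+ n.-1)).
    have dX := is_deriveX n (is_derive_id (x^-1 : R) 1).
    have dE : is_derive (x^-1 : R) 1 (expR \o -%R) (- expR (- x^-1)).
      rewrite -mulrN1; apply: is_derive1_comp.
    have := is_deriveM dX dE.
    have idX m y : (id ^+ m : R -> R) y = y ^+ m.
      by elim: m => // k IH; rewrite !exprS -IH.
    rewrite /GRing.scale /= mulr1 idX; congr is_derive.
    by apply/funext => y; rewrite /phi -idX.
  have dV : is_derive x 1 (fun y : R => y^-1) (- x ^- 2).
    have := is_deriveV (lt0r_neq0 x0) (is_derive_id (x : R) 1).
    by rewrite /GRing.scale /= mulr1.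
  have := is_derive1_comp dphi dV.
  rewrite (_ : _ * - x ^- 2 =
      x^-1 ^+ n.+2 * expR (- x^-1) - n%:R * (x^-1 ^+ n.+1 * expR (- x^-1))); last first.
    rewrite -exprVn; case: n @phi dphi => [|n] phi dphi /=.
      by rewrite !mul0r !exprS expr0; ring.
    by rewrite !exprS; ring.
  apply: near_eq_is_derive; near=> y => /=; rewrite /phi ifT//.
  by near: y; exact: lt_nbhsr.
- have e0 k : expinv k 0 = 0 by rewrite /expinv ltxx.
  rewrite !e0 mulr0 subr0.
  have H : (fun h : R => h^-1 *: ((expinv n \o shift 0) (h *: (1 : R)) - expinv n 0)) @ 0^' --> (0 : R).
    apply/cvgrPdist_le => eps eps0; near=> h.
    rewrite sub0r normrN /= addr0 [_ *: (1 : R)]mulr1 e0 subr0.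
    have [h0|h0] := leP h 0.
      by rewrite /expinv ifN -?leNgt// [_ *: _]mulr0 normr0 ltW.
    rewrite [_ *: _]mulrC ger0_norm; last by rewrite mulr_ge0 ?expinv_ge0// invr_ge0 ltW.
    rewrite ler_pdivrMr// (le_trans (expinv_le n h0))// expr2 mulrA ler_wpM2r ?ltW//.
    have F0 : 0 < n.+2`!%:R :> R by rewrite ltr0n fact_gt0.
    rewrite mulrC -ltr_pdivlMr// -[h]gtr0_norm//.
    near: h; apply: dnbhs0_lt; exact: divr_gt0.
  by apply: DeriveDef; [apply/cvg_ex; exists 0|exact: cvg_lim].
Unshelve. all: by end_near. Qed.

Lemma continuous_expinv n : continuous (expinv n).
Proof.
move=> x; apply/differentiable_continuous/derivable1_diffP.
by case: (is_derive_expinv n x).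
Qed.

Lemma expinv0_le1 x : expinv 0 x <= 1.
Proof.
rewrite /expinv; case: ifP => // x0.
by rewrite expr0 mul1r -expR0 ler_expR oppr_le0 invr_ge0 ltW.
Qed.

Lemma expinv_le0 n x : x <= 0 -> expinv n x = 0.
Proof. by move=> x0; rewrite /expinv ifN// -leNgt. Qed.

Lemma expinv0_cvg x : 0 < x -> expinv 0 (n.+1%:R * x) @[n --> \oo] --> (1 : R).
Proof.
move=> x0.
rewrite (_ : (fun _ => _) = (fun n => expR (- (x^-1 * n.+1%:R^-1)))).
  rewrite -[X in _ --> X](expR0); apply: continuous_cvg; first exact: continuous_expR.
  rewrite -[X in _ --> X]oppr0; apply: cvgN; rewrite -[X in _ --> X](mulr0 x^-1).
  by apply: cvgM; [exact: cvg_cst|exact: cvg_harmonic].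
apply/funext => n; rewrite /expinv ifT; first by rewrite expr0 mul1r invfM mulrC.
by rewrite mulr_gt0.
Qed.

End smooth_bumps.

Section bumps.
Context {R : realType} {d : nat}.
Local Notation T := 'rV[R]_d.
Implicit Types (x : T) (i : 'I_d).

(** By induction on k, since differentiation maps the family into its span. *)
Lemma Ck_expinv k n (a b : R) i : Ck k (fun x : T => expinv n (a * x ord0 i + b)).
Proof.
have ca n' : continuous (fun x : T => expinv n' (a * x ord0 i + b)).
  move=> x; have h : (fun y : T => a * y ord0 i + b) @ x --> a * x ord0 i + b.
    by apply: (@contD _ _ (fun y : T => a * y ord0 i) (fun=> b));
      [apply: contZ; exact: cont_coord|exact: cst_continuous].
  exact: (cvg_comp _ _ h (@continuous_expinv R n' _)).
elim: k n => [|k IH] n; first by split.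
apply: (@CkI _ _ k _ (fun j x => (expinv n.+2 (a * x ord0 i + b) +
   (- n%:R) * expinv n.+1 (a * x ord0 i + b)) * (a * (i == j)%:R))) => //.
- move=> j x; rewrite mulNr; apply: (@is_derive_comp1 _ _ (expinv n)).
    exact: is_derive_expinv.
  rewrite -[a * (i == j)%:R]addr0; apply: is_derive_addD.
  by apply: is_derive_scaleZ; exact: is_derive_coord.
- by move=> j; apply: CkM; [apply: CkD; [|apply: CkZ]|exact: Ck_cst].
Qed.

(** Smooth approximations from below of the indicator function of a box. *)
Definition box_bump (N : R) (a b : 'I_d -> R) : T -> R := fun x =>
  \prod_i (expinv 0 (N * (x ord0 i - a i)) * expinv 0 (N * (b i - x ord0 i))).

Let prodr_le1 (F : 'I_d -> R) : (forall i, 0 <= F i <= 1) -> \prod_i F i <= 1.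
Proof.
move=> F01; have : 0 <= \prod_i F i <= 1; last by case/andP.
elim/big_ind : _ => //; first by rewrite ler01 lexx.
by move=> y z /andP[y0 y1] /andP[z0 z1]; rewrite mulr_ge0// mulr_ile1.
Qed.

Lemma box_bump_ge0 N a b x : 0 <= box_bump N a b x.
Proof. by apply: prodr_ge0 => i _; rewrite mulr_ge0 ?expinv_ge0. Qed.

Lemma box_bump_le1 N a b x : box_bump N a b x <= 1.
Proof.
apply: prodr_le1 => i; rewrite mulr_ge0 ?expinv_ge0//=.
by rewrite mulr_ile1 ?expinv_ge0 ?expinv0_le1.
Qed.

Lemma box_bump_out N a b x : 0 < N -> ~ obox a b x -> box_bump N a b x = 0.
Proof.
move=> N0 nx.
have [i ni] : exists i, ~ (a i < x ord0 i < b i).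
  by apply: contrapT => h; apply: nx => i; apply: contrapT => hi; apply: h; exists i.
rewrite /box_bump (bigD1 i)//=.
suff -> : expinv 0 (N * (x ord0 i - a i)) * expinv 0 (N * (b i - x ord0 i)) = 0.
  by rewrite mul0r.
have [ai|ai] := leP (x ord0 i) (a i).
  by rewrite expinv_le0 ?mul0r// pmulr_rle0// subr_le0.
have [bi|bi] := leP (b i) (x ord0 i); last by rewrite ai bi in ni.
by rewrite [X in _ * X]expinv_le0 ?mulr0// pmulr_rle0// subr_le0.
Qed.

Lemma test_box_bump N a b : 0 < N -> test_function (box_bump N a b).
Proof.
move=> N0; apply: csupp_test => [k|].
  apply: Ck_prod => i; apply: CkM.
    rewrite (_ : (fun _ => _) = (fun x : T => expinv 0 (N * x ord0 i + (- (N * a i))))).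
      exact: Ck_expinv.
    by apply/funext => x; rewrite mulrBr.
  rewrite (_ : (fun _ => _) = (fun x : T => expinv 0 ((- N) * x ord0 i + N * b i))).
    exact: Ck_expinv.
  by apply/funext => x; rewrite mulrBr mulNr addrC.
have [r rab] := obox_bounded a b; exists r => x rx; apply: box_bump_out => // /rab.
by rewrite leNgt rx.
Qed.

Lemma cvg_prod (J : Type) (s : seq J) (F : J -> nat -> R) (l : J -> R) :
  (forall j, F j n @[n --> \oo] --> l j) ->
  \prod_(j <- s) F j n @[n --> \oo] --> \prod_(j <- s) l j.
Proof.
move=> Fl; elim: s => [|j s IH].
  rewrite big_nil (_ : (fun _ => _) = (fun=> 1)); first exact: cvg_cst.
  by apply/funext => n; rewrite big_nil.
rewrite big_cons (_ : (fun _ => _) = (fun n => F j n * \prod_(j <- s) F j n)).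
  exact: cvgM.
by apply/funext => n; rewrite big_cons.
Qed.

Lemma box_bump_cvg a b x : box_bump n.+1%:R a b x @[n --> \oo] --> (\1_(obox a b) x : R).
Proof.
have [xab|xab] := pselect (obox a b x); last first.
  rewrite indicE memNset//; apply: cvg_near_cst; apply: nearW => n.
  by rewrite box_bump_out.
rewrite indicE mem_set// (_ : true%:R = \prod_(i < d) (1 * 1 : R)); last first.
  by rewrite mulr1 big1.
apply: cvg_prod => i; have /andP[ai bi] := xab i.
by apply: cvgM; apply: expinv0_cvg; rewrite subr_gt0.
Qed.

(** Each factor of the bump takes its maximum expR (- 2) at the origin, since
    2 <= (1 + y)^-1 + (1 - y)^-1 on ]-1, 1[; the scaling makes it 1. *)
Definition cutoff0 : T -> R := fun x => expR 2 ^+ d * box_bump 1 (fun=> -1) (fun=> 1) x.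

Lemma cutoff0E x :
  cutoff0 x = \prod_i (expR 2 * (expinv 0 (1 + x ord0 i) * expinv 0 (1 - x ord0 i))).
Proof.
rewrite big_split /= prodr_const card_ord; congr (_ * _); apply: eq_bigr => i _.
by rewrite !mul1r opprK [1 + _]addrC.
Qed.

Let cutoff0_factor (y : R) :
  0 <= expR 2 * (expinv 0 (1 + y) * expinv 0 (1 - y)) <= 1.
Proof.
rewrite !mulr_ge0 ?expR_ge0 ?expinv_ge0//=.
have [y1|y1] := leP y (-1).
  by rewrite expinv_le0 ?mul0r ?mulr0//; lra.
have [y2|y2] := leP 1 y.
  by rewrite [expinv 0 (1 - y)]expinv_le0 ?mulr0//; lra.
have p1 : 0 < 1 + y by lra.
have p2 : 0 < 1 - y by lra.
rewrite /expinv p1 p2 !expr0 !mul1r -!expRD -[leRHS]expR0 ler_expR.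
have : 2 <= (1 + y)^-1 + (1 - y)^-1; last by lra.
rewrite -(@ler_pM2r _ ((1 + y) * (1 - y))) ?mulr_gt0//.
rewrite [leRHS](_ : _ = 2); last by field; rewrite !lt0r_neq0.
nra.
Qed.

Lemma test_cutoff0 : test_function cutoff0.
Proof. by apply: testM; [move=> k; exact: Ck_cst|exact: test_box_bump]. Qed.

Lemma cutoff0_ge0 x : 0 <= cutoff0 x.
Proof. by rewrite cutoff0E; apply: prodr_ge0 => i _; have /andP[] := cutoff0_factor (x ord0 i). Qed.

Lemma cutoff0_le1 x : cutoff0 x <= 1.
Proof. by rewrite cutoff0E; apply: prodr_le1 => i; exact: cutoff0_factor. Qed.

Lemma cutoff0_0 : cutoff0 0 = 1.
Proof.
rewrite cutoff0E big1// => i _; rewrite mxE addr0 subr0 /expinv ltr01 !expr0 !mul1r.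
by rewrite -!expRD invr1 -[RHS]expR0; congr expR; lra.
Qed.

Definition cutoff (n : nat) : T -> R := fun x => cutoff0 (n.+1%:R^-1 *: x).

Lemma test_cutoff n : test_function (cutoff n).
Proof.
have tc := test_cutoff0; apply: csupp_test => [k|].
  by apply: Ck_scale; exact: tc.1.
have [r cr] := test_csupp tc; exists (n.+1%:R * r) => x rx; apply: cr.
by rewrite normrZ gtr0_norm ?invr_gt0// ltr_pdivlMl.
Qed.

Lemma cutoff_ge0 n x : 0 <= cutoff n x.
Proof. exact: cutoff0_ge0. Qed.

Lemma cutoff_le1 n x : cutoff n x <= 1.
Proof. exact: cutoff0_le1. Qed.

Lemma cutoff_cvg x : cutoff n x @[n --> \oo] --> (1 : R).
Proof.
rewrite -cutoff0_0 /cutoff.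
have h : n.+1%:R^-1 *: x @[n --> \oo] --> (0 : T).
  by rewrite -[X in _ --> X](scale0r x); apply: cvgZr_tmp; exact: cvg_harmonic.
have H := test_continuous test_cutoff0.
exact: (cvg_comp (fun n : nat => n.+1%:R^-1 *: x) cutoff0 h (H (0 : T))).
Qed.

(** Stretching the cutoff by n.+1 divides its gradient by n.+1. *)
Lemma partial_cutoff : exists2 B, 0 <= B &
  forall n i x, `|partial i (cutoff n) x| <= n.+1%:R^-1 * B.
Proof.
have tc := test_cutoff0.
have H i := csupp_bounded (test_continuous (test_partial i tc)) (test_csupp (test_partial i tc)).
have H' i : exists M, 0 <= M /\ forall x, `|partial i cutoff0 x| <= M.
  by have [M M0 HM] := H i; exists M.
have [B HB] := choice H'.
exists (\sum_i B i); first by apply: sumr_ge0 => i _; case: (HB i).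
move=> n i x.
have -> : partial i (cutoff n) = (fun x => n.+1%:R^-1 * partial i cutoff0 (n.+1%:R^-1 *: x)).
  apply: partialE => y; apply: is_derive_scale.
  exact: (Ck_is_derive _ _ (test_C1 tc)).
rewrite normrM gtr0_norm ?invr_gt0// ler_pM2l ?invr_gt0//.
rewrite (bigD1 i)//= -[leLHS]addr0 lerD//; first by case: (HB i).
by apply: sumr_ge0 => k _; case: (HB k).
Qed.

End bumps.

(** * Correlation, mollification and weak derivatives *)

Section weak_derivatives.
Context {R : realType} {d : nat}.
Local Notation T := 'rV[R]_d.
Local Notation leb := (@lebesgue_rV R d).
Local Notation loc := (@locally_integrable_rV R d).
Local Notation e_ i := (delta_mx ord0 i : T).
Implicit Types (f g a xi : T -> R) (x y : T) (i : 'I_d).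

Lemma partialM f g i : Ck 1 f -> Ck 1 g ->
  partial i (fun x => f x * g x) = (fun x => f x * partial i g x + g x * partial i f x).
Proof.
move=> fC gC; apply: partialE => x.
by apply: is_derive_prodM; [exact: Ck_is_derive fC|exact: Ck_is_derive gC].
Qed.

(** The form of dominated convergence used throughout: a fixed locally
    integrable function against uniformly bounded and supported factors. *)
Lemma loc_dct f (a_ : nat -> T -> R) a r M : loc f ->
  (forall n, continuous (a_ n)) -> (forall x, a_ n x @[n --> \oo] --> a x) ->
  (forall n x, `|a_ n x| <= M) -> (forall n x, r < `|x| -> a_ n x = 0) ->
  \int[leb]_x (f x * a_ n x) @[n --> \oo] --> \int[leb]_x (f x * a x).
Proof.
move=> fl ca aa aM ar; have [F [Fi F0 fF]] := loc_elim r fl.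
have M0 : 0 <= M by apply: le_trans (aM 0%N 0).
have [] // := @Int_dct R d (fun n x => f x * a_ n x) (fun x => f x * a x) (fun x => M * F x).
- move=> n; apply: measurable_funM; first exact: loc_meas.
  exact: continuous_measurable_rV.
- by move=> x; apply: cvgM; [exact: cvg_cst|exact: aa].
- exact: integZ.
- move=> n x; rewrite normrM mulrC.
  have [xr|xr] := leP `|x| r; first by rewrite ler_pM// fF.
  by rewrite ar// normr0 mul0r mulr_ge0.
Qed.

(** Unlike a convolution, it needs no reflection of xi; it inherits the
    regularity of xi. *)
Definition correl f xi : T -> R := fun y => \int[leb]_x (f x * xi (x + y)).

Let seq_bounded (u : nat -> T) y : u n @[n --> \oo] --> y ->
  exists C, forall n, `|u n| <= C.
Proof.
move=> uy; have /cvg_seq_bounded [M [_ HM]] : cvgn u by apply/cvg_ex; exists y.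
by exists (M + 1) => n; apply: (HM (M + 1)) => //; rewrite ltrDl.
Qed.

Lemma correl_continuous f xi : loc f -> continuous xi -> csupp xi ->
  continuous (correl f xi).
Proof.
move=> fl cx [r xr] y; apply: seq_continuous => u uy.
have [M M0 HM] := csupp_bounded cx (ex_intro _ r xr).
have [C HC] := seq_bounded uy.
apply: (@loc_dct f (fun n x => xi (x + u n)) (fun x => xi (x + y)) (r + C) M) => //.
- by move=> n; exact: cont_shift.
- move=> x; have h : x + u n @[n --> \oo] --> x + y by apply: cvgD => //; exact: cvg_cst.
  exact: (cvg_comp (fun n : nat => x + u n) xi h (cx (x + y))).
- move=> n x Cx; apply: xr; have := ler_normB (x + u n) (u n); rewrite addrK.
  have := HC n; lra.
Qed.

Lemma correl_is_derive f xi i y : loc f -> Ck 1 xi -> csupp xi ->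
  is_derive y (e_ i) (correl f xi) (correl f (partial i xi) y).
Proof.
move=> fl xC sx; have [r xr] := sx.
have cx := Ck_continuous xC.
have cdx : continuous (partial i xi) by exact: Ck_partial_continuous.
have [M M0 HM] := csupp_bounded cdx (csupp_partial i xC sx).
apply: quotient_is_derive; apply/cvgr_dnbhsP => t [t0 t0c].
have [C HC] : exists C, forall n, `|t n| <= C.
  have /cvg_seq_bounded [N [_ HN]] : cvgn t by apply/cvg_ex; exists 0.
  by exists (N + 1) => n; apply: (HN (N + 1)) => //; rewrite ltrDl.
pose a n x := (t n)^-1 * (xi (x + (y + t n *: e_ i)) - xi (x + y)).
rewrite (_ : (fun n => _) = (fun n => \int[leb]_x (f x * a n x))); last first.
  apply/funext => n; rewrite /correl -IntB.
  - rewrite -IntZ; first by apply: eq_Int => x; rewrite /a; ring.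
    by apply: integB; apply: integM_csupp => //; try exact: cont_shift; exact: csupp_shift.
  - by apply: integM_csupp => //; [exact: cont_shift|exact: csupp_shift].
  - by apply: integM_csupp => //; [exact: cont_shift|exact: csupp_shift].
apply: (@loc_dct f a (fun x => partial i xi (x + y)) (r + `|y| + C) M) => //.
- by move=> n; apply: contZ; apply: contB; exact: cont_shift.
- move=> x; have /is_derive_quotient H := Ck_is_derive i (x + y) xC.
  have /cvgr_dnbhsP/(_ t (conj t0 t0c)) {}H := H.
  rewrite (_ : (fun n => a n x) = (fun n =>
    (t n)^-1 * (xi (x + y + t n *: e_ i) - xi (x + y)))); first exact: H.
  by apply/funext => n; rewrite /a addrA.
- move=> n x; rewrite /a addrA.
  have [s _ ->] := partial_MVT i (x + y) (t n) xC.
  by rewrite mulrA mulVf// mul1r.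
- move=> n x rx.
  have nt := le_trans (norm_scale_delta (t n) i) (HC n).
  have C0 : 0 <= C by apply: le_trans (HC 0%N).
  rewrite /a !xr ?subrr ?mulr0//.
    by have := ler_normB (x + y) y; rewrite addrK; lra.
  have := ler_normB (x + (y + t n *: e_ i)) (y + t n *: e_ i); rewrite addrK.
  have := ler_normD y (t n *: e_ i); lra.
Qed.

Lemma Ck_correl f xi k : loc f -> test_function xi -> Ck k (correl f xi).
Proof.
move=> fl; elim: k xi => [|k IH] xi tx.
  by split => //; apply: correl_continuous => //; [exact: test_continuous|exact: test_csupp].
apply: (@CkI _ _ _ _ (fun i => correl f (partial i xi))).
- by apply: correl_continuous => //; [exact: test_continuous|exact: test_csupp].
- by move=> i x; apply: correl_is_derive => //; [exact: test_C1|exact: test_csupp].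
- by move=> i; apply: IH; exact: test_partial.
Qed.

(** By translation invariance the correlation of xi with 1 is constant. *)
Lemma Int_partial xi i : Ck 1 xi -> csupp xi -> \int[leb]_x partial i xi x = 0.
Proof.
move=> xC sx.
have l1 : loc (fun=> 1) by apply: loc_continuous; exact: cst_continuous.
have : is_derive (0 : T) (e_ i) (correl (fun=> 1) xi) (\int[leb]_x partial i xi x).
  have := correl_is_derive i 0 l1 xC sx; rewrite {2}/correl.
  by under eq_Int do rewrite mul1r addr0.
have -> : correl (fun=> 1) xi = (fun=> \int[leb]_x xi x).
  apply/funext => y; rewrite /correl; under eq_Int do rewrite mul1r.
  by apply: Int_shift; apply: integ_continuous => //; exact: (Ck_continuous xC).
by case=> _ <-; exact: derive_cst.
Qed.

Lemma integ_by_parts f xi i : Ck 1 f -> Ck 1 xi -> csupp xi ->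
  \int[leb]_x (f x * partial i xi x) = - \int[leb]_x (partial i f x * xi x).
Proof.
move=> fC xC sx.
have cf := Ck_continuous fC; have cx := Ck_continuous xC.
have cdf : continuous (partial i f) by exact: Ck_partial_continuous.
have cdx : continuous (partial i xi) by exact: Ck_partial_continuous.
have i1 : integ (fun x => f x * partial i xi x).
  by apply: integM_csupp => //; [exact: loc_continuous|exact: csupp_partial].
have i2 : integ (fun x => partial i f x * xi x).
  by apply: integM_csupp => //; exact: loc_continuous.
apply/eqP; rewrite -subr_eq0 opprK -IntD//; apply/eqP.
have := Int_partial i (CkM fC xC) (csuppM f sx).
rewrite partialM// => <-; by apply: eq_Int => x; rewrite [xi x * _]mulrC.
Qed.

Lemma C1_weak_partial f i : Ck 1 f -> is_weak_partial i f (partial i f).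
Proof.
move=> fC; split.
- by apply: loc_continuous; exact: (Ck_continuous fC).
- by apply: loc_continuous; apply: (@Ck_continuous _ _ 0); exact: Ck_partial.
- by move=> eta te; apply: integ_by_parts => //; [exact: test_C1|exact: test_csupp].
Qed.

(* Mollification by bumps concentrating at the origin, which need not be even:
   the correlation of the bump with xi is used, so that differentiation falls
   on xi (correl_is_derive), while smoothness comes from exchanging the roles of
   both functions by a change of variables. *)
Let del n : R := n.+1%:R^-1.
Let rho n : T -> R := box_bump 1 (fun=> - del n) (fun=> del n).

Let del_gt0 n : 0 < del n. Proof. by rewrite invr_gt0. Qed.

Let rho_out n x : del n < `|x| -> rho n x = 0.
Proof.
move=> nx; apply: box_bump_out => // xn.
have : `|x| <= del n.
  by apply/rV_normP => [|i]; [exact: ltW|have := xn i; rewrite -ltr_norml => /ltW].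
by rewrite leNgt nx.
Qed.

Let rho_loc n : loc (rho n).
Proof. by apply: loc_continuous; apply: test_continuous; exact: test_box_bump. Qed.

Let rho_integ n : integ (rho n).
Proof.
have tb : test_function (rho n) by exact: test_box_bump.
by apply: integ_continuous; [exact: test_continuous|exact: test_csupp].
Qed.

Let rho_Int n : 0 < \int[leb]_x rho n x.
Proof.
rewrite lt_neqAle Int_ge0 ?andbT; last by move=> x; exact: box_bump_ge0.
apply/eqP => /esym/(Int_eq0_ae (rho_integ n) (fun x => box_bump_ge0 _ _ _ x))[N [mN N0 HN]].
have boxN : obox (fun=> - del n) (fun=> del n) `<=` N.
  move=> x xb; apply: HN => /= /eqP; rewrite /rho /box_bump; apply/negP.
  rewrite prodf_seq_neq0; apply/allP => i _ /=; have /andP[x1 x2] := xb i.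
  have p1 : 0 < x ord0 i - - del n by rewrite subr_gt0.
  have p2 : 0 < del n - x ord0 i by rewrite subr_gt0.
  by rewrite !mul1r mulf_neq0// lt0r_neq0// expinv_gt0.
have : leb (obox (fun=> - del n) (fun=> del n)) = 0%E.
  exact: (subset_measure0 (measurable_obox _ _) mN boxN N0).
have lebE := @lebesgue_rV_rect R d (fun=> `]- del n, del n[%classic) (fun=> measurable_itv _).
apply/eqP; rewrite gt_eqF// [X in (_ < X)%E]lebE.
elim/big_ind : _ => //=; first by move=> a b; exact: mule_gt0.
move=> i _; have := del_gt0 n => dn.
rewrite lebesgue_measure_itv/= lte_fin gtrN// -EFinB lte_fin; lra.
Qed.

Let moll xi n : T -> R := fun x => (\int[leb]_x rho n x)^-1 * correl (rho n) xi x.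

Let moll_le xi x n c eps : continuous xi -> csupp xi ->
  (forall z, `|z| <= del n -> `|xi (z + x) - c| <= eps) -> `|moll xi n x - c| <= eps.
Proof.
move=> cx sx H; rewrite /moll.
have i1 : integ (fun z => rho n z * xi (z + x)).
  by apply: integM_csupp => //; [exact: cont_shift|exact: csupp_shift].
have i2 : integ (fun z => c * rho n z) by exact: integZ.
rewrite -[X in _ - X](mulKf (lt0r_neq0 (rho_Int n))) -mulrBr normrM.
rewrite gtr0_norm ?invr_gt0// ler_pdivrMl// [leRHS]mulrC [X in `|_ - X|]mulrC -(IntZ c)// /correl -IntB//.
apply: le_trans (le_norm_Int (integB i1 i2)) _.
rewrite -IntZ//; apply: le_Int; [exact/integ_norm/integB|exact: integZ|move=> z].
rewrite [c * _]mulrC -mulrBr normrM mulrC [`|rho n z|]ger0_norm ?box_bump_ge0//.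
have [zn|zn] := leP `|z| (del n); last by rewrite rho_out// !mulr0.
by rewrite ler_wpM2r ?box_bump_ge0// H.
Qed.

Let moll_cvg xi x : continuous xi -> csupp xi ->
  moll xi n x @[n --> \oo] --> xi x.
Proof.
move=> cx sx; apply/cvgrPdist_le => eps eps0.
have : \forall y \near x, `|xi x - xi y| < eps.
  by move: (cx x) => /(@cvgrPdist_lt R R T (nbhs x) (nbhs_filter x)); exact.
move=> /nbhs_ballP[r /= r0 Hr].
have /cvgrPdist_lt/(_ _ r0)[N _ HN] := @cvg_harmonic R.
exists N => // n /HN; rewrite sub0r normrN /harmonic/= gtr0_norm// => nr.
rewrite distrC; apply: moll_le => // z zn; rewrite distrC; apply: ltW; apply: Hr.
by rewrite -ball_normE /= opprD addrCA subrr addr0 normrN (le_lt_trans zn).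
Qed.

Let moll_bounded xi M : continuous xi -> csupp xi -> (forall x, `|xi x| <= M) ->
  forall n x, `|moll xi n x| <= M.
Proof.
by move=> cx sx HM n x; rewrite -[moll _ _ _]subr0; apply: moll_le => // z _; rewrite subr0.
Qed.

Let moll_out xi r : continuous xi -> csupp xi -> (forall x, r < `|x| -> xi x = 0) ->
  forall n x, r + 1 < `|x| -> moll xi n x = 0.
Proof.
move=> cx sx xr n x rx; apply/eqP; rewrite -normr_le0 -[moll _ _ _]subr0.
apply: moll_le => // z zn; rewrite xr ?subr0 ?normr0//.
have := ler_normB (z + x) z; rewrite addrAC subrr add0r.
have : del n <= 1 by rewrite /del invf_le1// ler1n.
lra.
Qed.

Let moll_smooth xi n k : continuous xi -> csupp xi -> Ck k (moll xi n).
Proof.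
move=> cx sx; apply: CkZ.
have -> : correl (rho n) xi = (fun x => correl xi (rho n) ((-1) *: x)).
  apply/funext => x; rewrite /correl.
  rewrite -(@Int_shift _ _ x (fun z => xi z * rho n (z + (-1) *: x))).
    by apply: eq_Int => z; rewrite scaleN1r addrK mulrC.
  have tb : test_function (rho n) by exact: test_box_bump.
  apply: integM_csupp; first exact: loc_continuous.
    by apply: cont_shift; exact: test_continuous.
  by apply: csupp_shift; exact: test_csupp.
apply: Ck_scale; apply: Ck_correl; first exact: loc_continuous.
exact: test_box_bump.
Qed.

(** Weak derivatives may be tested against C^1 functions: these and their
    gradients are boundedly and pointwise approximated by mollification. *)
Lemma weak_partial_C1 i f g xi : is_weak_partial i f g -> Ck 1 xi -> csupp xi ->
  \int[leb]_x (f x * partial i xi x) = - \int[leb]_x (g x * xi x).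
Proof.
move=> [fl gl fg] xC sx.
have cx := Ck_continuous xC.
have cdx : continuous (partial i xi) by exact: Ck_partial_continuous.
have sdx := csupp_partial i xC sx.
have dmoll n : partial i (moll xi n) = moll (partial i xi) n.
  by apply: partialE => x; apply: is_derive_scaleZ; exact: correl_is_derive.
have tmoll n : test_function (moll xi n).
  apply: csupp_test => [k|]; first exact: moll_smooth.
  by have [r xr] := sx; exists (r + 1) => x; exact: (moll_out cx sx xr).
have [r xr] := sx; have [r' xr'] := sdx.
have [M M0 HM] := csupp_bounded cx sx; have [M' M'0 HM'] := csupp_bounded cdx sdx.
have L1 := @loc_dct f (moll (partial i xi)) (partial i xi) (r' + 1) M' fl _
  (fun x => @moll_cvg (partial i xi) x cdx sdx) (moll_bounded cdx sdx HM') (moll_out cdx sdx xr').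
have L2 := @loc_dct g (moll xi) xi (r + 1) M gl _
  (fun x => @moll_cvg xi x cx sx) (moll_bounded cx sx HM) (moll_out cx sx xr).
have {}L1 : \int[leb]_x (f x * moll (partial i xi) n x) @[n --> \oo] -->
    \int[leb]_x (f x * partial i xi x).
  by apply: L1 => n; rewrite -dmoll; apply: test_continuous; exact: test_partial.
have {}L2 : (- (\int[leb]_x (g x * moll xi n x))) @[n --> \oo] --> - (\int[leb]_x (g x * xi x)).
  by apply: cvgN; apply: L2 => n; exact: test_continuous.
have E : (fun n => \int[leb]_x (f x * moll (partial i xi) n x)) =
    (fun n => - (\int[leb]_x (g x * moll xi n x))).
  by apply/funext => n; rewrite -fg// dmoll.
by rewrite E in L1; exact: cvg_unique L1 L2.
Qed.

Lemma weak_partialM i f g a : is_weak_partial i f g -> Ck 1 a ->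
  is_weak_partial i (fun x => f x * a x) (fun x => g x * a x + f x * partial i a x).
Proof.
move=> wfg aC; have [fl gl _] := wfg.
have ca := Ck_continuous aC.
have cda : continuous (partial i a) by exact: Ck_partial_continuous.
split; first exact: locM.
  by apply: locD; exact: locM.
move=> eta te.
have eC := test_C1 te; have ce := test_continuous te; have se := test_csupp te.
have cde := test_continuous (test_partial i te); have sde := test_csupp (test_partial i te).
have := weak_partial_C1 wfg (CkM aC eC) (csuppM a se).
rewrite partialM//.
have i1 : integ (fun x => f x * a x * partial i eta x).
  by apply: integM_csupp => //; exact: locM.
have i2 : integ (fun x => f x * partial i a x * eta x).
  by apply: integM_csupp => //; exact: locM.
have i3 : integ (fun x => g x * a x * eta x) by apply: integM_csupp => //; exact: locM.
have -> : \int[leb]_x (f x * (a x * partial i eta x + eta x * partial i a x)) =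
    \int[leb]_x (f x * a x * partial i eta x) + \int[leb]_x (f x * partial i a x * eta x).
  by rewrite -IntD//; apply: eq_Int => x; ring.
have -> : \int[leb]_x ((g x * a x + f x * partial i a x) * eta x) =
    \int[leb]_x (g x * a x * eta x) + \int[leb]_x (f x * partial i a x * eta x).
  by rewrite -IntD//; apply: eq_Int => x; ring.
have -> : \int[leb]_x (g x * (a x * eta x)) = \int[leb]_x (g x * a x * eta x).
  by apply: eq_Int => x; ring.
lra.
Qed.

Lemma weak_partialD i f g f' g' : is_weak_partial i f g -> is_weak_partial i f' g' ->
  is_weak_partial i (fun x => f x + f' x) (fun x => g x + g' x).
Proof.
move=> [fl gl H] [fl' gl' H']; split; [exact: locD|exact: locD|move=> eta te].
have ce := test_continuous te; have se := test_csupp te.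
have cde := test_continuous (test_partial i te); have sde := test_csupp (test_partial i te).
under eq_Int do rewrite mulrDl; under [in RHS]eq_Int do rewrite mulrDl.
by rewrite !IntD ?opprD ?H ?H'//; exact: integM_csupp.
Qed.

Lemma weak_partialZ i f g k : is_weak_partial i f g ->
  is_weak_partial i (fun x => k * f x) (fun x => k * g x).
Proof.
move=> [fl gl H]; split; [exact: locZ|exact: locZ|move=> eta te].
have ce := test_continuous te; have se := test_csupp te.
have cde := test_continuous (test_partial i te); have sde := test_csupp (test_partial i te).
under eq_Int do rewrite -mulrA; under [in RHS]eq_Int do rewrite -mulrA.
by rewrite !IntZ ?H ?mulrN//; exact: integM_csupp.
Qed.

Lemma weak_partialB i f g f' g' : is_weak_partial i f g -> is_weak_partial i f' g' ->
  is_weak_partial i (fun x => f x - f' x) (fun x => g x - g' x).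
Proof.
move=> H /(weak_partialZ (-1)) /(weak_partialD H).
by congr is_weak_partial; apply/funext => x; rewrite mulN1r.
Qed.

Lemma weak_partial_shift i f g (v : T) : is_weak_partial i f g ->
  is_weak_partial i (fun x => f (x + v)) (fun x => g (x + v)).
Proof.
move=> [fl gl H]; split; [exact: loc_shift|exact: loc_shift|move=> eta te].
have te' := test_shift (- v) te.
have dte : partial i (fun x => eta (x - v)) = (fun x => partial i eta (x - v)).
  apply: partialE => x.
  exact: (@is_derive_translate _ _ eta x _ (- v) _ (Ck_is_derive i _ (test_C1 te))).
have tde := test_partial i te.
have i1 : integ (fun x => f x * partial i eta (x - v)).
  apply: integM_csupp => //; first by apply: cont_shift; exact: test_continuous.
  by apply: csupp_shift; exact: test_csupp.
have i2 : integ (fun x => g x * eta (x - v)).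
  apply: integM_csupp => //; first by apply: cont_shift; exact: test_continuous.
  by apply: csupp_shift; exact: test_csupp.
have := H _ te'; rewrite dte -(Int_shift v i1) -(Int_shift v i2).
by under eq_Int do rewrite addrK; under [in RHS]eq_Int do rewrite addrK.
Qed.

End weak_derivatives.

(** * The fundamental lemma and uniqueness of weak derivatives *)

Section density_measure.
Context {R : realType} {d : nat}.
Local Notation T := 'rV[R]_d.
Local Notation leb := (@lebesgue_rV R d).
Variables (f : T -> R) (mf : measurable_fun [set: T] f) (f0 : forall x, 0 <= f x).

(** The measure of density f. Measurability and nonnegativity are arguments so
    that the measure structure can be attached to the head constant. *)
Definition density_measure (_ : measurable_fun [set: T] f)
    (_ : forall x, 0 <= f x) (A : set T) : \bar R :=
  (\int[leb]_(x in A) (f x)%:E)%E.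
Local Notation nu := (density_measure mf f0).

Let nu0 : nu set0 = 0%E.
Proof. exact: integral_set0. Qed.

Let nu_ge0 A : (0 <= nu A)%E.
Proof. by apply: integral_ge0 => x _; rewrite lee_fin. Qed.

Let nu_sigma_additive : semi_sigma_additive nu.
Proof.
move=> F mF tF mUF; rewrite /density_measure ge0_integral_bigcup//=.
- apply: is_cvg_ereal_nneg_natsum_cond => n _ _.
  by apply: integral_ge0 => x _; rewrite lee_fin.
- by apply/measurable_EFinP; exact: measurable_funS mf.
- by move=> x _; rewrite lee_fin.
Qed.

HB.instance Definition _ := isMeasure.Build _ _ _ nu nu0 nu_ge0 nu_sigma_additive.

End density_measure.

Section fundamental_lemma.
Context {R : realType} {d : nat}.
Local Notation T := 'rV[R]_d.
Local Notation leb := (@lebesgue_rV R d).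
Local Notation loc := (@locally_integrable_rV R d).
Implicit Types (f g : T -> R).

Let box_Int g a b : loc g ->
  (forall eta, test_function eta -> \int[leb]_x (g x * eta x) = 0) ->
  \int[leb]_x (g x * \1_(obox a b) x) = 0.
Proof.
move=> gl H; have [r rab] := obox_bounded a b.
have := @loc_dct R d g (fun n => box_bump n.+1%:R a b) (\1_(obox a b)) r 1 gl _
  (fun x => @box_bump_cvg R d a b x).
move=> L; have {}L : \int[leb]_x (g x * box_bump n.+1%:R a b x) @[n --> \oo] -->
    \int[leb]_x (g x * \1_(obox a b) x).
  apply: L => [n|n x|n x rx].
  - by apply: test_continuous; exact: test_box_bump.
  - by rewrite ger0_norm ?box_bump_ge0// box_bump_le1.
  - by apply: box_bump_out => // /rab; rewrite leNgt rx.
have E : (fun n => \int[leb]_x (g x * box_bump n.+1%:R a b x)) = (fun=> 0).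
  by apply/funext => n; apply: H; exact: test_box_bump.
rewrite E in L; have C0 : (fun _ : nat => 0 : R) @ \oo --> (0 : R) by exact: cvg_cst.
exact: cvg_unique L C0.
Qed.

Let indic_integ g a b : loc g -> integ (fun x => g x * \1_(obox a b) x).
Proof.
move=> gl; have [r rab] := obox_bounded a b.
have [F [Fi F0 gF]] := loc_elim r gl.
apply: integ_le Fi _.
  by apply: measurable_funM; [exact: loc_meas|exact: measurable_indic (measurable_obox a b)].
move=> x; have [xab|xab] := pselect (obox a b x).
  by rewrite indicE mem_set// mulr1 gF// rab.
by rewrite indicE memNset// mulr0 normr0.
Qed.

(* The densities given by the positive and negative parts of g agree on boxes,
   hence on the set where g is positive, where the second one vanishes. *)
Let fundamental_le0 g : loc g ->
  (forall eta, test_function eta -> \int[leb]_x (g x * eta x) = 0) ->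
  {ae leb, forall x, g x <= 0}.
Proof.
move=> gl H; have mg := loc_meas gl.
pose gp x := Num.max (g x) 0; pose gn x := Num.max (- g x) 0.
have mgp : measurable_fun [set: T] gp by exact: measurable_maxr.
have mgn : measurable_fun [set: T] gn.
  by apply: measurable_maxr => //; exact: measurableT_comp.
have gp0 x : 0 <= gp x by rewrite /gp le_max lexx orbT.
have gn0 x : 0 <= gn x by rewrite /gn le_max lexx orbT.
have gpl : loc gp.
  apply: (@loc_le _ _ _ (fun x => `|g x|)) => //.
    by split; [exact: measurableT_comp|move=> K cK; have := gl.2 K cK; exact: integrable_norm].
  by move=> x; rewrite ger0_norm// /gp ge_max normr_ge0 ler_norm.
have gnl : loc gn.
  apply: (@loc_le _ _ _ (fun x => `|g x|)) => //.
    by split; [exact: measurableT_comp|move=> K cK; have := gl.2 K cK; exact: integrable_norm].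
  by move=> x; rewrite ger0_norm// /gn ge_max normr_ge0 -normrN ler_norm.
have gE x : g x = gp x - gn x.
  by rewrite /gp /gn; case: (leP (g x) 0); case: (leP (- g x) 0) => *; lra.
pose nup := density_measure mgp gp0; pose nun := density_measure mgn gn0.
have nuE f (mf : measurable_fun [set: T] f) (f0 : forall x, 0 <= f x) a b : loc f ->
    density_measure mf f0 (obox a b) = (\int[leb]_x (f x * \1_(obox a b) x))%:E.
  move=> fl; rewrite /density_measure integral_mkcond -EFin_Int; last exact: indic_integ.
  apply: eq_integral => x _; rewrite patchE indicE.
  by case: ifP => _; rewrite ?mulr1 ?mulr0.
have nupn A : measurable A -> nup A = nun A.
  apply: rV_measure_unique => a b; last first.
    by rewrite [X in (X < _)%E](nuE gp mgp gp0 a b gpl) ltry.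
  rewrite [LHS](nuE gp mgp gp0 a b gpl) [RHS](nuE gn mgn gn0 a b gnl).
  congr EFin; apply/eqP; rewrite -subr_eq0 -IntB; try exact: indic_integ.
  by rewrite -(box_Int a b gl H); apply/eqP; apply: eq_Int => x; rewrite gE mulrBl.
pose A := [set x | 0 < g x].
have mA : measurable A.
  rewrite (_ : A = g @^-1` `]0, +oo[%classic); last first.
    by apply/seteqP; split => x /=; rewrite in_itv/= andbT.
  by rewrite -[X in measurable X]setTI; exact: mg.
have : nup A = 0%E.
  rewrite nupn// /nun /density_measure; apply: integral0_eq => x /= x0.
  by rewrite /gn max_r// oppr_le0 ltW.
rewrite /nup /density_measure => nuA0.
have : ae_eq leb setT (EFin \o gp) (cst 0%E).
  apply/(ae_eq_integral_abs _ measurableT); first exact/measurable_EFinP.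
  rewrite -nuA0 [RHS]integral_mkcond; apply: eq_integral => x _.
  rewrite patchE /=; case: ifPn => [_|]; first by rewrite ger0_norm.
  by rewrite notin_setE /A /= => /negP; rewrite -leNgt => h; rewrite /gp max_r ?normr0.
by apply: filterS => x /(_ Logic.I) /= [] <-; rewrite /gp le_max lexx.
Qed.

(** By approximation of indicator functions, the positive and negative parts
    of g have equal integrals over boxes, hence over every measurable set. *)
Lemma fundamental_lemma g : loc g ->
  (forall eta, test_function eta -> \int[leb]_x (g x * eta x) = 0) ->
  {ae leb, forall x, g x = 0}.
Proof.
move=> gl H; have h1 := fundamental_le0 gl H.
have h2 : {ae leb, forall x, -1 * g x <= 0}.
  apply: fundamental_le0; first exact: locZ.
  move=> eta te; under eq_Int do rewrite -mulrA.
  by rewrite IntZ ?H ?mulr0//; exact: integM_test.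
apply: filterS2 h1 h2 => x; rewrite mulN1r oppr_le0 => g1 g2.
by apply/eqP; rewrite eq_le g1 g2.
Qed.

Lemma weak_partial_unique i f g g' : is_weak_partial i f g -> is_weak_partial i f g' ->
  {ae leb, forall x, g x = g' x}.
Proof.
move=> [fl gl H] [_ gl' H'].
have : {ae leb, forall x, g x + -1 * g' x = 0}.
  apply: fundamental_lemma; first by apply: locD => //; exact: locZ.
  move=> eta te.
  have ig : integ (fun x => g x * eta x).
    exact: integM_test.
  have ig' : integ (fun x => g' x * eta x).
    exact: integM_test.
  rewrite (@eq_Int _ _ _ (fun x => g x * eta x - g' x * eta x)).
    by have := H _ te; rewrite H'// IntB// => /oppr_inj ->; rewrite subrr.
  by move=> x; ring.
by apply: filterS => x /eqP; rewrite mulN1r subr_eq0 => /eqP.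
Qed.

Lemma weak_partialP i f g : is_weak_partial i f g ->
  is_weak_partial i f (weak_partial i f).
Proof. by move=> H; apply: (@getPex _ [set g | is_weak_partial i f g]); exists g. Qed.

Lemma weak_partial_ae i f g : is_weak_partial i f g ->
  {ae leb, forall x, weak_partial i f x = g x}.
Proof. by move=> H; exact: weak_partial_unique (weak_partialP H) H. Qed.

End fundamental_lemma.

(** * Riesz representation by minimization *)

Section riesz.
Context {R : realType}.

Local Notation r_ n := ((2 : R)^-1 ^+ n).

Lemma half_pow_gt0 n : 0 < r_ n.
Proof. by rewrite exprn_gt0// invr_gt0. Qed.

Lemma half_pow_le1 n : r_ n <= 1.
Proof. by rewrite exprn_ile1 ?invr_ge0// invf_le1 ?ler1n. Qed.

Lemma half_pow_cvg : r_ n @[n --> \oo] --> 0.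
Proof. by apply: cvg_expr; rewrite gtr0_norm ?invr_gt0// invf_lt1// ltr1n. Qed.

Lemma le_half_pow (X C B : R) : (forall n, X <= C + r_ n * B) -> X <= C.
Proof.
move=> H; have : C + r_ n * B @[n --> \oo] --> C + 0 * B.
  by apply: cvgD; [exact: cvg_cst|apply: cvgM; [exact: half_pow_cvg|exact: cvg_cst]].
rewrite mul0r addr0 => L; rewrite -(cvg_lim (@Rhausdorff R) L).
by apply: limr_ge; [apply/cvg_ex; exists C|exact: nearW].
Qed.

(** The Riesz representation of l by minimization of a(v, v) - 2 l(v). No
    completeness is assumed: the representing vector is delivered as a
    minimizing sequence with an explicit rate, and the parallelogram identity
    makes that sequence Cauchy. *)
Lemma riesz_sequence (V : Type) (S : set V) (lin : R -> V -> V -> V)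
    (a : V -> V -> R) (l : V -> R) (C : R) :
    S !=set0 -> 0 <= C ->
    (forall c u v, S u -> S v -> S (lin c u v)) ->
    (forall c u v w, S u -> S v -> S w -> a (lin c u v) w = c * a u w + a v w) ->
    (forall u v, S u -> S v -> a u v = a v u) ->
    (forall u, S u -> 0 <= a u u) ->
    (forall c u v, S u -> S v -> l (lin c u v) = c * l u + l v) ->
    (forall u, S u -> l u ^+ 2 <= C * a u u) ->
  exists v : nat -> V, [/\ forall n, S (v n),
    forall m n, let w := lin (-1) (v m) (v n) in a w w <= 2 * (r_ m ^+ 2 + r_ n ^+ 2),
    forall n w, S w -> (a (v n) w - l w) ^+ 2 <= r_ n ^+ 2 * a w w &
    forall n, a (v n) (v n) <= C + r_ n * (C + 2)].
Proof.
move=> [v0 Sv0] C0 Slin alin asym a0 llin lC.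
have alinr c u v w : S u -> S v -> S w -> a w (lin c u v) = c * a w u + a w v.
  by move=> Su Sv Sw; rewrite asym ?alin// ?(asym w)//; exact: Slin.
pose J v := a v v - 2 * l v.
have JC v : S v -> - C <= J v.
  move=> Sv; have av := a0 _ Sv; have lv := lC _ Sv; rewrite /J.
  suff : 2 * l v <= a v v + C by lra.
  have [l0|l0] := leP (l v) 0; first by lra.
  rewrite -ler_sqr ?nnegrE; [|lra|lra].
  have := sqr_ge0 (a v v - C); nra.
have infJ : has_inf (J @` S).
  split; first by exists (J v0), v0.
  by exists (- C) => _ [v Sv <-]; exact: JC.
have ex n : exists v, S v /\ J v < inf (J @` S) + r_ n ^+ 2.
  have e0 : 0 < r_ n ^+ 2 by rewrite exprn_gt0// half_pow_gt0.
  by have [_ [v Sv <-] Jv] := inf_adherent e0 infJ; exists v.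
have [v Hv] := choice ex.
have Sv n : S (v n) by case: (Hv n).
have Jv n : J (v n) < inf (J @` S) + r_ n ^+ 2 by case: (Hv n).
have Jinf w : S w -> inf (J @` S) <= J w.
  by move=> Sw; apply: ge_inf; [case: infJ|exists w].
have weak n w : S w -> (a (v n) w - l w) ^+ 2 <= r_ n ^+ 2 * a w w.
  move=> Sw; rewrite mulrC; apply: discriminant_le; first exact: a0.
  move=> t; have St := Slin (- t) _ _ Sw (Sv n).
  have := Jinf _ St; have := Jv n.
  rewrite /J alin// !alinr// llin// (asym w (v n))//; nra.
exists v; split => //.
- move=> m n /=.
  have Smid := Slin 2^-1 _ _ (Slin (-1) _ _ (Sv m) (Sv n)) (Sv m).
  have Sd := Slin (-1) _ _ (Sv m) (Sv n).
  have := Jinf _ Smid; have := Jv m; have := Jv n.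
  rewrite /J !(alin, alinr, llin)// (asym (v n) (v m))//; lra.
- move=> n; have := weak n _ (Sv n); have := lC _ (Sv n); have := a0 _ (Sv n).
  have r0 := half_pow_gt0 n; have r1 := half_pow_le1 n.
  move: (a (v n) (v n)) (l (v n)) (r_ n) r0 r1 => A L r r0 r1 A0 LA rA.
  have [->|A1] := eqVneq A 0; first by nra.
  have {A0 A1}A0 : 0 < A by rewrite lt0r A1.
  (* Young's inequality for A = L + (A - L) with weight r *)
  have Y : r * A ^+ 2 <= r * (1 + r) * L ^+ 2 + (1 + r) * (A - L) ^+ 2.
    rewrite -subr_ge0 (_ : _ - _ = (r * L - (A - L)) ^+ 2) ?sqr_ge0//; ring.
  have : r * A ^+ 2 <= (r * (1 + r) * C + (1 + r) * r ^+ 2) * A.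
    apply: le_trans Y _; rewrite [leRHS]mulrDl; apply: lerD.
      by rewrite -[leRHS]mulrA ler_wpM2l//; apply: mulr_ge0; lra.
    by rewrite -[leRHS]mulrA ler_wpM2l//; lra.
  have -> : (r * (1 + r) * C + (1 + r) * r ^+ 2) * A = r * A * (C + r * (C + (1 + r))) by ring.
  rewrite expr2 mulrA ler_pM2l ?mulr_gt0// => h; apply: le_trans h _.
  by rewrite lerD2l ler_wpM2l//; lra.
Qed.

Lemma nneseries_cvg (a : nat -> R) : (forall n, 0 <= a n) ->
  (\sum_(n <oo) (a n)%:E < +oo)%E -> cvgn (series a).
Proof.
move=> a0 aoo; apply: nondecreasing_is_cvgn.
  apply/nondecreasing_seqP => n; rewrite /series /= big_nat_recr//= lerDl//.
exists (fine (\sum_(n <oo) (a n)%:E)%E) => _ [n _ <-].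
rewrite -lee_fin fineK; last first.
  by rewrite ge0_fin_numE//; apply: nneseries_ge0 => k _ _; rewrite lee_fin.
rewrite /series /= -sumEFin; apply: nneseries_lim_ge => k _ _.
by rewrite lee_fin.
Qed.

End riesz.

(** * Completeness of weighted square integrable functions *)

Section weighted_L2.
Context {R : realType} {d : nat}.
Local Notation T := 'rV[R]_d.
Local Notation leb := (@lebesgue_rV R d).
Local Notation r_ n := ((2 : R)^-1 ^+ n).
Implicit Types (w f g : T -> R).

(** Equivalent to L2 for nonnegative measurable weights (L2_l2w), in a form
    adapted to linear combinations. *)
Definition l2w w f := measurable_fun [set: T] f /\ integ (fun x => f x ^+ 2 * w x).

Lemma L2_l2w w f : (forall x, 0 <= w x) -> measurable_fun [set: T] w ->
  L2 w f <-> l2w w f.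
Proof.
move=> w0 mw; split=> -[mf fi]; split => //; last exact: integ_lt_pinfty.
apply: ge0_integ => //; first by apply: measurable_funM => //; exact: measurable_funX.
by move=> x; rewrite mulr_ge0 ?sqr_ge0.
Qed.

Section one_weight.
Variable w : T -> R.
Hypotheses (w0 : forall x, 0 < w x) (cw : continuous w).

Let mw : measurable_fun [set: T] w. Proof. exact: continuous_measurable_rV. Qed.
Let w_ge0 x : 0 <= w x. Proof. exact: ltW. Qed.

Lemma l2w_CauchySchwarz f g : l2w w f -> l2w w g ->
  integ (fun x => f x * g x * w x) /\
  (\int[leb]_x (f x * g x * w x)) ^+ 2 <=
    \int[leb]_x (f x ^+ 2 * w x) * \int[leb]_x (g x ^+ 2 * w x).
Proof.
move=> [mf fi] [mg gi]; apply: Int_CauchySchwarz => //.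
- by apply: measurable_funM => //; exact: measurable_funM.
- by move=> x; rewrite mulr_ge0 ?sqr_ge0.
- by move=> x; rewrite mulr_ge0 ?sqr_ge0.
- by move=> x; apply: le_of_eq; ring.
Qed.

Lemma l2w_mul f g : l2w w f -> l2w w g -> integ (fun x => f x * g x * w x).
Proof. by move=> fw gw; have [] := l2w_CauchySchwarz fw gw. Qed.

Lemma l2wZ c f : l2w w f -> l2w w (fun x => c * f x).
Proof.
move=> [mf fi]; split; first exact: measurable_funM.
by apply: integ_ext (integZ (c ^+ 2) fi) => x; ring.
Qed.

Lemma l2wD f g : l2w w f -> l2w w g -> l2w w (fun x => f x + g x).
Proof.
move=> fw gw; have [mf fi] := fw; have [mg gi] := gw.
split; first exact: measurable_funD.
apply: integ_ext (integD (integD fi gi) (integZ 2 (l2w_mul fw gw))) => x; ring.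
Qed.

Lemma l2wB f g : l2w w f -> l2w w g -> l2w w (fun x => f x - g x).
Proof.
move=> fw /(l2wZ (-1)) /(l2wD fw).
by congr l2w; apply/funext => x; rewrite mulN1r.
Qed.

Lemma l2w_l2loc f : l2w w f -> l2loc f.
Proof.
move=> [mf fi]; split => //.
have cV : continuous (fun x => (w x)^-1).
  by move=> x; apply: (@continuousV R T w x); [exact: lt0r_neq0 (w0 x)|exact: cw].
have := locM (integ_loc fi) cV; congr (locally_integrable_rV _).
by apply/funext => x; rewrite mulfK// lt0r_neq0.
Qed.

Lemma l2loc_l2w f : l2loc f -> csupp f -> l2w w f.
Proof.
move=> [mf fl] [r fr]; split => //; apply: loc_csupp; first exact: locM.
by exists r => x /fr ->; rewrite expr0n mul0r.
Qed.

Variables (f_ : nat -> T -> R) (K : R).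
Hypotheses (fw : forall n, l2w w (f_ n)) (K0 : 0 <= K).
Hypothesis f_cauchy : forall m n,
  \int[leb]_x ((f_ m x - f_ n x) ^+ 2 * w x) <= K * (r_ m ^+ 2 + r_ n ^+ 2).

(* Completeness is needed only along sequences with this geometric rate, for
   which no extraction of a subsequence is necessary. *)
Let D n x := (f_ n.+1 x - f_ n x) ^+ 2 * w x.

Let D_integ n : integ (D n).
Proof. by have [_] := l2wB (fw n.+1) (fw n). Qed.

Let D_ge0 n x : 0 <= D n x.
Proof. by rewrite mulr_ge0 ?sqr_ge0. Qed.

Let rinv n : 0 < (r_ n)^-1.
Proof. by rewrite invr_gt0 half_pow_gt0. Qed.

(* A weight growing slower than the rate of decay turns summability of the
   integrals into pointwise summability of the increments. *)
Let D_series : {ae leb, forall x, (\sum_(n <oo) ((r_ n)^-1 * D n x)%:E < +oo)%E}.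
Proof.
have mD n : measurable_fun [set: T] (fun x => ((r_ n)^-1 * D n x)%:E).
  by apply/measurable_EFinP; exact: integ_meas (integZ _ (D_integ n)).
have pD n x : (0 <= ((r_ n)^-1 * D n x)%:E)%E.
  by rewrite lee_fin mulr_ge0// ltW.
have : (\int[leb]_x (\sum_(n <oo) ((r_ n)^-1 * D n x)%:E) < +oo)%E.
  rewrite integral_nneseries//.
  apply: (@le_lt_trans _ _ (\sum_(n <oo) (geometric (2 * K) 2^-1 n)%:E)%E).
    apply: lee_nneseries => [n _ _|n _]; first by apply: integral_ge0 => x _.
    rewrite EFin_Int; last exact: integZ.
    rewrite lee_fin IntZ// ler_pdivrMl ?half_pow_gt0//.
    apply: le_trans (f_cauchy n.+1 n) _; rewrite /geometric /= (exprS _ n).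
    have := half_pow_gt0 (R := R) n; move: (r_ n) => r r0.
    rewrite -subr_ge0 (_ : _ - _ = 3 / 4 * (K * r ^+ 2)); last by field.
    by rewrite mulr_ge0// mulr_ge0 ?sqr_ge0.
  have : cvgn (series (geometric (2 * K) (2 : R)^-1)).
    by apply: is_cvg_geometric_series; rewrite gtr0_norm ?invr_gt0// invf_lt1// ltr1n.
  move=> /cvg_ex[l Hl].
  have : (fun n => (series (geometric (2 * K) (2 : R)^-1) n)%:E) @ \oo --> l%:E.
    by apply: cvg_EFin; [exact: nearW|exact: Hl].
  rewrite (_ : (fun n => _) = (fun n => \sum_(0 <= k < n) (geometric (2 * K) 2^-1 k)%:E)%E).
    by move/cvg_lim => -> //; rewrite ltry.
  by apply/funext => n; rewrite /series /= sumEFin.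
move=> Soo.
have Si : leb.-integrable setT (fun x => (\sum_(n <oo) ((r_ n)^-1 * D n x)%:E)%E).
  apply/integrableP; split.
    by apply: ge0_emeasurable_sum => // n; exact: nearW.
  rewrite (eq_integral (fun x => (\sum_(n <oo) ((r_ n)^-1 * D n x)%:E)%E))//.
  by move=> x _; rewrite gee0_abs//; apply: nneseries_ge0.
have := integrable_ae measurableT Si; apply: filterS => x /(_ Logic.I).
by rewrite ge0_fin_numE//; apply: nneseries_ge0.
Qed.

Let D_cvg : {ae leb, forall x, cvgn (f_ ^~ x)}.
Proof.
apply: filterS D_series => x.
have p0 n : 0 <= (r_ n)^-1 * D n x by rewrite mulr_ge0// ltW.
move/(nneseries_cvg p0) => Dc.
pose u n := f_ n.+1 x - f_ n x.
have uc : cvgn (series u).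
  apply: normed_cvg.
  apply: (@series_le_cvg _ _ (geometric (w x)^-1 2^-1 + (fun n => (r_ n)^-1 * D n x))) => //.
  - by move=> n /=.
  - move=> n; apply: (@addr_ge0 R ((w x)^-1 * r_ n) ((r_ n)^-1 * D n x)) => //.
    by rewrite mulr_ge0 ?invr_ge0// ltW// half_pow_gt0.
  - move=> n /=; rewrite [leRHS]/((w x)^-1 * r_ n + (r_ n)^-1 * D n x) /D -/(u n).
    have r0 := half_pow_gt0 (R := R) n; rewrite -[u n ^+ 2]real_normK ?num_real//.
    rewrite -(ler_pM2r (w0 x)) -(ler_pM2r r0).
    have -> : ((w x)^-1 * r_ n + (r_ n)^-1 * (`|u n| ^+ 2 * w x)) * w x * r_ n =
        r_ n ^+ 2 + (`|u n| * w x) ^+ 2.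
      by field; rewrite !lt0r_neq0.
    rewrite [`| u n |]lock; move: (locked _) (r_ n) r0 => v r r0.
    move: (v * w x) => z.
    rewrite -subr_ge0 (_ : _ - _ = ((z - r) ^+ 2 + z ^+ 2 + r ^+ 2) / 2); last by field.
    by apply: divr_ge0 => //; rewrite !addr_ge0// sqr_ge0.
  - apply: is_cvg_seriesD => //.
    by apply: is_cvg_geometric_series; rewrite gtr0_norm ?invr_gt0// invf_lt1// ltr1n.
have := telescopeK (f_ ^~ x); rewrite -/u => E.
have {}uc : cvgn (fun n => f_ n x - f_ 0%N x) by move: uc; rewrite -/(telescope (f_ ^~ x)) E.
have : cvgn (fun n => (f_ n x - f_ 0%N x) + f_ 0%N x).
  by apply: is_cvgD => //; exact: is_cvg_cst.
by congr (cvgn _); apply/funext => n; rewrite subrK.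
Qed.

(* The limit superior is measurable everywhere and is the limit wherever the
   sequence converges. *)
Let f x := fine (limn_esup (fun n => (f_ n x)%:E)).

Let mf : measurable_fun [set: T] f.
Proof.
apply: measurableT_comp; first exact: fine_measurable.
apply: measurable_fun_limn_esup => n; apply/measurable_EFinP.
by have [] := fw n.
Qed.

Let f_cvg : {ae leb, forall x, f_ n x @[n --> \oo] --> f x}.
Proof.
apply: filterS D_cvg => x /cvg_ex[l /= fl].
have : (f_ n x)%:E @[n --> \oo] --> l%:E.
  by apply: cvg_EFin; [exact: nearW|exact: fl].
by move=> /cvg_limn_einf_sup[_ E]; rewrite /f E.
Qed.

(** Fatou's lemma transfers the Cauchy estimate to the pointwise limit. *)
Lemma l2w_complete : exists2 f, l2w w f &
  forall n, \int[leb]_x ((f_ n x - f x) ^+ 2 * w x) <= 2 * K * r_ n ^+ 2.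
Proof.
have mdf n : measurable_fun [set: T] (fun x => (f_ n x - f x) ^+ 2 * w x).
  apply: measurable_funM => //; apply: measurable_funX; apply: measurable_funB => //.
  by have [] := fw n.
have pdf n x : 0 <= (f_ n x - f x) ^+ 2 * w x by rewrite mulr_ge0 ?sqr_ge0.
have bound n : (\int[leb]_x ((f_ n x - f x) ^+ 2 * w x)%:E <= (2 * K * r_ n ^+ 2)%:E)%E.
  pose g m x := ((f_ n x - f_ (n + m)%N x) ^+ 2 * w x)%:E.
  have gi m : integ (fun x => (f_ n x - f_ (n + m)%N x) ^+ 2 * w x).
    by have [] := l2wB (fw n) (fw (n + m)%N).
  have mg m : measurable_fun [set: T] (g m).
    by apply/measurable_EFinP; exact: integ_meas (gi m).
  have g0 m x : setT x -> (0 <= g m x)%E by rewrite lee_fin mulr_ge0 ?sqr_ge0.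
  have /le_trans := fatou leb measurableT mg g0.
  have <- : (\int[leb]_x ((f_ n x - f x) ^+ 2 * w x)%:E = \int[leb]_x limn_einf (g^~ x))%E.
    apply: ae_eq_integral => //.
    - exact/measurable_EFinP.
    - apply: measurableT_comp; first exact: oppe_measurable.
      by apply: measurable_fun_limn_esup => m; apply: measurableT_comp (mg m); exact: oppe_measurable.
    apply: filterS f_cvg => x fx _.
    have : g m x @[m --> \oo] --> ((f_ n x - f x) ^+ 2 * w x)%:E.
      apply: cvg_EFin; first exact: nearW.
      apply: cvgM; last exact: cvg_cst.
      have fx' : f_ (n + m)%N x @[m --> \oo] --> f x.
        have := fx; rewrite -(cvg_shiftn n (f_ ^~ x)) => h.
        rewrite (_ : (fun m => _) = (fun m => f_ (m + n)%N x)); first exact: h.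
        by apply/funext => m; rewrite addnC.
      have fx2 : f_ n x - f_ (n + m)%N x @[m --> \oo] --> f_ n x - f x.
        by apply: cvgB => //; exact: cvg_cst.
      exact: (cvgM fx2 fx2).
    by move=> /cvg_limn_einf_sup[-> _].
  apply; rewrite limn_einf_lim; apply: lime_le; first exact: is_cvg_einfs.
  apply: nearW => m; apply: (@le_trans _ _ (\int[leb]_x g m x)%E).
    by apply: ereal_inf_lbound; exists m => /=.
  rewrite EFin_Int// lee_fin; apply: le_trans (f_cauchy _ _) _.
  rewrite [2 * K]mulrC -mulrA ler_wpM2l// mulrDl mul1r lerD2l exprD exprMn.
  have rn := half_pow_gt0 (R := R) n; have rm := half_pow_gt0 (R := R) m.
  by rewrite ger_pMr ?exprn_gt0// exprn_ile1 ?half_pow_le1// ltW.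
have df n : l2w w (fun x => f_ n x - f x).
  split; first by apply: measurable_funB => //; have [] := fw n.
  by apply: ge0_integ => //; apply: le_lt_trans (bound n) _; rewrite ltry.
exists f.
  have := l2wB (fw 0%N) (df 0%N); congr l2w; apply/funext => x; ring.
by move=> n; rewrite -lee_fin -EFin_Int//; case: (df n).
Qed.

End one_weight.

Lemma cvg_half_pow (X : nat -> R) (L B : R) : (forall n, (X n - L) ^+ 2 <= r_ n ^+ 2 * B) ->
  X n @[n --> \oo] --> L.
Proof.
move=> H; have B0 : 0 <= B.
  by have := le_trans (sqr_ge0 _) (H 0%N); rewrite expr0 expr1n mul1r.
have XL n : `|L - X n| <= r_ n * (B + 1).
  have r0 := half_pow_gt0 (R := R) n.
  have rB : 0 <= r_ n * (B + 1) by rewrite mulr_ge0 ?addr_ge0// ltW.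
  rewrite -ler_sqr ?nnegrE//.
  rewrite real_normK ?num_real// (_ : (L - X n) ^+ 2 = (X n - L) ^+ 2); last by ring.
  apply: le_trans (H n) _; rewrite exprMn ler_wpM2l ?sqr_ge0//.
  nra.
apply/cvgrPdist_le => e e0.
have : r_ n * (B + 1) @[n --> \oo] --> 0 * (B + 1).
  by apply: cvgM; [exact: half_pow_cvg|exact: cvg_cst].
rewrite mul0r => /cvgrPdist_le/(_ e e0)[N _ HN]; exists N => // n /HN.
rewrite sub0r normrN; apply: le_trans; apply: le_trans (XL n) _; exact: ler_norm.
Qed.

End weighted_L2.

(** * Duality and weak solutions *)

Section representation.
Context {R : realType} {d : nat}.
Local Notation T := 'rV[R]_d.
Local Notation leb := (@lebesgue_rV R d).
Local Notation r_ n := ((2 : R)^-1 ^+ n).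
Variable p : T -> R.
Hypotheses (p0 : forall x, 0 < p x) (cp : continuous p).
Implicit Types (f g : T -> R).

Let mp : measurable_fun [set: T] p. Proof. exact: continuous_measurable_rV. Qed.
Let p_ge0 x : 0 <= p x. Proof. exact: ltW. Qed.
Let p_neq0 x : p x != 0. Proof. exact: lt0r_neq0. Qed.

Let q x := (p x)^-1.
Let q0 x : 0 < q x. Proof. by rewrite invr_gt0. Qed.
Let cq : continuous q.
Proof. by move=> x; apply: (@continuousV R T p x); [exact: p_neq0|exact: cp]. Qed.

Lemma l2w_cvg (w : T -> R) (f_ : nat -> T -> R) f g B : (forall x, 0 < w x) -> continuous w ->
  (forall n, l2w w (f_ n)) -> l2w w f ->
  (forall n, \int[leb]_x ((f_ n x - f x) ^+ 2 * w x) <= B * r_ n ^+ 2) ->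
  l2w w g ->
  \int[leb]_x (f_ n x * g x * w x) @[n --> \oo] --> \int[leb]_x (f x * g x * w x).
Proof.
move=> w0 cw fw fw' fB gw.
apply: (@cvg_half_pow _ _ _ (B * \int[leb]_x (g x ^+ 2 * w x))) => n.
rewrite -IntB; [|exact: l2w_mul|exact: l2w_mul].
have dw := l2wB w0 cw (fw n) fw'.
have [_ CS] := l2w_CauchySchwarz w0 cw dw gw.
rewrite mulrA [_ * B]mulrC (eq_Int (g := fun x => (f_ n x - f x) * g x * w x)).
  apply: le_trans CS _; apply: ler_wpM2r; last exact: fB.
  by apply: Int_ge0 => x; rewrite mulr_ge0 ?sqr_ge0// ltW.
by move=> x; ring.
Qed.

Lemma cvg_sumr (J : Type) (s : seq J) (F : J -> nat -> R) (l : J -> R) :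
  (forall j, F j n @[n --> \oo] --> l j) ->
  \sum_(j <- s) F j n @[n --> \oo] --> \sum_(j <- s) l j.
Proof.
move=> Fl; elim: s => [|j s IH].
  rewrite big_nil (_ : (fun _ => _) = (fun=> 0)); first exact: cvg_cst.
  by apply/funext => n; rewrite big_nil.
rewrite big_cons (_ : (fun _ => _) = (fun n => F j n + \sum_(j <- s) F j n)).
  by apply: cvgD => //; exact: Fl.
by apply/funext => n; rewrite big_cons.
Qed.

(** The Riesz representative of l for the weight 1 / p lies in the completion
    of the test functions for that weight; divided by p, it is square
    integrable for p and represents l in the plain pairing. This produces weak
    derivatives, l being then an integral against derivatives of eta. *)
Lemma l2_duality (J : finType) (l : (J -> T -> R) -> R) C : 0 <= C ->
    (forall c eta zeta, (forall j, test_function (eta j)) ->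
      (forall j, test_function (zeta j)) ->
      l (fun j x => c * eta j x + zeta j x) = c * l eta + l zeta) ->
    (forall eta, (forall j, test_function (eta j)) ->
      l eta ^+ 2 <= C * \sum_j \int[leb]_x (eta j x ^+ 2 * (p x)^-1)) ->
  exists g : J -> T -> R, [/\ forall j, l2w p (g j),
    forall eta, (forall j, test_function (eta j)) ->
      l eta = \sum_j \int[leb]_x (g j x * eta j x) &
    \sum_j \int[leb]_x (g j x ^+ 2 * p x) <= C].
Proof.
move=> C0 llin lC.
pose S : set (J -> T -> R) := [set eta | forall j, test_function (eta j)].
pose lin (c : R) (u v : J -> T -> R) := (fun j x => c * u j x + v j x).
pose a (u v : J -> T -> R) := \sum_j \int[leb]_x (u j x * v j x * q x).
have Sq u j : S u -> l2w q (u j).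
  move=> Su; apply: l2loc_l2w => //; last exact: test_csupp.
  by apply: l2loc_continuous; exact: test_continuous.
have Slin c u v : S u -> S v -> S (lin c u v).
  move=> Su Sv j; apply: testD => //; apply: testM => // k; exact: Ck_cst.
have S0 : S !=set0.
  exists (fun _ _ => 0) => j; apply: csupp_test => [k|]; first exact: Ck_cst.
  by exists 0.
have alin c u v w : S u -> S v -> S w -> a (lin c u v) w = c * a u w + a v w.
  move=> Su Sv Sw; rewrite /a mulr_sumr -big_split; apply: eq_bigr => j _ /=.
  rewrite -IntZ; last by apply: l2w_mul => //; exact: Sq.
  rewrite -IntD; [|apply: integZ|]; try by apply: l2w_mul => //; exact: Sq.
  by apply: eq_Int => x; rewrite /lin; ring.
have asym u v : S u -> S v -> a u v = a v u.
  by move=> _ _; apply: eq_bigr => j _; apply: eq_Int => x; ring.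
have aE u : a u u = \sum_j \int[leb]_x (u j x ^+ 2 * q x).
  by apply: eq_bigr => j _; apply: eq_Int => x; rewrite expr2.
have a0 u : S u -> 0 <= a u u.
  move=> _; rewrite aE; apply: sumr_ge0 => j _; apply: Int_ge0 => x.
  by rewrite mulr_ge0 ?sqr_ge0// ltW.
have lC' u : S u -> l u ^+ 2 <= C * a u u by move=> Su; rewrite aE; exact: lC.
have [v [Sv v_cauchy v_weak v_norm]] :=
  riesz_sequence S0 C0 Slin alin asym a0 llin lC'.
have vq n j : l2w q (v n j) by exact: Sq.
have cauchy j m n : \int[leb]_x ((v m j x - v n j x) ^+ 2 * q x) <= 2 * (r_ m ^+ 2 + r_ n ^+ 2).
  apply: le_trans (v_cauchy m n) => /=; rewrite aE (bigD1 j)//= -[leLHS]addr0 lerD//.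
    apply: le_of_eq.
    by apply: eq_Int => x; rewrite /lin; ring.
  apply: sumr_ge0 => i _; apply: Int_ge0 => x.
  by rewrite mulr_ge0 ?sqr_ge0// ltW.
have limits j : exists g, l2w q g /\
    forall n, \int[leb]_x ((v n j x - g x) ^+ 2 * q x) <= 2 * 2 * r_ n ^+ 2.
  have [g gq gv] := @l2w_complete R d q q0 cq (fun n => v n j) 2 (vq^~ j) (ler0n _ _) (cauchy j).
  by exists g.
have [g Hg] := choice limits.
have gq j : l2w q (g j) by case: (Hg j).
exists (fun j x => g j x * q x); split.
- move=> j; have [mg gi] := gq j; split.
    by apply: measurable_funM => //; exact: continuous_measurable_rV.
  by apply: integ_ext gi => x; rewrite /q; field.
- move=> eta te; have Seta : S eta by [].
  have L1 : a (v n) eta @[n --> \oo] --> l eta.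
    by apply: (@cvg_half_pow _ _ _ (a eta eta)) => n; exact: v_weak.
  have L2 : a (v n) eta @[n --> \oo] --> \sum_j \int[leb]_x (g j x * eta j x * q x).
    apply: cvg_sumr => j.
    exact: (l2w_cvg q0 cq (vq^~ j) (gq j) (Hg j).2 (Sq _ j Seta)).
  rewrite (cvg_unique _ L1 L2)//; apply: eq_bigr => j _; apply: eq_Int => x; ring.
- have -> : \sum_j \int[leb]_x ((g j x * q x) ^+ 2 * p x) = \sum_j \int[leb]_x (g j x ^+ 2 * q x).
    by apply: eq_bigr => j _; apply: eq_Int => x; rewrite /q; field.
  apply: (@le_half_pow _ _ _ (3 * C + 4 + 8 * #|J|%:R)) => n.
  have r0 := half_pow_gt0 (R := R) n; have r1 := half_pow_le1 (R := R) n.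
  (* Young's inequality with weight r_ n loses a factor tending to 1 only. *)
  have single j : \int[leb]_x (g j x ^+ 2 * q x) <=
      (1 + r_ n) * \int[leb]_x (v n j x ^+ 2 * q x) + (1 + (r_ n)^-1) * (4 * r_ n ^+ 2).
    have [_ gi] := gq j; have [_ vi] := vq n j.
    have [_ di] := l2wB q0 cq (vq n j) (gq j).
    apply: (@le_trans _ _ ((1 + r_ n) * \int[leb]_x (v n j x ^+ 2 * q x) +
        (1 + (r_ n)^-1) * \int[leb]_x ((v n j x - g j x) ^+ 2 * q x))).
      rewrite -!IntZ// -IntD; [|exact: integZ|exact: integZ].
      apply: le_Int => //; first by apply: integD; exact: integZ.
      move=> x; rewrite !mulrA -mulrDl; apply: ler_wpM2r; first exact: ltW.
      rewrite -subr_ge0 -(pmulr_rge0 _ r0).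
      rewrite (_ : _ * _ = (r_ n * v n j x + (v n j x - g j x)) ^+ 2); last first.
        by field; exact: lt0r_neq0.
      exact: sqr_ge0.
    rewrite lerD2l; apply: ler_wpM2l; first by rewrite addr_ge0// invr_ge0 ltW.
    by apply: le_trans ((Hg j).2 n) _; rewrite -natrM.
  apply: (@le_trans _ _ (\sum_j ((1 + r_ n) * \int[leb]_x (v n j x ^+ 2 * q x) +
      (1 + (r_ n)^-1) * (4 * r_ n ^+ 2)))); first exact: ler_sum.
  rewrite big_split /= -mulr_sumr -aE sumr_const -[X in _ + X]mulr_natr.
  rewrite (_ : #|_| = #|J|); last exact: eq_card.
  have := v_norm n; move: (a _ _) (r_ n) r0 r1 => A r r0 r1 Av.
  have -> : (1 + r^-1) * (4 * r ^+ 2) * #|J|%:R = r * (4 * (1 + r) * #|J|%:R).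
    by field; exact: lt0r_neq0.
  apply: (@le_trans _ _ ((1 + r) * (C + r * (C + 2)) + r * (8 * #|J|%:R))).
    apply: lerD; first by rewrite ler_wpM2l//; lra.
    by apply: ler_wpM2l; [exact: ltW|rewrite ler_wpM2r//; lra].
  have -> : (1 + r) * (C + r * (C + 2)) = C + r * (2 * C + 2 + r * (C + 2)) by ring.
  rewrite -addrA lerD2l -mulrDr; apply: ler_wpM2l; [exact: ltW|rewrite lerD2r].
  have : r * (C + 2) <= C + 2 by rewrite ler_piMl//; lra.
  lra.
Qed.

(** The gradient is an explicit argument, which spares the choice of a
    representative in constructions. *)
Definition H1 (u : T -> R) (v : 'I_d -> T -> R) :=
  l2w p u /\ forall i, is_weak_partial i u (v i) /\ l2w p (v i).

Definition energy (v : 'I_d -> T -> R) := \sum_i \int[leb]_x (v i x ^+ 2 * p x).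

Lemma energy_ge0 v : 0 <= energy v.
Proof. by apply: sumr_ge0 => i _; apply: Int_ge0 => x; rewrite mulr_ge0 ?sqr_ge0. Qed.

Lemma H1D u v u' v' : H1 u v -> H1 u' v' ->
  H1 (fun x => u x + u' x) (fun i x => v i x + v' i x).
Proof.
move=> [uw H] [uw' H']; split; first exact: l2wD.
move=> i; have [dv vw] := H i; have [dv' vw'] := H' i.
by split; [exact: weak_partialD|exact: l2wD].
Qed.

Lemma H1Z c u v : H1 u v -> H1 (fun x => c * u x) (fun i x => c * v i x).
Proof.
move=> [uw H]; split; first exact: l2wZ.
by move=> i; have [dv vw] := H i; split; [exact: weak_partialZ|exact: l2wZ].
Qed.

Hypotheses (pi : integ p) (p1 : \int[leb]_x p x = 1).

Lemma l2w_cst c : l2w p (fun=> c).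
Proof. by split; [exact: measurable_cst|exact: integZ]. Qed.

Lemma H1_cst c : H1 (fun=> c) (fun _ _ => 0).
Proof.
split; first exact: l2w_cst.
move=> i; split; last exact: l2w_cst.
have := C1_weak_partial i (Ck_cst 1 c).
congr is_weak_partial; apply: partialE => x; exact: is_derive_cst.
Qed.

Lemma H1_integ u v : H1 u v -> integ (fun x => u x * p x).
Proof.
move=> [uw _]; apply: integ_ext (l2w_mul p0 cp uw (l2w_cst 1)) => x.
by rewrite mulr1.
Qed.

(** Existence of weak solutions: the Poincare inequality makes the Dirichlet
    form coercive on the functions with zero mean. *)
Lemma weak_solution_exists lambda f : 0 < lambda ->
    (forall u v, H1 u v -> \int[leb]_x (u x * p x) = 0 ->
      \int[leb]_x (u x ^+ 2 * p x) <= lambda^-1 * \sum_i \int[leb]_x (v i x ^+ 2 * p x)) ->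
    l2w p f -> \int[leb]_x (f x * p x) = 0 ->
  exists u v, [/\ H1 u v, \int[leb]_x (u x * p x) = 0 &
    forall u' v', H1 u' v' ->
      \sum_i \int[leb]_x (v i x * v' i x * p x) = \int[leb]_x (f x * u' x * p x)].
Proof.
move=> lam0 poincare fw f0.
pose V := ((T -> R) * ('I_d -> T -> R))%type.
pose S : set V := [set u | H1 u.1 u.2 /\ \int[leb]_x (u.1 x * p x) = 0].
pose lin (c : R) (u v : V) : V :=
  ((fun x => c * u.1 x + v.1 x), (fun i x => c * u.2 i x + v.2 i x)).
pose a (u v : V) := \sum_i \int[leb]_x (u.2 i x * v.2 i x * p x).
pose l (u : V) := \int[leb]_x (f x * u.1 x * p x).
pose C := \int[leb]_x (f x ^+ 2 * p x) * lambda^-1.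
have C0 : 0 <= C.
  apply: mulr_ge0; last by rewrite invr_ge0 ltW.
  by apply: Int_ge0 => x; rewrite mulr_ge0 ?sqr_ge0.
have S0 : S !=set0.
  exists ((fun=> 0), (fun _ _ => 0)); split; first exact: H1_cst.
  by rewrite -[RHS](@Int0 R d); apply: eq_Int => x; rewrite mul0r.
have Slin c u v : S u -> S v -> S (lin c u v).
  move=> [Su u0] [Sv v0]; split; first by apply: H1D => //; exact: H1Z.
  rewrite (eq_Int (g := fun x => c * (u.1 x * p x) + v.1 x * p x)) => [|x] /=; last by ring.
  rewrite IntD; [|apply: integZ; exact: H1_integ Su|exact: H1_integ Sv].
  by rewrite IntZ ?u0 ?v0 ?mulr0 ?addr0//; exact: H1_integ Su.
have vw i u : S u -> l2w p (u.2 i) by move=> [[_ /(_ i)[]]].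
have alin c u v w : S u -> S v -> S w -> a (lin c u v) w = c * a u w + a v w.
  move=> Su Sv Sw; rewrite /a mulr_sumr -big_split; apply: eq_bigr => j _ /=.
  rewrite -IntZ; last by apply: l2w_mul => //; exact: vw.
  rewrite -IntD; [|apply: integZ|]; try by apply: l2w_mul => //; exact: vw.
  by apply: eq_Int => x; ring.
have asym u v : S u -> S v -> a u v = a v u.
  by move=> _ _; apply: eq_bigr => j _; apply: eq_Int => x; ring.
have aE u : a u u = \sum_j \int[leb]_x (u.2 j x ^+ 2 * p x).
  by apply: eq_bigr => j _; apply: eq_Int => x; rewrite expr2.
have a0 u : S u -> 0 <= a u u.
  move=> _; rewrite aE; apply: sumr_ge0 => j _; apply: Int_ge0 => x.
  by rewrite mulr_ge0 ?sqr_ge0.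
have llin c u v : S u -> S v -> l (lin c u v) = c * l u + l v.
  move=> [[uw _] _] [[vw' _] _]; rewrite /l.
  rewrite -IntZ; last exact: l2w_mul.
  rewrite -IntD; [|apply: integZ; exact: l2w_mul|exact: l2w_mul].
  by apply: eq_Int => x /=; ring.
have lC u : S u -> l u ^+ 2 <= C * a u u.
  move=> [[uw H] u0]; have [_ CS] := l2w_CauchySchwarz p0 cp fw uw.
  apply: le_trans CS _; rewrite /C -mulrA ler_wpM2l//.
    by apply: Int_ge0 => x; rewrite mulr_ge0 ?sqr_ge0.
  by rewrite aE; exact: poincare.
have [v [Sv v_cauchy v_weak _]] := riesz_sequence S0 C0 Slin alin asym a0 llin lC.
have dE i m n : \int[leb]_x (((v m).2 i x - (v n).2 i x) ^+ 2 * p x) =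
    \int[leb]_x ((lin (-1) (v m) (v n)).2 i x ^+ 2 * p x).
  by apply: eq_Int => x /=; ring.
have cauchy i m n : \int[leb]_x (((v m).2 i x - (v n).2 i x) ^+ 2 * p x) <=
    2 * (r_ m ^+ 2 + r_ n ^+ 2).
  apply: le_trans (v_cauchy m n) => /=; rewrite aE (bigD1 i)//= -[leLHS]addr0 lerD//.
    by rewrite dE.
  apply: sumr_ge0 => j _; apply: Int_ge0 => x.
  by rewrite mulr_ge0 ?sqr_ge0.
have cauchy0 m n : \int[leb]_x (((v m).1 x - (v n).1 x) ^+ 2 * p x) <=
    (lambda^-1 * 2) * (r_ m ^+ 2 + r_ n ^+ 2).
  have [Sd d0] := Slin (-1) _ _ (Sv m) (Sv n).
  have := poincare _ _ Sd d0; rewrite -aE => P.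
  rewrite (eq_Int (g := fun x => (lin (-1) (v m) (v n)).1 x ^+ 2 * p x)) => [|x] /=; last by ring.
  apply: le_trans P _; rewrite -mulrA; apply: ler_wpM2l; [by rewrite invr_ge0 ltW|exact: v_cauchy].
have limits i : exists g, l2w p g /\
    forall n, \int[leb]_x (((v n).2 i x - g x) ^+ 2 * p x) <= 2 * 2 * r_ n ^+ 2.
  have [g gp gv] := @l2w_complete R d p p0 cp (fun n => (v n).2 i) 2
    (fun n => vw i _ (Sv n)) (ler0n _ _) (cauchy i).
  by exists g.
have [g Hg] := choice limits.
have uw k : l2w p (v k).1 by have [H _] := Sv k; exact: H.1.
have K0 : 0 <= lambda^-1 * 2 by rewrite mulr_ge0// invr_ge0 ltW.
have [u up uv] := @l2w_complete R d p p0 cp (fun n => (v n).1) _ uw K0 cauchy0.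
have gp i : l2w p (g i) by case: (Hg i).
have uH1 : H1 u g.
  split => // i; split => //.
  split; [exact/l2loc_loc/l2w_l2loc|exact/l2loc_loc/l2w_l2loc|move=> eta te].
  (* Dividing test functions by p turns the weighted pairings into the plain
     ones that define weak derivatives. *)
  have tq zeta : test_function zeta -> l2w p (fun x => zeta x * q x).
    move=> tz; apply: l2loc_l2w => //; last exact/csuppMl/test_csupp.
    by apply: l2loc_continuous; apply: contM => //; exact: test_continuous.
  have L1 := l2w_cvg p0 cp uw up uv (tq _ (test_partial i te)).
  have L2 := l2w_cvg p0 cp (fun n => vw i _ (Sv n)) (gp i) (Hg i).2 (tq _ te).
  have E h zeta : \int[leb]_x (h x * (zeta x * q x) * p x) = \int[leb]_x (h x * zeta x).
    by apply: eq_Int => x; rewrite /q; field.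
  rewrite -E -[X in _ = - X]E; apply: (cvg_unique _ L1) => //.
  rewrite (_ : (fun n => _) = (fun n => - (\int[leb]_x ((v n).2 i x * (eta x * q x) * p x)))).
    exact: cvgN L2.
  apply/funext => n; rewrite !E; have [[_ /(_ i)[[_ _ H] _]] _] := Sv n.
  exact: H.
exists u, g; split => //.
- have L := l2w_cvg p0 cp uw up uv (l2w_cst 1).
  transitivity (\int[leb]_x (u x * 1 * p x)); first by apply: eq_Int => x; rewrite mulr1.
  apply: (cvg_unique _ L) => //; rewrite (_ : (fun n => _) = (fun=> 0)); first exact: cvg_cst.
  apply/funext => n; have [_ E] := Sv n; rewrite -[RHS]E.
  by apply: eq_Int => x; rewrite mulr1.
- move=> u' v' H'.
  pose c := \int[leb]_x (u' x * p x).
  (* Subtracting its mean makes u' admissible without changing the gradient. *)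
  pose w : V := lin 1 (u', v') ((fun=> - c), (fun _ _ => 0)).
  have Hw : H1 w.1 w.2 by apply: H1D; [exact: H1Z|exact: H1_cst].
  have Sw : S w.
    split => //; rewrite (eq_Int (g := fun x => u' x * p x + (- c) * p x)) => [|x] /=; last by ring.
    rewrite IntD; [|exact: H1_integ H'|exact: integZ].
    by rewrite IntZ// p1 mulr1 subrr.
  have L1 : a (v n) w @[n --> \oo] --> l w.
    by apply: (@cvg_half_pow _ _ _ (a w w)) => n; exact: v_weak.
  have L2 : a (v n) w @[n --> \oo] --> \sum_i \int[leb]_x (g i x * w.2 i x * p x).
    apply: cvg_sumr => i.
    exact: (l2w_cvg p0 cp (fun n => vw i _ (Sv n)) (gp i) (Hg i).2 (vw i _ Sw)).
  have := cvg_unique _ L1 L2 => /(_ (@Rhausdorff R)) E.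
  transitivity (\sum_i \int[leb]_x (g i x * w.2 i x * p x)).
    by apply: eq_bigr => i _; apply: eq_Int => x /=; ring.
  rewrite -E /l.
  have uw' : l2w p u' by case: H'.
  rewrite (eq_Int (g := fun x => f x * u' x * p x + (- c) * (f x * p x))) => [|x] /=; last by ring.
  have fi : integ (fun x => f x * p x).
    by apply: integ_ext (l2w_mul p0 cp fw (l2w_cst 1)) => x; rewrite mulr1.
  by rewrite IntD ?IntZ ?f0 ?mulr0 ?addr0//; [exact: l2w_mul|exact: integZ].
Qed.

End representation.

(** * Difference quotients under an exponential weight *)

Section exponential_weight.
Context {R : realType} {d : nat}.
Local Notation T := 'rV[R]_d.
Local Notation leb := (@lebesgue_rV R d).
Local Notation loc := (@locally_integrable_rV R d).
Local Notation e_ i := (delta_mx ord0 i : T).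
Implicit Types (f g : T -> R).

Lemma big_unit1 (F : unit -> R) : \sum_j F j = F tt.
Proof. by rewrite (big_pred1 tt) // => -[]. Qed.

Lemma is_derive_expR_comp (c : R) f x v l : is_derive x v f l ->
  is_derive x v (fun x : T => expR (c * f x)) (expR (c * f x) * (c * l)).
Proof.
move=> fl; apply: (@is_derive_comp1 _ _ expR (fun x => c * f x)).
Qed.

Lemma C1_expR (c : R) f : Ck 1 f -> Ck 1 (fun x : T => expR (c * f x)).
Proof.
move=> fC; have cf : continuous (fun x : T => expR (c * f x)).
  move=> x; have h := @contZ _ _ c f (Ck_continuous fC) x.
  exact: (cvg_comp _ _ h (@continuous_expR R _)).
apply: (@CkI _ _ 0 _ (fun i x => expR (c * f x) * (c * partial i f x))) => //.
- by move=> i x; apply: is_derive_expR_comp; exact: Ck_is_derive fC.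
- move=> i; split => //; apply: contM => //; apply: contZ.
  by exact: Ck_partial_continuous.
Qed.

Lemma partial_expR (c : R) f i : Ck 1 f ->
  partial i (fun x : T => expR (c * f x)) = (fun x => expR (c * f x) * (c * partial i f x)).
Proof.
by move=> fC; apply: partialE => x; apply: is_derive_expR_comp; exact: Ck_is_derive fC.
Qed.

Variables (G : T -> R).
Hypothesis GC : Ck 2 G.

Let GC1 : Ck 1 G. Proof. exact: CkS. Qed.

(** The weight and its inverse, both of the form expR (c * G) so that the same
    derivation rule serves for them. *)
Definition gibbs (x : T) := expR (-1 * G x).
Definition gibbsV (x : T) := expR (1 * G x).

Lemma gibbs_gt0 x : 0 < gibbs x. Proof. exact: expR_gt0. Qed.

Lemma gibbsV_gt0 x : 0 < gibbsV x. Proof. exact: expR_gt0. Qed.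

Lemma gibbsVE x : (gibbs x)^-1 = gibbsV x.
Proof. by rewrite /gibbs /gibbsV mulN1r mul1r expRN invrK. Qed.

Lemma gibbsM x : gibbs x * gibbsV x = 1.
Proof. by rewrite -gibbsVE mulfV// lt0r_neq0// gibbs_gt0. Qed.

Lemma gibbs_C1 : Ck 1 gibbs. Proof. exact: C1_expR. Qed.

Lemma gibbsV_C1 : Ck 1 gibbsV. Proof. exact: C1_expR. Qed.

Lemma gibbs_continuous : continuous gibbs.
Proof. exact: Ck_continuous gibbs_C1. Qed.

Lemma gibbsV_continuous : continuous gibbsV.
Proof. exact: Ck_continuous gibbsV_C1. Qed.

Definition dq k (s : R) f (x : T) : R := s^-1 * (f (x + s *: e_ k) - f x).

Lemma dq_weak_partial k s f g i : is_weak_partial i f g ->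
  is_weak_partial i (dq k s f) (dq k s g).
Proof. by move=> fg; apply: weak_partialZ; apply: weak_partialB => //; exact: weak_partial_shift. Qed.

Lemma dq_l2loc k s f : l2loc f -> l2loc (dq k s f).
Proof. by move=> fl; apply: l2locZ; apply: l2locB => //; exact: l2loc_shift. Qed.

Lemma dq_cont k s f : continuous f -> continuous (dq k s f).
Proof. by move=> fl; apply: contZ; apply: contB => //; exact: cont_shift. Qed.

(** On a bounded set G is Lipschitz, hence the weight changes by a factor
    close to 1 under small translations. *)
Lemma gibbsV_shift (chi : T -> R) (r delta : R) : (forall x, r < `|x| -> chi x = 0) -> 0 < delta ->
  exists2 s0, 0 < s0 & forall k s x, `|s| <= s0 -> chi x != 0 ->
    gibbsV (x + s *: e_ k) <= (1 + delta) * gibbsV x.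
Proof.
move=> chir d0.
have H k := @continuous_bounded R d (partial k G) (r + 1)
  (@Ck_continuous _ _ 0 _ (Ck_partial k GC1)).
have H' k : exists M, 0 <= M /\ forall x, `|x| <= r + 1 -> `|partial k G x| <= M.
  by have [M M0 HM] := H k; exists M.
have [M HM] := choice H'.
pose L := \sum_k M k.
have ML k : M k <= L.
  rewrite /L (bigD1 k)//= lerDl; apply: sumr_ge0 => i _; by case: (HM i).
have L0 : 0 <= L by apply: sumr_ge0 => i _; case: (HM i).
have ln0 : 0 < ln (1 + delta) by rewrite ln_gt0// ltrDl.
exists (Num.min 1 (ln (1 + delta) / (L + 1))).
  by rewrite lt_min ltr01 divr_gt0// ltr_wpDl.
move=> k s x; rewrite le_min => /andP[s1 sL] chix.
have xr : `|x| <= r by rewrite leNgt; apply/negP => /chir/eqP; rewrite (negbTE chix).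
have [y ys E] := partial_MVT k x s GC1.
have -> : 1 + delta = expR (ln (1 + delta)) by rewrite lnK// posrE ltr_wpDl// ltW.
rewrite /gibbsV !mul1r -expRD ler_expR -lerBlDr E.
apply: le_trans (ler_norm _) _; rewrite normrM.
have : `|s| * (L + 1) <= ln (1 + delta) by rewrite -ler_pdivlMr// ltr_wpDl.
apply: le_trans; apply: ler_wpM2l => //.
have [_ /(_ (x + y *: e_ k)) B] := HM k.
apply: le_trans (B _) _; last by have := ML k; lra.
apply: le_trans (ler_normD _ _) _; apply: lerD => //.
by apply: le_trans (norm_scale_delta y k) _; exact: le_trans s1.
Qed.

(** Difference quotients of f are bounded by the weak derivative g in the
    weighted norm, up to a factor close to 1 that accounts for the variation
    of the weight. By duality only the pairings with test functions matter,
    and for these the mean value theorem applies to the smooth function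
    y |-> \int f(x) xi(x + y) dx. *)
Lemma dq_bound k f g chi B delta : test_function chi -> (forall x, `|chi x| <= B) ->
  0 < delta -> l2loc f -> is_weak_partial k f g -> l2w gibbs g ->
  exists2 s0, 0 < s0 & forall s, s != 0 -> `|s| <= s0 ->
   \int[leb]_x ((chi x * dq k s f x) ^+ 2 * gibbs x) <=
     (1 + delta) * B ^+ 2 * \int[leb]_x (g x ^+ 2 * gibbs x).
Proof.
move=> tchi chiB d0 fl2 wfg gw; have fl := l2loc_loc fl2.
have [r chir] := test_csupp tchi.
have [s0 s00 Hs] := gibbsV_shift chir d0.
exists s0 => // s sn0 ss0.
pose N := \int[leb]_x (g x ^+ 2 * gibbs x).
have N0 : 0 <= N by apply: Int_ge0 => x; rewrite mulr_ge0 ?sqr_ge0// ltW// gibbs_gt0.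
pose F x := chi x * dq k s f x.
have Fl : l2loc F.
  apply: (@l2loc_ext _ _ (fun x => dq k s f x * chi x)) => [x|]; first by rewrite mulrC.
  by apply: l2locM; [exact: dq_l2loc|exact: test_continuous].
have pairing eta : test_function eta -> exists2 y, `|y| <= `|s| &
    \int[leb]_x (F x * eta x) = \int[leb]_x (g x * (chi (x + y *: e_ k) * eta (x + y *: e_ k))).
  move=> te; pose xi x := chi x * eta x.
  have txi : test_function xi by apply: testM => //; exact: tchi.1.
  have cxi := test_continuous txi; have sxi := test_csupp txi.
  have mC : Ck 1 (correl f xi) by exact: Ck_correl.
  have [y ys E] := partial_MVT k 0 (- s) mC.
  exists y; first by rewrite (le_trans ys)// normrN.
  have dm z : partial k (correl f xi) z = - (\int[leb]_x (g x * xi (x + z))).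
    have -> : partial k (correl f xi) z = \int[leb]_x (f x * partial k xi (x + z)).
      exact: (congr1 (fun F => F z) (partialE (fun z => correl_is_derive k z fl (test_C1 txi) sxi))).
    have [_ _ H] := wfg; rewrite -(H _ (test_shift z txi)).
    apply: eq_Int => x; congr (_ * _); symmetry.
    have := @is_derive_translate _ _ xi x (e_ k) z _ (Ck_is_derive k _ (test_C1 txi)).
    by move=> h; exact: derive_val.
  rewrite dm add0r in E; rewrite -[RHS]opprK.
  have -> : \int[leb]_x (g x * (chi (x + y *: e_ k) * eta (x + y *: e_ k))) =
    s^-1 * (correl f xi (0 + (- s) *: e_ k) - correl f xi 0).
    rewrite add0r E mulrNN mulrA mulVf// mul1r.
    by apply: eq_Int => x; rewrite add0r.
  rewrite opprK /correl.
  have i1 : integ (fun x => f x * xi (x + (- s) *: e_ k)).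
    by apply: integM_csupp => //; [exact: cont_shift|exact: csupp_shift].
  have i1' : integ (fun x => f (x + s *: e_ k) * xi x).
    by apply: integM_csupp => //; exact: loc_shift.
  have i2 : integ (fun x => f x * xi x) by exact: integM_csupp.
  rewrite add0r -(Int_shift (s *: e_ k) i1).
  rewrite (@eq_Int _ _ (fun x => f x * xi (x + 0)) (fun x => f x * xi x)); last by move=> x; rewrite addr0.
  rewrite (@eq_Int _ _ (fun x => f (x + s *: e_ k) * xi _) (fun x => f (x + s *: e_ k) * xi x)); last first.
    by move=> x; rewrite scaleNr addrK.
  rewrite -IntB// -IntZ; last exact: integB.
  by apply: eq_Int => x; rewrite /F /dq /xi; ring.
(* Moving the translation from the test function to the weight costs the
   factor 1 + delta. *)
have bound eta : test_function eta ->
    (\int[leb]_x (F x * eta x)) ^+ 2 <=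
      (1 + delta) * B ^+ 2 * N * \int[leb]_x (eta x ^+ 2 * (gibbs x)^-1).
  move=> te; have [y ys ->] := pairing _ te.
  pose xi x := chi x * eta x.
  have txi : test_function xi by apply: testM => //; exact: tchi.1.
  have txiy : test_function (fun x => xi (x + y *: e_ k)) by exact: test_shift.
  have cq := gibbsV_continuous.
  have mV v f' : test_function f' -> integ (fun x => f' x ^+ 2 * gibbsV (x + v)).
    move=> tf'; apply: integ_continuous.
      by apply: contM; [exact/contX2/test_continuous|exact: cont_shift].
    have [ρ H] := test_csupp tf'; exists ρ => x /H ->; by rewrite expr0n mul0r.
  have xiw : l2w gibbs (fun x => xi (x + y *: e_ k) * gibbsV x).
    apply: l2loc_l2w; [exact: gibbs_continuous| |exact/csuppMl/test_csupp].
    by apply: l2loc_continuous; apply: contM => //; exact: test_continuous.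
  have [_ CS] := l2w_CauchySchwarz gibbs_gt0 gibbs_continuous gw xiw.
  have -> : \int[leb]_x (g x * (chi (x + y *: e_ k) * eta (x + y *: e_ k))) =
      \int[leb]_x (g x * (xi (x + y *: e_ k) * gibbsV x) * gibbs x).
    apply: eq_Int => x; have := gibbsM x; rewrite /xi => E.
    by rewrite -[in LHS](mulr1 (g x)) -E; ring.
  apply: le_trans CS _; rewrite -/N [_ * N]mulrC -mulrA; apply: ler_wpM2l => //.
  have -> : \int[leb]_x ((xi (x + y *: e_ k) * gibbsV x) ^+ 2 * gibbs x) =
      \int[leb]_x (xi x ^+ 2 * gibbsV (x + (- y) *: e_ k)).
    rewrite -[RHS](Int_shift (y *: e_ k)); last exact: mV.
    apply: eq_Int => x; rewrite scaleNr addrK; have := gibbsM x => E.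
    rewrite exprMn [gibbsV x ^+ 2]expr2 -mulrA -[X in _ * X]mulrA.
    by rewrite [gibbsV x * gibbs x]mulrC E mulr1.
  rewrite -IntZ; last first.
    apply: integ_ext (mV 0 _ te) => x; by rewrite addr0 gibbsVE.
  apply: le_Int; first exact: mV.
    by apply: integZ; apply: integ_ext (mV 0 _ te) => x; rewrite addr0 gibbsVE.
  move=> x; rewrite /xi; have [->|chix] := eqVneq (chi x) 0.
    rewrite mul0r expr0n mul0r; apply: mulr_ge0.
      by apply: mulr_ge0; [lra|exact: sqr_ge0].
    by apply: mulr_ge0; [exact: sqr_ge0|rewrite invr_ge0 ltW// gibbs_gt0].
  rewrite gibbsVE; have := Hs k (- y) x; rewrite normrN (le_trans ys ss0) => /(_ isT chix) Hq.
  apply: (@le_trans _ _ ((chi x * eta x) ^+ 2 * ((1 + delta) * gibbsV x))).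
    by apply: ler_wpM2l => //; exact: sqr_ge0.
  rewrite exprMn (_ : _ * _ * _ = (1 + delta) * (chi x ^+ 2 * (eta x ^+ 2 * gibbsV x))); last by ring.
  rewrite -[leRHS]mulrA; apply: ler_wpM2l; first lra.
  apply: ler_wpM2r; first by rewrite mulr_ge0 ?sqr_ge0// ltW// gibbsV_gt0.
  rewrite -real_normK ?num_real// ler_pXn2r ?nnegrE//.
  exact: le_trans (chiB x).
have C0 : 0 <= (1 + delta) * B ^+ 2 * N.
  by apply: mulr_ge0 => //; apply: mulr_ge0; [lra|exact: sqr_ge0].
have [||gh [ghw ghE ghC]] := @l2_duality R d gibbs gibbs_gt0 gibbs_continuous unit
  (fun eta => \int[leb]_x (F x * eta tt x)) _ C0.
- move=> c eta zeta te tz.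
  have ie : integ (fun x => F x * eta tt x).
    exact: integM_test (l2loc_loc Fl) (te tt).
  have iz : integ (fun x => F x * zeta tt x).
    exact: integM_test (l2loc_loc Fl) (tz tt).
  by rewrite -IntZ// -IntD//; [apply: eq_Int => x; ring|exact: integZ].
- by move=> eta te; rewrite big_unit1; exact: bound.
have Fgh : {ae leb, forall x, F x + -1 * gh tt x = 0}.
  have ghl : loc (gh tt).
    exact/l2loc_loc/(l2w_l2loc gibbs_gt0 gibbs_continuous).
  apply: fundamental_lemma; first by apply: locD; [exact: l2loc_loc|exact: locZ].
  move=> eta te; have := ghE (fun=> eta) (fun=> te); rewrite big_unit1 => E.
  have i1 : integ (fun x => F x * eta x) by apply: integM_test => //; exact: l2loc_loc.
  have i2 : integ (fun x => gh tt x * eta x) by exact: integM_test.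
  rewrite (eq_Int (g := fun x => F x * eta x - gh tt x * eta x)) => [|x]; last by ring.
  by rewrite IntB// E subrr.
move: ghC; rewrite big_unit1; apply: le_trans.
apply: le_of_eq; apply: ae_eq_Int.
- apply: measurable_funM; last exact: continuous_measurable_rV gibbs_continuous.
  by apply: measurable_funX; case: Fl.
- apply: measurable_funM; last exact: continuous_measurable_rV gibbs_continuous.
  by apply: measurable_funX; case: (ghw tt).
- by apply: filterS Fgh => x /eqP; rewrite mulN1r subr_eq0 => /eqP <-.
Qed.

End exponential_weight.

(** * The discrete Bochner identity *)

Section bochner.
Context {R : realType} {d : nat}.
Local Notation T := 'rV[R]_d.
Local Notation leb := (@lebesgue_rV R d).
Local Notation loc := (@locally_integrable_rV R d).
Local Notation e_ i := (delta_mx ord0 i : T).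

Lemma l2loc_integ (a F : T -> R) : l2loc a -> l2loc F -> csupp F ->
  integ (fun x => a x * F x).
Proof. by move=> al Fl sF; apply: loc_csupp (csuppM _ sF); exact: l2loc_mul. Qed.

Lemma dq_csupp k s (F : T -> R) : csupp F -> csupp (dq k s F).
Proof.
move=> sF; apply: csuppM; apply: csuppD; first exact: csupp_shift.
by have [r Fr] := sF; exists r => x /Fr ->; rewrite oppr0.
Qed.

(** Summation by parts. *)
Lemma dq_adjoint k s (a F : T -> R) : l2loc a -> l2loc F -> csupp F ->
  \int[leb]_x (a x * dq k (- s) F x) = - (\int[leb]_x (dq k s a x * F x)).
Proof.
move=> al Fl sF.
have i0 : integ (fun x => a x * F x) by exact: l2loc_integ.
have i1 : integ (fun x => a x * F (x + (- s) *: e_ k)).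
  by apply: l2loc_integ => //; [exact: l2loc_shift|exact: csupp_shift].
have i2 : integ (fun x => a (x + s *: e_ k) * F x).
  by apply: l2loc_integ => //; exact: l2loc_shift.
have E : \int[leb]_x (a x * F (x + (- s) *: e_ k)) = \int[leb]_x (a (x + s *: e_ k) * F x).
  rewrite -(Int_shift (s *: e_ k) i1); apply: eq_Int => x.
  by rewrite scaleNr addrK.
rewrite (eq_Int (g := fun x => (- s)^-1 * (a x * F (x + (- s) *: e_ k) - a x * F x))) => [|x].
  rewrite IntZ; last exact: integB.
  rewrite IntB// E -IntB// invrN mulNr -IntZ; last exact: integB.
  by congr (- _); apply: eq_Int => x; rewrite /dq; ring.
by rewrite /dq; ring.
Qed.

Variables (G : T -> R).
Hypothesis GC : Ck 2 G.
Local Notation p := (gibbs G).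

Variables (u f : T -> R) (v : 'I_d -> T -> R).
Hypotheses (uv : H1 p u v) (fw : l2w p f).
Hypothesis u_weak : forall u' v', H1 p u' v' ->
  \sum_i \int[leb]_x (v i x * v' i x * p x) = \int[leb]_x (f x * u' x * p x).

Let p0 := gibbs_gt0 G.
Let cp := gibbs_continuous GC.
Let GC1 : Ck 1 G. Proof. exact: CkS. Qed.
Let pC := gibbs_C1 GC.
Let qC := gibbsV_C1 GC.
Let ul : l2loc u. Proof. by case: uv => uw _; exact: (l2w_l2loc p0 cp uw). Qed.
Let vl i : l2loc (v i). Proof. by case: uv => _ /(_ i)[_ vw]; exact: (l2w_l2loc p0 cp vw). Qed.
Let fl : l2loc f. Proof. exact: (l2w_l2loc p0 cp fw). Qed.
Let uvw i : is_weak_partial i u (v i). Proof. by case: uv => _ /(_ i)[]. Qed.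
Let cG i : continuous (partial i G).
Proof. by apply: (@Ck_continuous _ _ 1); exact: Ck_partial. Qed.

(** The discrete Bochner identity. The weak equation, divided by the weight,
    reads - Delta u + grad G . grad u = f; it is tested with the summation by
    parts adjoint of the difference quotient of u, multiplied by chi^2 p. The
    terms in which the gradient of the weight meets the second differences
    of u cancel exactly, so that no second derivative of u is needed. *)
Lemma discrete_bochner k s chi : s != 0 -> Ck 1 chi -> csupp chi ->
  let w := dq k s u in
  let Q x := p x * (\sum_j (chi x ^+ 2 * dq k s (v j) x ^+ 2
      + 2 * chi x * partial j chi x * w x * dq k s (v j) x
      + (v j x + s * dq k s (v j) x) * dq k s (partial j G) x * chi x ^+ 2 * w x)
      - dq k s f x * chi x ^+ 2 * w x) in
  integ Q /\ \int[leb]_x Q x = 0.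
Proof.
move=> s0 chiC schi /=; set w := dq k s u.
pose c x := chi x * (chi x * p x).
have cC : Ck 1 c by apply: CkM => //; exact: CkM.
have sc : csupp c by exact: csuppMl.
have cc := Ck_continuous cC.
have cdc j : continuous (partial j c) by exact: Ck_partial_continuous.
have sdc j : csupp (partial j c) by exact: csupp_partial.
have wl : l2loc w by exact: dq_l2loc.
have wjl j : l2loc (dq k s (v j)) by exact: dq_l2loc.
pose F x := w x * c x.
pose Fj j x := dq k s (v j) x * c x + w x * partial j c x.
have FFj j : is_weak_partial j F (Fj j).
  by apply: weak_partialM => //; exact: dq_weak_partial.
have Fl : l2loc F by exact: l2locM.
have Fjl j : l2loc (Fj j) by apply: l2locD; exact: l2locM.
have sF : csupp F by exact: csuppM.
have sFj j : csupp (Fj j) by apply: csuppD; exact: csuppM.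
pose eta := dq k (- s) F; pose etaj j := dq k (- s) (Fj j).
have etal : l2loc eta by exact: dq_l2loc.
have etajl j : l2loc (etaj j) by exact: dq_l2loc.
have seta : csupp eta by exact: dq_csupp.
have setaj j : csupp (etaj j) by exact: dq_csupp.
have cq := gibbsV_continuous GC.
have cdq j : continuous (partial j (gibbsV G)).
  by exact: Ck_partial_continuous.
pose psi x := eta x * gibbsV G x.
pose psij j x := etaj j x * gibbsV G x + eta x * partial j (gibbsV G) x.
have Hpsi : H1 p psi psij.
  split; first by apply: l2loc_l2w => //; [exact: l2locM|exact: csuppMl].
  move=> j; split.
    by apply: weak_partialM => //; exact: dq_weak_partial.
  apply: l2loc_l2w => //; first by apply: l2locD; exact: l2locM.
  by apply: csuppD; exact: csuppMl.
have := u_weak Hpsi.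
have vG j : l2loc (fun x => v j x * partial j G x) by exact: l2locM.
have -> : \int[leb]_x (f x * psi x * p x) = - (\int[leb]_x (dq k s f x * F x)).
  rewrite -dq_adjoint//; apply: eq_Int => x; rewrite /psi.
  by rewrite -[RHS]mulr1 -(gibbsM G x) -/eta; ring.
have -> : \sum_i \int[leb]_x (v i x * psij i x * p x) =
    - (\sum_i \int[leb]_x (dq k s (v i) x * Fj i x + dq k s (fun x => v i x * partial i G x) x * F x)).
  rewrite -sumrN; apply: eq_bigr => j _.
  rewrite IntD; [|by apply: l2loc_integ|by apply: l2loc_integ => //; exact: dq_l2loc].
  rewrite opprD -!dq_adjoint// -IntD; [|exact: (l2loc_integ (vl j) (etajl j) (setaj j))|
    exact: (l2loc_integ (vG j) etal seta)].
  apply: eq_Int => x; rewrite /psij partial_expR//.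
  rewrite -/(gibbsV G x) [1 * partial j G x]mul1r -/eta -/(etaj j) -[RHS]mulr1 -(gibbsM G x); ring.
move=> /oppr_inj E.
have iA j : integ (fun x => dq k s (v j) x * Fj j x + dq k s (fun x => v j x * partial j G x) x * F x).
  apply: integD; first exact: l2loc_integ.
  by apply: l2loc_integ => //; exact: dq_l2loc.
have iB : integ (fun x => dq k s f x * F x).
  by apply: l2loc_integ => //; exact: dq_l2loc.
pose Q' x := \sum_j (dq k s (v j) x * Fj j x + dq k s (fun x => v j x * partial j G x) x * F x) -
  dq k s f x * F x.
have iQ : integ Q' by apply: integB => //; exact: integ_sum.
have IQ : \int[leb]_x Q' x = 0.
  by rewrite IntB//; [rewrite Int_sum// E subrr|exact: integ_sum].
have QE x : Q' x = p x * (\sum_j (chi x ^+ 2 * dq k s (v j) x ^+ 2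
      + 2 * chi x * partial j chi x * w x * dq k s (v j) x
      + (v j x + s * dq k s (v j) x) * dq k s (partial j G) x * chi x ^+ 2 * w x)
      - dq k s f x * chi x ^+ 2 * w x).
  rewrite mulrBr mulr_sumr /Q'; congr (_ - _); last by rewrite /F /c; ring.
  apply: eq_bigr => j _.
  have dc : partial j c x = chi x * (chi x * (p x * (-1 * partial j G x)) + p x * partial j chi x)
      + chi x * p x * partial j chi x.
    by rewrite /c partialM//; [rewrite partialM// partial_expR|exact: CkM].
  rewrite /Fj /F dc /c /dq /w.
  move: (partial j G x) (partial j G _) (v j x) (v j _) => *; field; exact: s0.
split; first exact: (integ_ext QE iQ).
by rewrite -[RHS]IQ; apply: eq_Int => x; rewrite QE.
Qed.

End bochner.

(** * Uniform energy estimate for difference quotients *)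

Lemma sum_CauchySchwarz (R : realType) (J : finType) (a b : J -> R) :
  (\sum_j a j * b j) ^+ 2 <= (\sum_j a j ^+ 2) * (\sum_j b j ^+ 2).
Proof.
apply: discriminant_le; first by apply: sumr_ge0 => j _; exact: sqr_ge0.
move=> t; rewrite !mulr_sumr -big_split /=; apply: ler_sum => j _.
rewrite -subr_ge0 (_ : _ - _ = (t * a j - b j) ^+ 2) ?sqr_ge0//; ring.
Qed.

Section energy.
Context {R : realType} {d : nat}.
Local Notation T := 'rV[R]_d.
Local Notation leb := (@lebesgue_rV R d).
Local Notation loc := (@locally_integrable_rV R d).
Local Notation e_ i := (delta_mx ord0 i : T).

Variables (G : T -> R).
Hypothesis GC : Ck 2 G.
Local Notation p := (gibbs G).

Variables (u f : T -> R) (v fd : 'I_d -> T -> R).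
Hypotheses (uv : H1 p u v) (fH1 : H1 p f fd).
Hypothesis u_weak : forall u' v', H1 p u' v' ->
  \sum_i \int[leb]_x (v i x * v' i x * p x) = \int[leb]_x (f x * u' x * p x).

Variables (c2 M : R).
Hypotheses (c20 : 0 <= c2) (M0 : 0 <= M).
Hypothesis G_c2 : forall x j k, `|partial k (partial j G) x| <= c2.
Hypothesis G_M : {ae leb, forall x,
  \sum_k \sum_j partial k (partial j G) x ^+ 2 <= M ^+ 2}.

Let p0 := gibbs_gt0 G.
Let p_ge0 x : 0 <= p x. Proof. by rewrite ltW// p0. Qed.
Let cp := gibbs_continuous GC.
Let ul : l2loc u. Proof. by case: uv => uw _; exact: (l2w_l2loc p0 cp uw). Qed.
Let vw i : l2w p (v i). Proof. by case: uv => _ /(_ i)[]. Qed.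
Let vl i : l2loc (v i). Proof. exact: (l2w_l2loc p0 cp (vw i)). Qed.
Let fl : l2loc f. Proof. by case: fH1 => fw _; exact: (l2w_l2loc p0 cp fw). Qed.
Let GjC j : Ck 1 (partial j G). Proof. exact: Ck_partial. Qed.

Lemma dq_c2 k s j x : s != 0 -> `|dq k s (partial j G) x| <= c2.
Proof.
move=> s0; rewrite /dq; have [y _ ->] := partial_MVT k x s (GjC j).
by rewrite mulrA mulVf// mul1r.
Qed.

Let sq_integ chi g : continuous chi -> csupp chi -> l2loc g ->
  integ (fun x => (chi x * g x) ^+ 2 * p x).
Proof.
move=> cc sc gl; apply: loc_csupp.
  apply: locM => //; have := l2locM gl cc => -[_].
  by congr (locally_integrable_rV _); apply/funext => x; rewrite mulrC.
by have [r H] := sc; exists r => x /H ->; rewrite mul0r expr0n mul0r.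
Qed.

Section fixed_cutoff.
Variable chi : T -> R.
Hypothesis tchi : test_function chi.

Let cchi := test_continuous tchi.
Let schi := test_csupp tchi.
Let tdchi j := test_partial j tchi.

Definition second_energy s := \sum_k \sum_j \int[leb]_x ((chi x * dq k s (v j) x) ^+ 2 * p x).
Definition first_energy s := \sum_k \int[leb]_x ((chi x * dq k s u x) ^+ 2 * p x).
Definition source_energy s := \sum_k \int[leb]_x ((chi x * dq k s f x) ^+ 2 * p x).
Definition cutoff_energy s :=
  \sum_k \sum_j \int[leb]_x ((partial j chi x * dq k s u x) ^+ 2 * p x).
Definition curvature s := \int[leb]_x
  (\sum_k (\sum_j v j x * dq k s (partial j G) x) ^+ 2 * (chi x ^+ 2 * p x)).

Let curvature_integrand_le s x : s != 0 ->
  \sum_k (\sum_j v j x * dq k s (partial j G) x) ^+ 2 * (chi x ^+ 2 * p x) <=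
  d%:R * (d%:R * c2 ^+ 2) * (\sum_j v j x ^+ 2) * (chi x ^+ 2 * p x).
Proof.
move=> s0; rewrite -mulr_suml; apply: ler_wpM2r.
  by apply: mulr_ge0 => //; exact: sqr_ge0.
apply: (@le_trans _ _ (\sum_(k < d) (\sum_j v j x ^+ 2) * (d%:R * c2 ^+ 2))).
  apply: ler_sum => k _; apply: le_trans (sum_CauchySchwarz _ _) _.
  apply: ler_wpM2l; first by apply: sumr_ge0 => j _; exact: sqr_ge0.
  apply: (@le_trans _ _ (\sum_(j < d) c2 ^+ 2)); last by rewrite sumr_const card_ord -[leLHS]mulr_natl.
  apply: ler_sum => j _; rewrite -real_normK ?num_real// ler_pXn2r ?nnegrE//.
  exact: dq_c2.
by rewrite sumr_const card_ord -[leLHS]mulr_natl; apply: le_of_eq; ring.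
Qed.

Let curvature_integ s : s != 0 -> integ (fun x =>
  \sum_k (\sum_j v j x * dq k s (partial j G) x) ^+ 2 * (chi x ^+ 2 * p x)).
Proof.
move=> s0; apply: integ_sum => k.
have cG j : continuous (dq k s (partial j G)) by apply: dq_cont; exact: Ck_continuous (GjC j).
have l : l2loc (fun x => \sum_j v j x * dq k s (partial j G) x).
  by apply: l2loc_sum => j; exact: l2locM.
apply: integ_ext (sq_integ cchi schi l) => x; ring.
Qed.

(** Young's inequality absorbs the products of first and second differences
    of u into the second ones. The weight t is spent on the derivatives of
    the cutoff; the terms with the factor s come from the discrete product
    rule for v_j partial_j G, and only need the crude bound c2. The two square
    roots are the terms that survive in the limit. *)
Lemma energy_step s t : s != 0 -> 0 < t ->
  (1 - t - `|s| * c2) * second_energy s <= t^-1 * cutoff_energy s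
    + `|s| * c2 * d%:R * first_energy s + Num.sqrt (curvature s * first_energy s)
    + Num.sqrt (source_energy s * first_energy s).
Proof.
move=> s0 t0.
have chiC := test_C1 tchi.
pose w k := dq k s u.
have wl k : l2loc (w k) by exact: dq_l2loc.
have wjl k j : l2loc (dq k s (v j)) by exact: dq_l2loc.
pose A x k j := dq k s (partial j G) x.
pose e x := \sum_k \sum_j (chi x * dq k s (v j) x) ^+ 2 * p x.
pose z x := \sum_k \sum_j (partial j chi x * w k x) ^+ 2 * p x.
pose m x := \sum_k (chi x * w k x) ^+ 2 * p x.
pose a x := \sum_k (\sum_j v j x * dq k s (partial j G) x) * (chi x * w k x) * (chi x * p x).
pose b x := \sum_k (chi x * dq k s f x) * (chi x * w k x) * p x.
pose Q k x := p x * (\sum_j (chi x ^+ 2 * dq k s (v j) x ^+ 2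
      + 2 * chi x * partial j chi x * w k x * dq k s (v j) x
      + (v j x + s * dq k s (v j) x) * dq k s (partial j G) x * chi x ^+ 2 * w k x)
      - dq k s f x * chi x ^+ 2 * w k x).
have QI k : integ (Q k) /\ \int[leb]_x Q k x = 0.
  by apply: (discrete_bochner GC uv _ u_weak) => //; case: fH1.
have Qi k : integ (Q k) by case: (QI k).
have ei : integ e.
  by apply: integ_sum => k; apply: integ_sum => j; exact: sq_integ.
have zi : integ z.
  apply: integ_sum => k; apply: integ_sum => j; apply: sq_integ => //.
    exact: test_continuous.
  exact: test_csupp.
have mi : integ m by apply: integ_sum => k; exact: sq_integ.
have eE : \int[leb]_x e x = second_energy s.
  rewrite Int_sum => [|k]; last by apply: integ_sum => j; exact: sq_integ.
  by apply: eq_bigr => k _; rewrite Int_sum// => j; exact: sq_integ.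
have zE : \int[leb]_x z x = cutoff_energy s.
  have zji k j : integ (fun x => (partial j chi x * w k x) ^+ 2 * p x).
    by apply: sq_integ => //; [exact: test_continuous|exact: test_csupp].
  rewrite Int_sum => [|k]; last by apply: integ_sum => j; exact: zji.
  by apply: eq_bigr => k _; rewrite Int_sum// => j; exact: zji.
have mE : \int[leb]_x m x = first_energy s.
  by rewrite Int_sum// => k; exact: sq_integ.
have m0 x : 0 <= m x by apply: sumr_ge0 => k _; rewrite mulr_ge0 ?sqr_ge0.
have meas_p := continuous_measurable_rV cp.
have meas_chi := continuous_measurable_rV cchi.
have meas_chip : measurable_fun [set: T] (fun x => chi x * p x) by exact: measurable_funM.
have meas_w k : measurable_fun [set: T] (fun x => chi x * w k x).
  by apply: measurable_funM => //; case: (wl k).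
have meas_G k j : measurable_fun [set: T] (dq k s (partial j G)).
  by apply: continuous_measurable_rV; apply: dq_cont; exact: Ck_continuous (GjC j).
have [ai aCS] : integ a /\ (\int[leb]_x a x) ^+ 2 <= curvature s * first_energy s.
  rewrite -mE; apply: Int_CauchySchwarz => //.
  - apply: measurable_sum => k; apply: measurable_funM => //; apply: measurable_funM => //.
    by apply: measurable_sum => j; apply: measurable_funM => //; case: (vl j).
  - exact: curvature_integ.
  - move=> x; apply: sumr_ge0 => k _; apply: mulr_ge0; first exact: sqr_ge0.
    by apply: mulr_ge0 => //; exact: sqr_ge0.
  - move=> x; rewrite /a /m -!mulr_suml exprMn.
    apply: (@le_trans _ _ (((\sum_k (\sum_j v j x * dq k s (partial j G) x) ^+ 2) *
        (\sum_k (chi x * w k x) ^+ 2)) * (chi x * p x) ^+ 2)).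
      by apply: ler_wpM2r; [exact: sqr_ge0|exact: sum_CauchySchwarz].
    by apply: le_of_eq; ring.
have [bi bCS] : integ b /\ (\int[leb]_x b x) ^+ 2 <= source_energy s * first_energy s.
  have fi k : integ (fun x => (chi x * dq k s f x) ^+ 2 * p x).
    by apply: sq_integ => //; exact: dq_l2loc.
  rewrite -mE /source_energy -Int_sum//; apply: Int_CauchySchwarz => //.
  - apply: measurable_sum => k; apply: measurable_funM => //; apply: measurable_funM => //.
    by apply: measurable_funM => //; case: (dq_l2loc k s fl).
  - exact: integ_sum.
  - by move=> x; apply: sumr_ge0 => k _; rewrite mulr_ge0 ?sqr_ge0.
  - move=> x; rewrite /b /m -!mulr_suml exprMn.
    apply: (@le_trans _ _ (((\sum_k (chi x * dq k s f x) ^+ 2) *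
        (\sum_k (chi x * w k x) ^+ 2)) * p x ^+ 2)).
      by apply: ler_wpM2r; [exact: sqr_ge0|exact: sum_CauchySchwarz].
    by apply: le_of_eq; ring.
have pointwise x : (1 - t - `|s| * c2) * e x <=
    t^-1 * z x + `|s| * c2 * d%:R * m x - a x + b x + \sum_k Q k x.
  rewrite /e /z /m /a /b !mulr_sumr -sumrN -!big_split /=; apply: ler_sum => k _.
  have -> : (\sum_j v j x * dq k s (partial j G) x) * (chi x * w k x) * (chi x * p x) =
      \sum_j (v j x * dq k s (partial j G) x) * (chi x * w k x) * (chi x * p x).
    by rewrite -!mulr_suml.
  have -> : `|s| * c2 * d%:R * ((chi x * w k x) ^+ 2 * p x) =
      \sum_(j < d) `|s| * c2 * ((chi x * w k x) ^+ 2 * p x).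
    by rewrite sumr_const card_ord -mulr_natr; ring.
  rewrite /Q; set beta := chi x * dq k s f x * (chi x * w k x) * p x.
  have -> : dq k s f x * chi x ^+ 2 * w k x = dq k s f x * chi x * (chi x * w k x) by ring.
  apply: (@le_trans _ _ (\sum_j (t^-1 * ((partial j chi x * w k x) ^+ 2 * p x)
      + `|s| * c2 * ((chi x * w k x) ^+ 2 * p x)
      - v j x * dq k s (partial j G) x * (chi x * w k x) * (chi x * p x)
      + p x * (chi x ^+ 2 * dq k s (v j) x ^+ 2
      + 2 * chi x * partial j chi x * w k x * dq k s (v j) x
      + (v j x + s * dq k s (v j) x) * dq k s (partial j G) x * chi x ^+ 2 * w k x)))).
    rewrite mulr_sumr; apply: ler_sum => j _.
    have := dq_c2 k j x s0; have := p_ge0 x.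
    move: (p x) (chi x) (partial j chi x) (w k x) (dq k s (v j) x) (v j x)
      (dq k s (partial j G) x) => P X Xj W Wj Vj A' P0 Ac.
    rewrite -subr_ge0.
    (* The difference of both sides is a combination of squares with
       nonnegative coefficients, as |s A'| <= |s| c2. *)
    have -> : t^-1 * ((Xj * W) ^+ 2 * P) + `|s| * c2 * ((X * W) ^+ 2 * P)
        - Vj * A' * (X * W) * (X * P)
        + P * (X ^+ 2 * Wj ^+ 2 + 2 * X * Xj * W * Wj + (Vj + s * Wj) * A' * X ^+ 2 * W)
        - (1 - t - `|s| * c2) * ((X * Wj) ^+ 2 * P) =
      P * (t^-1 * (t * (X * Wj) + Xj * W) ^+ 2 + X ^+ 2 *
        ((`|s| * c2 + s * A') * (Wj + W) ^+ 2 / 4 + (`|s| * c2 - s * A') * (Wj - W) ^+ 2 / 4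
          + `|s| * c2 * (Wj ^+ 2 + W ^+ 2) / 2)).
      by field; exact: lt0r_neq0.
    have : `|s * A'| <= `|s| * c2 by rewrite normrM; apply: ler_wpM2l.
    rewrite ler_norml => /andP[sA1 sA2].
    apply: mulr_ge0 => //; apply: addr_ge0.
      by apply: mulr_ge0; [rewrite invr_ge0 ltW|exact: sqr_ge0].
    apply: mulr_ge0; first exact: sqr_ge0.
    apply: addr_ge0; first apply: addr_ge0.
    - by apply: divr_ge0 => //; apply: mulr_ge0; [lra|exact: sqr_ge0].
    - by apply: divr_ge0 => //; apply: mulr_ge0; [lra|exact: sqr_ge0].
    - apply: divr_ge0 => //; apply: mulr_ge0; first exact: mulr_ge0.
      by apply: addr_ge0; exact: sqr_ge0.
  rewrite !big_split /= sumrN -!mulr_sumr; apply: le_of_eq.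
  rewrite /beta !big_split /= -!mulr_sumr; ring.
have QsI : \int[leb]_x (\sum_k Q k x) = 0.
  by rewrite Int_sum// big1// => k _; case: (QI k).
have Qsi : integ (fun x => \sum_k Q k x) by exact: integ_sum.
have I1 : integ (fun x => t^-1 * z x + `|s| * c2 * d%:R * m x).
  by apply: integD; exact: integZ.
have I2 : integ (fun x => t^-1 * z x + `|s| * c2 * d%:R * m x - a x) by exact: integB.
have I3 : integ (fun x => t^-1 * z x + `|s| * c2 * d%:R * m x - a x + b x) by exact: integD.
have := le_Int (integZ (1 - t - `|s| * c2) ei) (integD I3 Qsi) pointwise.
rewrite IntZ// eE IntD// QsI addr0 IntD// IntB// IntD; [|exact: integZ|exact: integZ].
rewrite IntZ// IntZ// zE mE => H; apply: le_trans H _.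
have sqrt_le (X Y : R) : X ^+ 2 <= Y -> `|X| <= Num.sqrt Y.
  by move=> XY; rewrite -sqrtr_sqr ler_wsqrtr.
have := sqrt_le _ _ aCS; have := sqrt_le _ _ bCS.
rewrite !ler_norml => /andP[_ hb] /andP[ha _]; lra.
Qed.

Local Notation N := (energy p v).
Local Notation H := (energy p fd).

Let s_ n : R := n.+1%:R^-1.
Let s_neq0 n : s_ n != 0. Proof. by rewrite invr_neq0// pnatr_eq0. Qed.
Let s_cvg : s_ n @[n --> \oo] --> (0 : R). Proof. exact: cvg_harmonic. Qed.
Let s_le s0 : 0 < s0 -> \forall n \near \oo, `|s_ n| <= s0.
Proof.
move=> s00; have /cvgrPdist_le/(_ _ s00) := s_cvg.
by apply: filterS => n; rewrite sub0r normrN.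
Qed.

Hypothesis chi_le1 : forall x, `|chi x| <= 1.

Let chi2_le1 x : chi x ^+ 2 <= 1.
Proof. by rewrite -real_normK ?num_real// exprn_ile1. Qed.

(* Here the essential bound M enters: in the limit the difference quotients
   of the gradient of G become its Hessian, and Cauchy-Schwarz in j bounds the
   integrand by |D^2 G|^2 |v|^2; c2 provides the domination. *)
Let curvature_cvg : exists2 P, P <= M ^+ 2 * N & curvature (s_ n) @[n --> \oo] --> P.
Proof.
pose P x := \sum_k (\sum_j v j x * partial k (partial j G) x) ^+ 2 * (chi x ^+ 2 * p x).
pose g x := d%:R * (d%:R * c2 ^+ 2) * (\sum_j v j x ^+ 2) * (chi x ^+ 2 * p x).
have gi : integ g.
  have gi' : integ (fun x => \sum_j (chi x * v j x) ^+ 2 * p x).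
    by apply: integ_sum => j; exact: sq_integ.
  apply: integ_ext (integZ (d%:R * (d%:R * c2 ^+ 2)) gi') => x.
  rewrite /g -[RHS]mulrA; congr (_ * _); rewrite mulr_suml; apply: eq_bigr => j _; ring.
have cvgP x : \sum_k (\sum_j v j x * dq k (s_ n) (partial j G) x) ^+ 2 * (chi x ^+ 2 * p x)
    @[n --> \oo] --> P x.
  apply: cvg_sumr => k; apply: cvgM; last exact: cvg_cst.
  have L : \sum_j v j x * dq k (s_ n) (partial j G) x @[n --> \oo] -->
      \sum_j v j x * partial k (partial j G) x.
    apply: cvg_sumr => j; apply: cvgM; first exact: cvg_cst.
    have /is_derive_quotient := Ck_is_derive k x (GjC j).
    by move=> /cvgr_dnbhsP/(_ s_ (conj s_neq0 s_cvg)).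
  exact: (cvgM L L).
have bound n x : `|\sum_k (\sum_j v j x * dq k (s_ n) (partial j G) x) ^+ 2 * (chi x ^+ 2 * p x)|
    <= g x.
  rewrite ger0_norm; first exact: curvature_integrand_le.
  apply: sumr_ge0 => k _; apply: mulr_ge0; first exact: sqr_ge0.
  by apply: mulr_ge0 => //; exact: sqr_ge0.
have [Pi L] := Int_dct (fun n => integ_meas (curvature_integ (s_neq0 n))) cvgP gi bound.
exists (\int[leb]_x P x) => //.
have vi k : integ (fun x => v k x ^+ 2 * p x) by case: (vw k).
rewrite /energy -Int_sum// -IntZ; last exact: integ_sum.
apply: ae_le_Int => //; first by apply: integZ; exact: integ_sum.
apply: filterS G_M => x HM; rewrite /P -!mulr_suml.
have v0 : 0 <= \sum_j v j x ^+ 2 by apply: sumr_ge0 => j _; exact: sqr_ge0.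
apply: (@le_trans _ _ (((\sum_j v j x ^+ 2) * M ^+ 2) * (1 * p x))).
  apply: ler_pM.
  - by apply: sumr_ge0 => k _; exact: sqr_ge0.
  - by apply: mulr_ge0 => //; exact: sqr_ge0.
  - apply: (@le_trans _ _ (\sum_k (\sum_j v j x ^+ 2) * (\sum_j partial k (partial j G) x ^+ 2))).
      by apply: ler_sum => k _; exact: sum_CauchySchwarz.
    by rewrite -mulr_sumr; apply: ler_wpM2l.
  - by apply: ler_wpM2r.
by apply: le_of_eq; ring.
Qed.

Let N0 : 0 <= N. Proof. exact: energy_ge0. Qed.
Let H0 : 0 <= H. Proof. exact: energy_ge0. Qed.

(** The terms of the previous bound are controlled up to the factor 1 + t once
    s is small, t being also the size of the derivatives of the cutoff. *)
Lemma energy_limit t B : 0 < t -> t < 1 -> 0 <= B ->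
  (forall j x, `|partial j chi x| <= t * B) ->
  \forall n \near \oo, (1 - 2 * t) * second_energy (s_ n) <=
    t * ((1 + t) * B ^+ 2 * d%:R * N) + t
    + Num.sqrt ((M ^+ 2 * N + t) * ((1 + t) * N))
    + Num.sqrt ((1 + t) * H * ((1 + t) * N)).
Proof.
move=> t0 t1 B0 dchi.
have c2_ge0 : 0 <= c2 by exact: c20.
have uvw k : is_weak_partial k u (v k) by case: uv => _ /(_ k)[].
have ffd k : is_weak_partial k f (fd k) by case: fH1 => _ /(_ k)[].
have fdw k : l2w p (fd k) by case: fH1 => _ /(_ k)[].
have near_first : \forall n \near \oo, first_energy (s_ n) <= (1 + t) * N.
  have : \forall n \near \oo, forall k,
      \int[leb]_x ((chi x * dq k (s_ n) u x) ^+ 2 * p x) <=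
      (1 + t) * 1 ^+ 2 * \int[leb]_x (v k x ^+ 2 * p x).
    apply: filter_forall => k.
    have [s0 s00 Hs] := dq_bound GC tchi chi_le1 t0 ul (uvw k) (vw k).
    by apply: filterS (s_le s00) => n; exact: Hs.
  apply: filterS => n Hn; rewrite /first_energy /energy mulr_sumr.
  by apply: ler_sum => k _; have := Hn k; rewrite expr1n mulr1.
have near_source : \forall n \near \oo, source_energy (s_ n) <= (1 + t) * H.
  have : \forall n \near \oo, forall k,
      \int[leb]_x ((chi x * dq k (s_ n) f x) ^+ 2 * p x) <=
      (1 + t) * 1 ^+ 2 * \int[leb]_x (fd k x ^+ 2 * p x).
    apply: filter_forall => k.
    have [s0 s00 Hs] := dq_bound GC tchi chi_le1 t0 fl (ffd k) (fdw k).
    by apply: filterS (s_le s00) => n; exact: Hs.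
  apply: filterS => n Hn; rewrite /source_energy /energy mulr_sumr.
  by apply: ler_sum => k _; have := Hn k; rewrite expr1n mulr1.
have near_cutoff : \forall n \near \oo,
    cutoff_energy (s_ n) <= (1 + t) * (t * B) ^+ 2 * d%:R * N.
  have : \forall n \near \oo, forall kj : 'I_d * 'I_d,
      \int[leb]_x ((partial kj.2 chi x * dq kj.1 (s_ n) u x) ^+ 2 * p x) <=
      (1 + t) * (t * B) ^+ 2 * \int[leb]_x (v kj.1 x ^+ 2 * p x).
    apply: filter_forall => -[k j] /=.
    have [s0 s00 Hs] := dq_bound GC (tdchi j) (dchi j) t0 ul (uvw k) (vw k).
    by apply: filterS (s_le s00) => n; exact: Hs.
  apply: filterS => n Hn; rewrite /cutoff_energy /energy mulr_sumr.
  apply: ler_sum => k _.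
  apply: (@le_trans _ _ (\sum_(j < d) (1 + t) * (t * B) ^+ 2 * \int[leb]_x (v k x ^+ 2 * p x))).
    by apply: ler_sum => j _; exact: (Hn (k, j)).
  by rewrite sumr_const card_ord -[leLHS]mulr_natl; apply: le_of_eq; ring.
have near_curv : \forall n \near \oo, curvature (s_ n) <= M ^+ 2 * N + t.
  have [P PM /cvgrPdist_le/(_ _ t0)] := curvature_cvg.
  apply: filterS => n; rewrite ler_distlC => /andP[_]; lra.
(* For |s| <= kappa, both |s| c2 and the first order term with the factor
   |s| c2 are at most t. *)
pose kappa := t / (c2 + 1 + c2 * d%:R * ((1 + t) * N)).
have N1 : 0 <= (1 + t) * N by apply: mulr_ge0 => //; lra.
have c2N : 0 <= c2 * d%:R * ((1 + t) * N) by apply: mulr_ge0 => //; exact: mulr_ge0.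
have den0 : 0 < c2 + 1 + c2 * d%:R * ((1 + t) * N) by apply: ltr_wpDr => //; exact: ltr_wpDl.
have kappa0 : 0 < kappa by exact: divr_gt0.
have near_s := s_le kappa0; near=> n.
have sn : `|s_ n| <= kappa by near: n.
have h1 : first_energy (s_ n) <= (1 + t) * N by near: n.
have h2 : source_energy (s_ n) <= (1 + t) * H by near: n.
have h3 : cutoff_energy (s_ n) <= (1 + t) * (t * B) ^+ 2 * d%:R * N by near: n.
have h4 : curvature (s_ n) <= M ^+ 2 * N + t by near: n.
have sk : `|s_ n| * (c2 + 1 + c2 * d%:R * ((1 + t) * N)) <= t by rewrite -ler_pdivlMr.
have E0 : 0 <= second_energy (s_ n).
  apply: sumr_ge0 => k _; apply: sumr_ge0 => j _; apply: Int_ge0 => x.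
  by rewrite mulr_ge0 ?sqr_ge0.
have F0 : 0 <= first_energy (s_ n).
  by apply: sumr_ge0 => k _; apply: Int_ge0 => x; rewrite mulr_ge0 ?sqr_ge0.
have sn0 : 0 <= `|s_ n| by [].
have sc : `|s_ n| * c2 <= t.
  apply: le_trans sk; apply: ler_wpM2l => //; lra.
have sd : `|s_ n| * c2 * d%:R * first_energy (s_ n) <= t.
  apply: (@le_trans _ _ (`|s_ n| * (c2 * d%:R * ((1 + t) * N)))).
    rewrite -!mulrA; apply: ler_wpM2l => //; apply: ler_wpM2l => //.
    by apply: ler_wpM2l.
  apply: le_trans sk; apply: ler_wpM2l => //; lra.
have := energy_step (s_neq0 n) t0.
have le1 : (1 - 2 * t) * second_energy (s_ n) <=
    (1 - t - `|s_ n| * c2) * second_energy (s_ n).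
  by apply: ler_wpM2r => //; lra.
have le2 : t^-1 * cutoff_energy (s_ n) <= t * ((1 + t) * B ^+ 2 * d%:R * N).
  rewrite ler_pdivrMl//; apply: le_trans h3 _.
  by apply: le_of_eq; ring.
have le3 : Num.sqrt (curvature (s_ n) * first_energy (s_ n)) <=
    Num.sqrt ((M ^+ 2 * N + t) * ((1 + t) * N)).
  apply: ler_wsqrtr; apply: ler_pM => //.
  apply: Int_ge0 => x; apply: sumr_ge0 => k _; apply: mulr_ge0; first exact: sqr_ge0.
  by apply: mulr_ge0 => //; exact: sqr_ge0.
have le4 : Num.sqrt (source_energy (s_ n) * first_energy (s_ n)) <=
    Num.sqrt ((1 + t) * H * ((1 + t) * N)).
  apply: ler_wsqrtr; apply: ler_pM => //.
  by apply: sumr_ge0 => k _; apply: Int_ge0 => x; rewrite mulr_ge0 ?sqr_ge0.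
lra.
Unshelve. all: by end_near. Qed.

End fixed_cutoff.

End energy.

(** * Second order regularity *)

Section second_order.
Context {R : realType} {d : nat}.
Local Notation T := 'rV[R]_d.
Local Notation leb := (@lebesgue_rV R d).
Local Notation loc := (@locally_integrable_rV R d).
Local Notation e_ i := (delta_mx ord0 i : T).

Variables (G : T -> R).
Hypothesis GC : Ck 2 G.
Local Notation p := (gibbs G).

Variables (u f : T -> R) (v fd : 'I_d -> T -> R).
Hypotheses (uv : H1 p u v) (fH1 : H1 p f fd).
Hypothesis u_weak : forall u' v', H1 p u' v' ->
  \sum_i \int[leb]_x (v i x * v' i x * p x) = \int[leb]_x (f x * u' x * p x).

Variables (c2 M : R).
Hypotheses (c20 : 0 <= c2) (M0 : 0 <= M).
Hypothesis G_c2 : forall x j k, `|partial k (partial j G) x| <= c2.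
Hypothesis G_M : {ae leb, forall x,
  \sum_k \sum_j partial k (partial j G) x ^+ 2 <= M ^+ 2}.

Let p0 := gibbs_gt0 G.
Let p_ge0 x : 0 <= p x. Proof. by rewrite ltW// p0. Qed.
Let cp := gibbs_continuous GC.
Let vw i : l2w p (v i). Proof. by case: uv => _ /(_ i)[]. Qed.
Let vl i : l2loc (v i). Proof. exact: (l2w_l2loc p0 cp (vw i)). Qed.

Local Notation N := (energy p v).
Local Notation H := (energy p fd).

Let N0 : 0 <= N. Proof. exact: energy_ge0. Qed.
Let H0 : 0 <= H. Proof. exact: energy_ge0. Qed.

Local Notation I2 := ('I_d * 'I_d)%type.

(* The functional that the weak second derivatives of u must represent, and
   the norm for the dual weight. *)
Let l (eta : I2 -> T -> R) :=
  \sum_kj - (\int[leb]_x (v kj.2 x * partial kj.1 (eta kj) x)).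

Let q_norm (eta : I2 -> T -> R) := \sum_kj \int[leb]_x (eta kj x ^+ 2 * (p x)^-1).

Let tests (eta : I2 -> T -> R) := forall kj, test_function (eta kj).

Let s_ n : R := n.+1%:R^-1.
Let s_neq0 n : s_ n != 0. Proof. by rewrite invr_neq0// pnatr_eq0. Qed.
Let s_cvg : s_ n @[n --> \oo] --> (0 : R). Proof. exact: cvg_harmonic. Qed.

Let eta_integ eta : test_function eta -> integ (fun x : T => eta x ^+ 2 * (p x)^-1).
Proof.
move=> te; apply: (@integ_ext _ _ (fun x => eta x ^+ 2 * gibbsV G x)) => [x|].
  by rewrite gibbsVE.
apply: integ_continuous.
  by apply: contM; [exact/contX2/test_continuous|exact: gibbsV_continuous].
have [r er] := test_csupp te; exists r => x /er ->; by rewrite expr0n mul0r.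
Qed.

Let q_norm_ge0 eta : 0 <= q_norm eta.
Proof.
apply: sumr_ge0 => kj _; apply: Int_ge0 => x; apply: mulr_ge0; first exact: sqr_ge0.
by rewrite invr_ge0.
Qed.

Let dq_pairing_cvg k (a xi : T -> R) : loc a -> l2loc a -> test_function xi ->
  \int[leb]_x (dq k (s_ n) a x * xi x) @[n --> \oo] --> - (\int[leb]_x (a x * partial k xi x)).
Proof.
move=> al al2 txi.
have cxi := test_continuous txi; have sxi := test_csupp txi.
have -> : (fun n => \int[leb]_x (dq k (s_ n) a x * xi x)) =
    (fun n => - (\int[leb]_x (a x * dq k (- s_ n) xi x))).
  apply/funext => n; rewrite dq_adjoint ?opprK//; exact: l2loc_continuous.
apply: cvgN.
have [r xir] := sxi.
have [B B0 HB] := csupp_bounded (test_continuous (test_partial k txi)) (test_csupp (test_partial k txi)).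
have sn0 n : - s_ n != 0 by rewrite oppr_eq0.
have snc : - s_ n @[n --> \oo] --> (0 : R) by rewrite -[X in _ --> X]oppr0; exact: cvgN.
apply: (@loc_dct _ _ a (fun n => dq k (- s_ n) xi) (partial k xi) (r + 1) B) => //.
- by move=> n; exact: dq_cont.
- move=> x; have /is_derive_quotient := Ck_is_derive k x (test_C1 txi).
  by move=> /cvgr_dnbhsP/(_ _ (conj sn0 snc)).
- move=> n x; rewrite /dq; have [y _ ->] := partial_MVT k x (- s_ n) (test_C1 txi).
  by rewrite mulrA mulVf// mul1r.
- move=> n x rx.
  have nt := norm_scale_delta (- s_ n) k.
  have s1 : `|- s_ n| <= 1.
    by rewrite normrN gtr0_norm ?invr_gt0// invf_le1// ler1n.
  rewrite /dq !xir ?subrr ?mulr0//; first lra.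
  have := ler_normB (x + - s_ n *: e_ k) (- s_ n *: e_ k); rewrite addrK; lra.
Qed.

(* The right-hand side of the energy estimate, which at t = 0 becomes
   M N + sqrt (H N). *)
Let Y (t B : R) := t * ((1 + t) * B ^+ 2 * d%:R * N) + t
    + Num.sqrt ((M ^+ 2 * N + t) * ((1 + t) * N))
    + Num.sqrt ((1 + t) * H * ((1 + t) * N)).

(* The pairing of the difference quotients of v with chi eta converges to l,
   and Cauchy-Schwarz bounds it by the energy of the former. *)
Let cut_bound chi t B eta : test_function chi -> (forall x, `|chi x| <= 1) ->
  0 < t -> t <= 2^-1 -> 0 <= B -> (forall j x, `|partial j chi x| <= t * B) ->
  tests eta ->
  (1 - 2 * t) * l (fun kj x => chi x * eta kj x) ^+ 2 <= Y t B * q_norm eta.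
Proof.
move=> tchi chi1 t0 t12 B0 dchi te.
have tce kj : test_function (fun x => chi x * eta kj x) by apply: testM => //; exact: tchi.1.
pose a n := \sum_kj \int[leb]_x (dq kj.1 (s_ n) (v kj.2) x * (chi x * eta kj x)).
have al : a n @[n --> \oo] --> l (fun kj x => chi x * eta kj x).
  by apply: cvg_sumr => kj; apply: dq_pairing_cvg => //; exact: l2loc_loc.
have t1 : t < 1 by lra.
have L : (1 - 2 * t) * (a n) ^+ 2 @[n --> \oo] -->
    (1 - 2 * t) * l (fun kj x => chi x * eta kj x) ^+ 2.
  by apply: cvgM; [exact: cvg_cst|exact: (cvgM al al)].
rewrite -(cvg_lim (@Rhausdorff R) L); apply: limr_le; first by apply/cvg_ex; eexists; exact: L.
have := energy_limit GC uv fH1 u_weak c20 G_c2 G_M tchi chi1 t0 t1 B0 dchi.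
apply: filterS => n En.
apply: (@le_trans _ _ ((1 - 2 * t) * (second_energy G v chi (s_ n) * q_norm eta))); last first.
  by rewrite mulrA; apply: ler_wpM2r.
apply: ler_wpM2l; first lra.
have cchi := test_continuous tchi; have schi := test_csupp tchi.
have sqi kj : integ (fun x => (chi x * dq kj.1 (s_ n) (v kj.2) x) ^+ 2 * p x).
  apply: loc_csupp.
    apply: locM => //; have := l2locM (dq_l2loc kj.1 (s_ n) (vl kj.2)) cchi => -[_].
    by congr (locally_integrable_rV _); apply/funext => x; rewrite mulrC.
  by have [r Hr] := schi; exists r => x /Hr ->; rewrite mul0r expr0n mul0r.
have -> : second_energy G v chi (s_ n) =
    \int[leb]_x (\sum_(kj : I2) (chi x * dq kj.1 (s_ n) (v kj.2) x) ^+ 2 * p x).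
  by rewrite Int_sum// /second_energy pair_bigA.
have -> : q_norm eta = \int[leb]_x (\sum_(kj : I2) eta kj x ^+ 2 * (p x)^-1).
  by rewrite Int_sum// => kj; exact: eta_integ.
have ii (kj : I2) : integ (fun x => dq kj.1 (s_ n) (v kj.2) x * (chi x * eta kj x)).
  apply: integM_csupp; [exact/l2loc_loc/dq_l2loc|exact: test_continuous|exact: test_csupp].
rewrite /a -Int_sum//.
apply: (proj2 (Int_CauchySchwarz _ _ _ _ _ _)).
- by apply: integ_meas; exact: integ_sum.
- exact: integ_sum.
- by apply: integ_sum => kj; exact: eta_integ.
- by move=> x; apply: sumr_ge0 => kj _; rewrite mulr_ge0 ?sqr_ge0.
- move=> x; apply: sumr_ge0 => kj _; apply: mulr_ge0; first exact: sqr_ge0.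
  by rewrite invr_ge0.
- move=> x; rewrite -!mulr_suml mulrACA mulfV ?lt0r_neq0 ?p0// mulr1.
  rewrite (eq_bigr (fun kj : I2 => (chi x * dq kj.1 (s_ n) (v kj.2) x) * eta kj x)).
    exact: sum_CauchySchwarz.
  by move=> kj _; ring.
Qed.

Let l_bound eta : tests eta ->
  l eta ^+ 2 <= (M * N + Num.sqrt (H * N)) * q_norm eta.
Proof.
move=> te.
have [B B0 HB] := @partial_cutoff R d.
pose t_ n : R := n.+2%:R^-1.
have t0 n : 0 < t_ n by rewrite invr_gt0.
have t12 n : t_ n <= 2^-1 by rewrite lef_pV2 ?posrE// ler_nat.
have tc : t_ n @[n --> \oo] --> (0 : R).
  by have := s_cvg; rewrite -(cvg_shiftn 1 s_); under eq_fun do rewrite /= addn1.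
have cut1 n (x : T) : `|cutoff n x| <= 1.
  by rewrite ger0_norm ?cutoff_ge0// cutoff_le1.
(* Stretching the cutoff as t tends to 0 keeps its derivatives below t B. *)
have bound n := @cut_bound (cutoff n.+1) (t_ n) B eta (test_cutoff n.+1) (cut1 n.+1)
  (t0 n) (t12 n) B0 (HB n.+1) te.
have lc : l (fun kj x => cutoff n.+1 x * eta kj x) @[n --> \oo] --> l eta.
  apply: cvg_sumr => kj; apply: cvgN.
  have tek := te kj; have ce := test_continuous tek; have se := test_csupp tek.
  have cde := test_continuous (test_partial kj.1 tek); have sde := test_csupp (test_partial kj.1 tek).
  have [r er] := se; have [r' er'] := sde.
  have [K K0 HK] := csupp_bounded ce se; have [K' K'0 HK'] := csupp_bounded cde sde.
  have pE n : partial kj.1 (fun x => cutoff n.+1 x * eta kj x) =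
      (fun x => cutoff n.+1 x * partial kj.1 (eta kj) x + eta kj x * partial kj.1 (cutoff n.+1) x).
    by apply: partialM; [exact: test_C1 (test_cutoff _)|exact: test_C1].
  apply: (@loc_dct _ _ (v kj.2) (fun n => partial kj.1 (fun x => cutoff n.+1 x * eta kj x))
    (partial kj.1 (eta kj)) (Num.max r r') (K' + K * B)).
  - exact: l2loc_loc.
  - by move=> n; apply: test_continuous; apply: test_partial; apply: testM => //; exact: (test_cutoff _).1.
  - move=> x; under eq_fun do rewrite pE.
    suff : cutoff n.+1 x * partial kj.1 (eta kj) x + eta kj x * partial kj.1 (cutoff n.+1) x
        @[n --> \oo] --> 1 * partial kj.1 (eta kj) x + eta kj x * 0.
      by rewrite mul1r mulr0 addr0.
    apply: cvgD.
      apply: cvgM; last exact: cvg_cst.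
      have := @cutoff_cvg R d x; rewrite -(cvg_shiftn 1 (fun n => cutoff n x)).
      by under eq_fun do rewrite /= addn1.
    apply: cvgM; first exact: cvg_cst.
    apply/cvgrPdist_le => eps eps0.
    have : t_ n * B @[n --> \oo] --> 0 * B by apply: cvgM => //; exact: cvg_cst.
    rewrite mul0r => /cvgrPdist_le/(_ _ eps0); apply: filterS => n.
    rewrite !sub0r !normrN => h; apply: le_trans (HB n.+1 kj.1 x) _.
    by apply: le_trans h; exact: ler_norm.
  - move=> n x; rewrite pE; apply: le_trans (ler_normD _ _) _; apply: lerD; rewrite normrM.
      apply: le_trans (HK' x); rewrite -[leRHS]mul1r; apply: ler_wpM2r => //.
    apply: ler_pM => //; apply: le_trans (HB n.+1 kj.1 x) _.
    rewrite -[leRHS]mul1r; apply: ler_wpM2r => //.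
    by rewrite invf_le1// ler1n.
  - move=> n x; rewrite gt_max => /andP[rx rx'].
    by rewrite pE er// er'// mulr0 mul0r addr0.
have L1 : (1 - 2 * t_ n) * l (fun kj x => cutoff n.+1 x * eta kj x) ^+ 2 @[n --> \oo] -->
    (1 - 2 * 0) * l eta ^+ 2.
  apply: cvgM; last exact: (cvgM lc lc).
  by apply: cvgB; [exact: cvg_cst|apply: cvgM => //; exact: cvg_cst].
have c1 : 1 + t_ n @[n --> \oo] --> (1 + 0 : R) by apply: cvgD => //; exact: cvg_cst.
have cN : (1 + t_ n) * N @[n --> \oo] --> (1 + 0) * N by apply: cvgM => //; exact: cvg_cst.
have L2 : Y (t_ n) B * q_norm eta @[n --> \oo] --> Y 0 B * q_norm eta.
  apply: cvgM; last exact: cvg_cst.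
  have S1 : Num.sqrt ((M ^+ 2 * N + t_ n) * ((1 + t_ n) * N)) @[n --> \oo] -->
      Num.sqrt ((M ^+ 2 * N + 0) * ((1 + 0) * N)).
    apply: (@cvg_comp _ _ _ (fun n => (M ^+ 2 * N + t_ n) * ((1 + t_ n) * N)) Num.sqrt _ _ _ _
      (@sqrt_continuous R _)).
    by apply: cvgM => //; apply: cvgD => //; exact: cvg_cst.
  have S2 : Num.sqrt ((1 + t_ n) * H * ((1 + t_ n) * N)) @[n --> \oo] -->
      Num.sqrt ((1 + 0) * H * ((1 + 0) * N)).
    apply: (@cvg_comp _ _ _ (fun n => (1 + t_ n) * H * ((1 + t_ n) * N)) Num.sqrt _ _ _ _
      (@sqrt_continuous R _)).
    by apply: cvgM => //; apply: cvgM => //; exact: cvg_cst.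
  apply: cvgD => //; apply: cvgD => //; apply: cvgD => //.
  apply: cvgM => //; apply: cvgM; last exact: cvg_cst.
  apply: cvgM; last exact: cvg_cst.
  by apply: cvgM => //; exact: cvg_cst.
have : (1 - 2 * 0) * l eta ^+ 2 <= Y 0 B * q_norm eta.
  by apply: (ler_cvg_to L1 L2); exact: nearW.
rewrite mulr0 subr0 mul1r /Y mul0r !addr0 add0r !mul1r.
rewrite -mulrA -expr2 -exprMn sqrtr_sqr ger0_norm//; exact: mulr_ge0.
Qed.

(** The first derivatives of u are in turn weakly differentiable because the
    functional l is bounded for the weight 1 / p; its representative is the
    Hessian, whose norm is controlled by the bound on l. *)
Lemma second_order : exists g : I2 -> T -> R,
  (forall k j, is_weak_partial k (v j) (g (k, j)) /\ l2w p (g (k, j))) /\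
  \sum_kj \int[leb]_x (g kj x ^+ 2 * p x) <= M * N + Num.sqrt (H * N).
Proof.
have C0 : 0 <= M * N + Num.sqrt (H * N) by apply: addr_ge0; [exact: mulr_ge0|exact: sqrtr_ge0].
have vi k j eta : test_function eta -> integ (fun x => v j x * partial k eta x).
  by move=> te; apply: integM_test; [exact: l2loc_loc|exact: test_partial].
have [||g [gw gE gC]] := @l2_duality R d p p0 cp I2 l _ C0.
- move=> c eta zeta te tz; rewrite /l mulr_sumr -big_split /=; apply: eq_bigr => kj _.
  have -> : partial kj.1 (fun x => c * eta kj x + zeta kj x) =
      (fun x => c * partial kj.1 (eta kj) x + partial kj.1 (zeta kj) x).
    apply: partialE => x; apply: is_derive_addD; last exact: Ck_is_derive (test_C1 (tz kj)).
    by apply: is_derive_scaleZ; exact: Ck_is_derive (test_C1 (te kj)).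
  rewrite mulrN -IntZ; last exact: vi.
  rewrite -opprD -IntD; [|apply: integZ; exact: vi|exact: vi].
  by congr (- _); apply: eq_Int => x; ring.
- exact: l_bound.
exists g; split => // k j; split => //.
have vjl := l2loc_loc (vl j).
have gl : loc (g (k, j)) by exact/l2loc_loc/(l2w_l2loc p0 cp (gw (k, j))).
split => // eta te.
(* Testing with families that have a single nonzero member isolates each
   second derivative. *)
pose fam (kj : I2) : T -> R := if kj == (k, j) then eta else (fun=> 0).
have t0 : test_function (fun _ : T => 0 : R).
  by apply: csupp_test => [n|]; [exact: Ck_cst|exists 0].
have tf kj : test_function (fam kj) by rewrite /fam; case: ifP.
have := gE fam tf; rewrite /l (bigD1 (k, j))//= [in RHS](bigD1 (k, j))//=.
rewrite /fam eqxx !big1 ?addr0.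
- by move=> h; rewrite -h opprK.
- move=> kj /negbTE ->; rewrite -[RHS](@Int0 R d); apply: eq_Int => x; exact: mulr0.
- move=> kj /negbTE ->; apply/eqP; rewrite oppr_eq0; apply/eqP.
  rewrite -[RHS](@Int0 R d); apply: eq_Int => x.
  have -> : partial kj.1 (fun _ : T => 0 : R) x = 0 by exact: derive_val.
  exact: mulr0.
Qed.

End second_order.

(** * Weak gradients and the Poincare inequality *)

Lemma norm2_sqr (R : realType) m n (A : 'M[R]_(m, n)) :
  norm2 A ^+ 2 = \sum_i \sum_j A i j ^+ 2.
Proof.
rewrite sqr_sqrtr//; apply: sumr_ge0 => i _; apply: sumr_ge0 => j _.
exact: sqr_ge0.
Qed.

Lemma norm2_row_sqr (R : realType) n (r : 'rV[R]_n) :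
  norm2 r ^+ 2 = \sum_i r ord0 i ^+ 2.
Proof. by rewrite norm2_sqr big_ord1. Qed.

Section weak_gradient.
Context {R : realType} {d : nat}.
Local Notation T := 'rV[R]_d.
Local Notation leb := (@lebesgue_rV R d).

Variable p : T -> R.
Hypotheses (p0 : forall x, 0 < p x) (cp : continuous p).

Let mp : measurable_fun [set: T] p. Proof. exact: continuous_measurable_rV. Qed.
Let p_ge0 x : 0 <= p x. Proof. exact: ltW. Qed.

Local Notation wgrad u := (fun i => weak_partial i u).

Lemma l2w_ae (f g : T -> R) : l2w p f -> measurable_fun [set: T] g ->
  {ae leb, forall x, f x = g x} -> l2w p g.
Proof.
move=> [mf fi] mg fg; split => //; apply: (ae_eq_integ fi).
  by apply: measurable_funM => //; exact: measurable_funX.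
by apply: filterS fg => x ->.
Qed.

Lemma l2w_le (f F : T -> R) : measurable_fun [set: T] f -> measurable_fun [set: T] F ->
  (forall x, f x ^+ 2 <= F x) -> (\int[leb]_x (F x * p x)%:E < +oo)%E -> l2w p f.
Proof.
move=> mf mF fF Foo; split => //; apply: (@integ_le _ _ _ (fun x => F x * p x)).
- by apply: measurable_funM => //; exact: measurable_funX.
- apply: ge0_integ => //; first exact: measurable_funM.
  by move=> x; apply: mulr_ge0 => //; apply: le_trans (fF x); exact: sqr_ge0.
- move=> x; rewrite ger0_norm; first by apply: ler_wpM2r.
  by apply: mulr_ge0 => //; exact: sqr_ge0.
Qed.

(** The chosen weak derivatives inherit square integrability from any others,
    as they agree almost everywhere; so every statement on H1 transfers to
    weak_grad and sobolev. *)
Lemma H1_weak_partial u v : H1 p u v -> H1 p u (wgrad u).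
Proof.
move=> [uw H]; split => // i; have [Hi vi] := H i.
split; first exact: weak_partialP Hi.
apply: (l2w_ae vi); first by have [_ /loc_meas] := weak_partialP Hi.
by apply: filterS (weak_partial_ae Hi) => x ->.
Qed.

Lemma sobolev1P u : sobolev p 1 u <-> H1 p u (wgrad u).
Proof.
split=> [[/(L2_l2w _ p_ge0 mp) uw H]|[uw H]].
  have /choice[v Hv] : forall i, exists g, is_weak_partial i u g /\ l2w p g.
    by move=> i; have [g [ug [/(L2_l2w _ p_ge0 mp) gw _]]] := H i; exists g.
  exact: (@H1_weak_partial u v).
split; first exact/(L2_l2w _ p_ge0 mp).
move=> i; have [Hi vi] := H i; exists (weak_partial i u); split => //.
by split => //; exact/(L2_l2w _ p_ge0 mp).
Qed.

Lemma dirichletE u v u' v' : H1 p u v -> H1 p u' v' ->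
  \sum_i \int[leb]_x (v i x * v' i x * p x) =
  \int[leb]_x (dot (weak_grad u x) (weak_grad u' x) * p x).
Proof.
move=> uv uv'; have uw := H1_weak_partial uv; have uw' := H1_weak_partial uv'.
rewrite (eq_Int (g := fun x => \sum_i weak_partial i u x * weak_partial i u' x * p x)); last first.
  by move=> x; rewrite /dot mulr_suml; apply: eq_bigr => i _; rewrite !mxE.
rewrite Int_sum; last by move=> i; apply: l2w_mul => //; [have [_ /(_ i)[]] := uw|have [_ /(_ i)[]] := uw'].
apply: eq_bigr => i _.
have [_ /(_ i)[vi [mi _]]] := uv; have [_ /(_ i)[vi' [mi' _]]] := uv'.
have [_ /(_ i)[_ [wi _]]] := uw; have [_ /(_ i)[_ [wi' _]]] := uw'.
apply: ae_eq_Int.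
- by apply: measurable_funM => //; exact: measurable_funM.
- by apply: measurable_funM => //; exact: measurable_funM.
- by apply: filterS2 (weak_partial_ae vi) (weak_partial_ae vi') => x -> ->.
Qed.

Lemma dirichlet_integ u v : H1 p u v ->
  integ (fun x => norm2 (weak_grad u x) ^+ 2 * p x) /\
  \int[leb]_x (norm2 (weak_grad u x) ^+ 2 * p x) = \sum_i \int[leb]_x (v i x ^+ 2 * p x).
Proof.
move=> uv; have [_ uw] := H1_weak_partial uv; split.
  have : integ (fun x => \sum_i weak_partial i u x ^+ 2 * p x).
    by apply: integ_sum => i; have [_ []] := uw i.
  apply: integ_ext => x; rewrite norm2_row_sqr mulr_suml.
  by apply: eq_bigr => i _; rewrite mxE.
rewrite (dirichletE uv uv); apply: eq_Int => x; rewrite norm2_row_sqr /dot.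
by congr (_ * _); apply: eq_bigr => i _; rewrite expr2.
Qed.

Lemma spectral_gap_H1 lambda u v : spectral_gap p lambda -> H1 p u v ->
  \int[leb]_x (u x * p x) = 0 ->
  \int[leb]_x (u x ^+ 2 * p x) <= lambda^-1 * \sum_i \int[leb]_x (v i x ^+ 2 * p x).
Proof.
move=> [_ gap] uv u0; have [wi <-] := dirichlet_integ uv.
have := gap u; rewrite !EFin_Int//; last by case: uv => -[].
rewrite -EFinM lee_fin; apply; split => //; apply/sobolev1P.
exact: H1_weak_partial uv.
Qed.

End weak_gradient.

(** * Poisson equation and essential bound on the Hessian of the weight *)

Section poisson.
Context {R : realType} {d : nat}.
Local Notation T := 'rV[R]_d.
Local Notation leb := (@lebesgue_rV R d).

Variables (p : T -> R) (lambda : R) (h : T -> R).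
Hypotheses (p0 : forall x, 0 < p x) (cp : continuous p).
Hypotheses (p_integ : integ p) (p1 : \int[leb]_x p x = 1).
Hypotheses (gap : spectral_gap p lambda) (hw : l2w p h).

Let mp : measurable_fun [set: T] p. Proof. exact: continuous_measurable_rV. Qed.
Let p_ge0 x : 0 <= p x. Proof. exact: ltW. Qed.
Let lambda0 : 0 < lambda. Proof. by case: gap. Qed.

Local Notation wgrad u := (fun i => weak_partial i u).
Local Notation f := (fun x => h x - mean p h).

Lemma l2w_centered : l2w p f.
Proof. exact: (l2wB p0 cp hw (l2w_cst p_integ _)). Qed.

Lemma centered_mean : \int[leb]_x (f x * p x) = 0.
Proof.
have hi : integ (fun x => h x * p x).
  apply: integ_ext (l2w_mul p0 cp hw (l2w_cst p_integ 1)) => x.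
  by rewrite mulr1.
under eq_Int do rewrite mulrBl.
rewrite IntB//; last exact: integZ.
by rewrite IntZ// p1 mulr1 subrr.
Qed.

Lemma weak_solution_ex : exists phi, weak_solution p h phi.
Proof.
have [u [v [uv u0 Hu]]] := weak_solution_exists p0 cp p_integ p1 lambda0
  (fun u v => spectral_gap_H1 p0 cp gap) l2w_centered centered_mean.
exists u; split; first by split => //; apply/sobolev1P => //; exact: H1_weak_partial uv.
by move=> psi /(sobolev1P p0 cp) Hpsi; rewrite -(dirichletE p0 cp uv Hpsi) (Hu _ _ Hpsi).
Qed.

Lemma weak_solution_H1 phi : weak_solution p h phi -> H1 p phi (wgrad phi).
Proof. by move=> [[/(sobolev1P p0 cp)]]. Qed.

Lemma weak_solution_mean phi : weak_solution p h phi -> \int[leb]_x (phi x * p x) = 0.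
Proof. by move=> [[]]. Qed.

Lemma weak_solution_test phi u v : weak_solution p h phi -> H1 p u v ->
  \sum_i \int[leb]_x (weak_partial i phi x * v i x * p x) = \int[leb]_x (f x * u x * p x).
Proof.
move=> ws uv; rewrite (dirichletE p0 cp (weak_solution_H1 ws) uv).
have [_ -> //] := ws; apply/(sobolev1P p0 cp); exact: H1_weak_partial uv.
Qed.

(** The difference of two solutions is orthogonal to itself in the Dirichlet
    form, and vanishes by the Poincare inequality. *)
Lemma weak_solution_unique phi phi' : weak_solution p h phi -> weak_solution p h phi' ->
  {ae leb, forall x, phi' x = phi x}.
Proof.
move=> ws ws'; have H := weak_solution_H1 ws; have H' := weak_solution_H1 ws'.
have HD := H1D p0 cp H' (H1Z (-1) H); set D := fun x => _ in HD; set v := fun i x => _ in HD.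
have D0 : \int[leb]_x (D x * p x) = 0.
  under eq_Int do rewrite mulrDl mulN1r mulNr.
  have i1 := H1_integ p0 cp p_integ H; have i2 := H1_integ p0 cp p_integ H'.
  rewrite IntD//; last exact: integN.
  by rewrite IntN// (weak_solution_mean ws) (weak_solution_mean ws') subr0.
have v0 : \sum_i \int[leb]_x (v i x ^+ 2 * p x) = 0.
  transitivity (\sum_i \int[leb]_x (weak_partial i phi' x * v i x * p x) -
      \sum_i \int[leb]_x (weak_partial i phi x * v i x * p x)); last first.
    have E := etrans (weak_solution_test ws' HD) (esym (weak_solution_test ws HD)).
    by apply/eqP; rewrite subr_eq0; apply/eqP; exact: E.
  rewrite -sumrB; apply: eq_bigr => i _.
  have [_ /(_ i)[_ vi]] := HD; have [_ /(_ i)[_ wi]] := H; have [_ /(_ i)[_ wi']] := H'.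
  rewrite -IntB; [|exact: l2w_mul|exact: l2w_mul].
  by apply: eq_Int => x; rewrite /v; ring.
have := spectral_gap_H1 p0 cp gap HD D0; rewrite v0 mulr0 => Dle.
have Di : integ (fun x => D x ^+ 2 * p x) by case: HD => -[].
have D20 x : 0 <= D x ^+ 2 * p x by apply: mulr_ge0 => //; exact: sqr_ge0.
have Dge := Int_ge0 D20.
have : \int[leb]_x (D x ^+ 2 * p x) = 0 by apply/eqP; rewrite eq_le Dle.
move=> /(Int_eq0_ae Di D20); apply: filterS => x /eqP.
by rewrite mulf_eq0 (gt_eqF (p0 x)) orbF sqrf_eq0 /D mulN1r subr_eq0 => /eqP.
Qed.

(** Tested with itself, the equation gives N = \int f phi p, whose square is at
    most (\int f^2 p) (lambda^-1 N); then N cancels. *)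
Lemma weak_solution_energy phi : weak_solution p h phi ->
  \sum_i \int[leb]_x (weak_partial i phi x ^+ 2 * p x) <=
  lambda^-1 * \int[leb]_x (f x ^+ 2 * p x).
Proof.
move=> ws; have H := weak_solution_H1 ws.
have gapH := spectral_gap_H1 p0 cp gap H (weak_solution_mean ws).
have NE := weak_solution_test ws H.
have -> : \sum_i \int[leb]_x (weak_partial i phi x ^+ 2 * p x) = \int[leb]_x (f x * phi x * p x).
  by rewrite -NE; apply: eq_bigr => i _; apply: eq_Int => x; rewrite expr2.
have := weak_solution_test ws H.
have -> : \sum_i \int[leb]_x (weak_partial i phi x * weak_partial i phi x * p x) =
    \sum_i \int[leb]_x (weak_partial i phi x ^+ 2 * p x).
  by apply: eq_bigr => i _; apply: eq_Int => x; rewrite expr2.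
move=> {}NE; rewrite NE in gapH.
have [_ CS] := l2w_CauchySchwarz p0 cp l2w_centered (proj1 H).
have N0 : 0 <= \int[leb]_x (f x * phi x * p x).
  by rewrite -NE; apply: sumr_ge0 => i _; apply: Int_ge0 => x; apply: mulr_ge0 => //; exact: sqr_ge0.
have F0 : 0 <= \int[leb]_x (f x ^+ 2 * p x).
  by apply: Int_ge0 => x; apply: mulr_ge0 => //; exact: sqr_ge0.
move: (\int[leb]_x (f x * phi x * p x)) (\int[leb]_x (f x ^+ 2 * p x)) N0 F0 gapH CS => N F N0 F0 gapH CS.
have [->|Nn0] := eqVneq N 0; first by apply: mulr_ge0 => //; rewrite invr_ge0 ltW.
have Np : 0 < N by rewrite lt0r Nn0.
rewrite -(ler_pM2r Np) -expr2; apply: le_trans CS _.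
rewrite (_ : lambda^-1 * F * N = F * (lambda^-1 * N)); last by rewrite [RHS]mulrCA [RHS]mulrA.
exact: ler_wpM2l.
Qed.

End poisson.

Section hessian_bound.
Context {R : realType} {d : nat}.
Local Notation T := 'rV[R]_d.
Local Notation leb := (@lebesgue_rV R d).

Variables (G : T -> R) (c2 : R).
Hypotheses (GC : Ck 2 G) (G_c2 : forall x j k, `|partial k (partial j G) x| <= c2).

Lemma hess_ln_gibbs x : norm2 (hess (fun y => ln (gibbs G y)) x) ^+ 2 =
  \sum_k \sum_j partial k (partial j G) x ^+ 2.
Proof.
have -> : (fun y => ln (gibbs G y)) = (fun y => -1 * G y).
  by apply/funext => y; rewrite /gibbs expRK.
have p1 j : partial j (fun y => -1 * G y) = (fun y => -1 * partial j G y).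
  by apply: partialE => y; exact: (is_derive_scaleZ _ (Ck_is_derive j y GC)).
have p2 j k : partial k (fun y => -1 * partial j G y) = (fun y => -1 * partial k (partial j G) y).
  by apply: partialE => y; exact: (is_derive_scaleZ _ (Ck_is_derive k y (Ck_partial j GC))).
rewrite norm2_sqr exchange_big /=; apply: eq_bigr => k _; apply: eq_bigr => j _.
by rewrite mxE p1 p2 mulN1r sqrrN.
Qed.

(** The bound c2 keeps the essential supremum below +oo. Were it -oo, the
    empty set would be of full measure and every almost everywhere statement
    would hold; a negative real value is excluded, as it would entail -oo. *)
Lemma ess_sup_hess_log_bound : 0 <= ess_sup_hess_log (gibbs G) /\
  {ae leb, forall x, \sum_k \sum_j partial k (partial j G) x ^+ 2 <=
    ess_sup_hess_log (gibbs G) ^+ 2}.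
Proof.
pose n x := norm2 (hess (fun y => ln (gibbs G y)) x).
have n0 x : 0 <= n x by exact: sqrtr_ge0.
suff [M0 nM] : 0 <= ess_sup_hess_log (gibbs G) /\
    {ae leb, forall x, n x <= ess_sup_hess_log (gibbs G)}.
  split => //; apply: filterS nM => x nM; rewrite -hess_ln_gibbs.
  by apply: lerXn2r; [exact: n0|exact: M0|exact: nM].
have := ess_sup_ge leb (EFin \o n).
have lep : (ess_sup leb (EFin \o n) <= (Num.sqrt (\sum_(k < d) \sum_(j < d) c2 ^+ 2))%:E)%E.
  apply/ess_supP; apply: nearW => x; rewrite /= lee_fin -[leLHS]ger0_norm// -sqrtr_sqr.
  rewrite hess_ln_gibbs; apply: ler_wsqrtr; apply: ler_sum => k _; apply: ler_sum => j _.
  rewrite -real_normK ?num_real// ler_pXn2r ?nnegrE//.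
  exact: le_trans (G_c2 x j k).
rewrite /ess_sup_hess_log -/n.
case: (ess_sup leb (EFin \o n)) (@ess_sup_eqNyP _ _ _ leb (EFin \o n)) lep => [r| |] /=.
- move=> Ny _ nr; have {}nr : {ae leb, forall x, n x <= r}.
    by apply: filterS nr => x /=; rewrite lee_fin.
  split => //; rewrite leNgt; apply/negP => r0.
  suff : r%:E = -oo%E by [].
  apply/Ny.
  apply: filterS nr => x nr; have := le_lt_trans nr r0.
  by rewrite ltNge n0.
- by [].
- by move=> _ _ H; split => //; apply: filterS H => x; rewrite leeNy_eq.
Qed.

End hessian_bound.

(** * The Hessian estimate *)

Lemma norm2_mulmx_le (R : realType) m n (A : 'M[R]_(m, n)) (r : 'rV[R]_n) :
  norm2 (A *m r^T) ^+ 2 <= norm2 A ^+ 2 * norm2 r ^+ 2.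
Proof.
rewrite norm2_row_sqr !norm2_sqr mulr_suml; apply: ler_sum => i _.
rewrite big_ord1 mxE.
under eq_bigr do rewrite mxE.
exact: sum_CauchySchwarz.
Qed.

Lemma measurable_norm2 (R : realType) d (T : measurableType d) m n
    (A : T -> 'M[R]_(m, n)) :
  (forall i j, measurable_fun [set: T] (fun x => A x i j)) ->
  measurable_fun [set: T] (fun x => norm2 (A x)).
Proof.
move=> mA; apply: (measurableT_comp (measurable_funTS (continuous_measurable_fun (@sqrt_continuous R)))).
apply: measurable_sum => i; apply: measurable_sum => j.
exact: measurable_funX.
Qed.

Lemma hess_constant_sqr (R : realType) d (p : 'rV[R]_d -> R) (lambda : R) :
    0 < lambda -> 0 <= ess_sup_hess_log p ->
  0 <= hess_constant lambda p /\
  hess_constant lambda p ^+ 2 = (lambda ^+ 3)^-1 * (ess_sup_hess_log p / lambda + 1).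
Proof.
move=> l0 M0; split; first by rewrite mulr_ge0 ?invr_ge0 ?powR_ge0.
have b0 : 0 <= ess_sup_hess_log p / lambda + 1.
  by apply: addr_ge0 => //; apply: divr_ge0 => //; exact: ltW.
rewrite /hess_constant exprMn exprVn -!powR_mulrn ?powR_ge0//.
have E (a : R) : 0 <= a -> (a `^ (1 / 2)) `^ 2 = a.
  by move=> a0; rewrite -powRrM (_ : 1 / 2 * 2 = 1 :> R) ?powRr1//; field.
rewrite E// -powRrM (_ : 3 / 2 * 2 = 3%:R :> R); last by field.
by [].
exact: ltW.
Qed.

Section regularity.
Context {R : realType} {d : nat}.
Local Notation T := 'rV[R]_d.
Local Notation leb := (@lebesgue_rV R d).

Variables (G : T -> R) (c2 lambda : R) (h phi : T -> R).
Local Notation p := (gibbs G).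
Hypotheses (GC : Ck 2 G) (G_c2 : forall x j k, `|partial k (partial j G) x| <= c2).
Hypotheses (p_integ : integ p) (p1 : \int[leb]_x p x = 1).
Hypotheses (gap : spectral_gap p lambda).
Hypotheses (hC : Ck 1 h) (hw : l2w p h) (dhw : forall i, l2w p (partial i h)).
Hypothesis ws : weak_solution p h phi.

Let p0 := gibbs_gt0 G.
Let cp := gibbs_continuous GC.
Let p_ge0 x : 0 <= p x. Proof. by rewrite ltW// p0. Qed.
Let mp : measurable_fun [set: T] p. Proof. exact: continuous_measurable_rV. Qed.
Let lambda0 : 0 < lambda. Proof. by case: gap. Qed.

Local Notation M := (ess_sup_hess_log p).
Local Notation v := (fun i => weak_partial i phi).
Local Notation N := (energy p v).
Local Notation H := (energy p (fun i => partial i h)).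

Let N0 : 0 <= N. Proof. exact: energy_ge0. Qed.
Let H0 : 0 <= H. Proof. exact: energy_ge0. Qed.

Let fH1 : H1 p (fun x => h x - mean p h) (fun i => partial i h).
Proof.
have -> : (fun i => partial i h) = (fun i x => partial i h x + 0).
  by apply/funext => i; apply/funext => x; rewrite addr0.
apply: (H1D p0 cp _ (H1_cst p_integ (- mean p h))).
by split => // i; split => //; exact: C1_weak_partial.
Qed.

Let N_le : N <= lambda^-1 * (lambda^-1 * H).
Proof.
apply: le_trans (weak_solution_energy p0 cp p_integ gap hw ws) _.
apply: ler_wpM2l; first by rewrite invr_ge0 ltW.
exact: (spectral_gap_H1 p0 cp gap fH1 (centered_mean p0 cp p_integ p1 hw)).
Qed.

Let M_ge0 : 0 <= M. Proof. by case: (ess_sup_hess_log_bound GC G_c2). Qed.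

(** The Poincare inequality for h - mean p h bounds N by H / lambda^2, which
    turns the Bochner bound into a multiple of H. *)
Lemma weak_solution_H2 :
  (forall j, H1 p (weak_partial j phi) (fun k => weak_partial k (weak_partial j phi))) /\
  exists2 K, K <= lambda^-1 * H * (M / lambda + 1) &
    integ (fun x => norm2 (weak_hess phi x) ^+ 2 * p x) /\
    \int[leb]_x (norm2 (weak_hess phi x) ^+ 2 * p x) <= K.
Proof.
have [_ G_M] := ess_sup_hess_log_bound GC G_c2.
have vH1 := weak_solution_H1 p0 cp ws.
have c20 : 0 <= Num.max c2 0 by rewrite le_max lexx orbT.
have G_c2' x j k : `|partial k (partial j G) x| <= Num.max c2 0.
  by rewrite le_max G_c2.
have [g [gP gK]] := second_order GC vH1 fH1
  (fun u' v' => weak_solution_test p0 cp ws) c20 M_ge0 G_c2' G_M.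
have gH1 j : H1 p (weak_partial j phi) (fun k => g (k, j)).
  by split; [have [_ /(_ j)[]] := vH1|move=> k; exact: gP].
split; first by move=> j; exact: H1_weak_partial (gH1 j).
exists (M * N + Num.sqrt (H * N)).
  have -> : lambda^-1 * H * (M / lambda + 1) =
      M * (lambda^-1 * (lambda^-1 * H)) + lambda^-1 * H by ring.
  apply: lerD; first exact: ler_wpM2l.
  have l1 : 0 <= lambda^-1 * H by apply: mulr_ge0 => //; rewrite invr_ge0 ltW.
  rewrite -[leRHS]ger0_norm// -sqrtr_sqr; apply: ler_wsqrtr.
  have -> : (lambda^-1 * H) ^+ 2 = H * (lambda^-1 * (lambda^-1 * H)) by ring.
  exact: ler_wpM2l.
have hE x : norm2 (weak_hess phi x) ^+ 2 * p x =
    \sum_j norm2 (weak_grad (weak_partial j phi) x) ^+ 2 * p x.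
  rewrite norm2_sqr mulr_suml; apply: eq_bigr => j _; congr (_ * _).
  by rewrite norm2_row_sqr; apply: eq_bigr => k _; rewrite !mxE.
have di j := dirichlet_integ p0 cp (gH1 j).
have hi : integ (fun x => \sum_j norm2 (weak_grad (weak_partial j phi) x) ^+ 2 * p x).
  by apply: integ_sum => j; exact: (di j).1.
split; first by apply: integ_ext hi => x; rewrite hE.
apply: le_trans gK; rewrite (eq_Int hE) Int_sum; last by move=> j; exact: (di j).1.
apply: le_of_eq.
rewrite (eq_bigr (fun j => \sum_k \int[leb]_x (g (k, j) x ^+ 2 * p x))); last first.
  by move=> j _; exact: (di j).2.
by rewrite exchange_big pair_bigA; apply: eq_bigr => -[].
Qed.

(** Cauchy-Schwarz between the Hessian and the gradient; both sides are
    compared through their squares. *)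
Lemma weak_solution_hess_grad :
  (\int[leb]_x (norm2 (weak_hess phi x *m (weak_grad phi x)^T) * p x)%:E <=
   (hess_constant lambda p)%:E * \int[leb]_x (norm2 (grad h x) ^+ 2 * p x)%:E)%E.
Proof.
have [HH [K KH [Hi HK]]] := weak_solution_H2.
have vH1 := weak_solution_H1 p0 cp ws.
have [Ni NE] := dirichlet_integ p0 cp vH1.
have gE x : norm2 (grad h x) ^+ 2 * p x = \sum_i partial i h x ^+ 2 * p x.
  rewrite norm2_row_sqr mulr_suml; apply: eq_bigr => i _; congr (_ ^+ 2 * _).
  by rewrite mxE.
have gi i : integ (fun x => partial i h x ^+ 2 * p x) by case: (dhw i).
have gHi : integ (fun x => norm2 (grad h x) ^+ 2 * p x).
  by apply: integ_ext (integ_sum _ gi) => x; rewrite gE.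
have gH : \int[leb]_x (norm2 (grad h x) ^+ 2 * p x) = H by rewrite (eq_Int gE) Int_sum.
have m1 i : measurable_fun [set: T] (weak_partial i phi).
  by have [_ /(_ i)[_ []]] := vH1.
have m2 i k : measurable_fun [set: T] (weak_partial k (weak_partial i phi)).
  by have [_ /(_ k)[_ []]] := HH i.
have [Pi PCS] : integ (fun x => norm2 (weak_hess phi x *m (weak_grad phi x)^T) * p x) /\
    (\int[leb]_x (norm2 (weak_hess phi x *m (weak_grad phi x)^T) * p x)) ^+ 2 <=
    \int[leb]_x (norm2 (weak_hess phi x) ^+ 2 * p x) *
    \int[leb]_x (norm2 (weak_grad phi x) ^+ 2 * p x).
  apply: Int_CauchySchwarz => //.
  - apply: measurable_funM => //; apply: measurable_norm2 => i j.
    under eq_fun do rewrite mxE.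
    apply: measurable_sum => k; apply: measurable_funM.
      by under eq_fun do rewrite mxE; exact: m2.
    by under eq_fun do rewrite !mxE; exact: m1.
  - by move=> x; apply: mulr_ge0 => //; exact: sqr_ge0.
  - by move=> x; apply: mulr_ge0 => //; exact: sqr_ge0.
  - move=> x; rewrite exprMn [leRHS]mulrACA -[p x * p x]expr2.
    apply: ler_wpM2r; first exact: sqr_ge0.
    exact: norm2_mulmx_le.
rewrite !EFin_Int// -EFinM lee_fin gH.
have [C0 CE] := hess_constant_sqr lambda0 M_ge0.
apply: le_trans (ler_norm _) _; rewrite -[leRHS]ger0_norm; last exact: mulr_ge0.
rewrite -ler_sqr ?nnegrE// !real_normK ?num_real//.
apply: le_trans PCS _; rewrite NE exprMn CE.
have l0 : 0 <= lambda^-1 by rewrite invr_ge0 ltW.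
have b0 : 0 <= M / lambda + 1 by apply: addr_ge0 => //; exact: mulr_ge0.
apply: (@le_trans _ _ (lambda^-1 * H * (M / lambda + 1) * (lambda^-1 * (lambda^-1 * H)))).
  apply: ler_pM => //; last exact: le_trans HK KH.
  by apply: Int_ge0 => x; apply: mulr_ge0 => //; exact: sqr_ge0.
apply: le_of_eq; field; exact: lt0r_neq0.
Qed.

End regularity.

Theorem theorem2 (R : realType) (d m : nat)
    (h : 'rV[R]_d -> 'rV[R]_m) (p G : 'rV[R]_d -> R -> R) (t : R)
    (j : 'I_m) (lambda : R)
    (h_C1 : forall k : 'I_m, Ck 1 (fun x => h x ord0 k))
    (p_density : probability_density (p^~ t))
    (A1_exp : forall x, p x t = expR (- G x t))
    (A1_C2 : Ck 2 (G^~ t))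
    (A1_growth : forall M : R, \forall r \near +oo, forall x : 'rV[R]_d,
       r <= norm2 x ->
       M <= norm2 (grad (G^~ t) x) ^+ 2 - 2 * laplacian (G^~ t) x)
    (A2 : (\int[lebesgue_rV]_x (norm2 (h x) ^+ 2 * p x t)%:E < +oo)%E)
    (lambda_gap : spectral_gap (p^~ t) lambda) :
  let hj := fun x => h x ord0 j in
  exists phi : 'rV[R]_d -> R,
    [/\ weak_solution (p^~ t) hj phi,
        forall phi' : 'rV[R]_d -> R, weak_solution (p^~ t) hj phi' ->
          {ae lebesgue_rV, forall x, phi' x = phi x},
        (\int[lebesgue_rV]_x (norm2 (weak_grad phi x) ^+ 2 * p x t)%:E <=
         lambda^-1%:E *
           \int[lebesgue_rV]_x ((hj x - mean (p^~ t) hj) ^+ 2 * p x t)%:E)%E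
      & forall
          (A3 : exists c2 : R, forall (x : 'rV[R]_d) (i k : 'I_d),
             `|hess (G^~ t) x i k| <= c2)
          (A4 : (\int[lebesgue_rV]_x
             ((\sum_(k < m) norm2 (grad (fun y => h y ord0 k) x) ^+ 2)
                * p x t)%:E < +oo)%E),
          sobolev (p^~ t) 2 phi /\
          (\int[lebesgue_rV]_x
             (norm2 (weak_hess phi x *m (weak_grad phi x)^T) * p x t)%:E <=
           (hess_constant lambda (p^~ t))%:E *
             \int[lebesgue_rV]_x (norm2 (grad hj x) ^+ 2 * p x t)%:E)%E].
Proof.
move=> hj.
have pE : p^~ t = gibbs (G^~ t).
  by apply/funext => x; rewrite A1_exp /gibbs mulN1r.
have GC := A1_C2; have p0 := gibbs_gt0 (G^~ t); have cp := gibbs_continuous GC.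
have p_ge0 x : 0 <= gibbs (G^~ t) x by exact: ltW.
have mp := continuous_measurable_rV cp.
have ptE x : p x t = gibbs (G^~ t) x by rewrite -pE.
have {}A2 : (\int[lebesgue_rV]_x (norm2 (h x) ^+ 2 * gibbs (G^~ t) x)%:E < +oo)%E.
  by move: A2; under eq_integral do rewrite ptE.
rewrite pE in p_density lambda_gap *.
have [_ _ p1E] := p_density.
have p_integ : integ (gibbs (G^~ t)) by apply: ge0_integ => //; rewrite p1E ltry.
have p1 : \int[lebesgue_rV]_x gibbs (G^~ t) x = 1.
  by move: p1E; rewrite EFin_Int// => -[].
have mh k : measurable_fun [set: 'rV[R]_d] (fun x => h x ord0 k).
  exact: continuous_measurable_rV (Ck_continuous (h_C1 k)).
have hw : l2w (gibbs (G^~ t)) hj.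
  apply: (l2w_le p0 cp (mh j) _ _ A2) => //.
  - apply: measurable_funX; apply: measurable_norm2 => i k; rewrite ord1; exact: mh.
  - move=> x; rewrite norm2_row_sqr (bigD1 j)//= lerDl; apply: sumr_ge0 => k _.
    exact: sqr_ge0.
have [phi ws] := weak_solution_ex p0 cp p_integ p1 lambda_gap hw.
exists phi; split => //.
- by move=> phi' ws'; exact: (weak_solution_unique p0 cp p_integ lambda_gap ws ws').
- have [Ni NE] := dirichlet_integ p0 cp (weak_solution_H1 p0 cp ws).
  have [_ fi] := l2w_centered p0 cp p_integ hw.
  under eq_integral do rewrite ptE.
  under [X in (_ <= _ * X)%E]eq_integral do rewrite ptE.
  rewrite !EFin_Int// -EFinM lee_fin NE.
  exact: (weak_solution_energy p0 cp p_integ lambda_gap hw ws).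
- move=> [c2 A3] A4.
  have G_c2 x i k : `|partial k (partial i (G^~ t)) x| <= c2.
    by have := A3 x i k; rewrite mxE.
  have mdh k i : measurable_fun [set: 'rV[R]_d] (partial i (fun y => h y ord0 k)).
    exact: continuous_measurable_rV (Ck_continuous (Ck_partial i (h_C1 k))).
  have dhw i : l2w (gibbs (G^~ t)) (partial i hj).
    move: A4; under eq_integral do rewrite ptE.
    move=> {}A4; apply: (l2w_le p0 cp (mdh j i) _ _ A4) => //.
    + apply: measurable_sum => k; apply: measurable_funX; apply: measurable_norm2 => a b.
      by under eq_fun do rewrite mxE; exact: mdh.
    + move=> x; rewrite (bigD1 j)//= norm2_row_sqr (bigD1 i)//= mxE -addrA lerDl.
      apply: addr_ge0; apply: sumr_ge0 => k _; exact: sqr_ge0.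
  split; last first.
    under eq_integral do rewrite ptE.
    under [X in (_ <= _ * X)%E]eq_integral do rewrite ptE.
    exact: (weak_solution_hess_grad GC G_c2 p_integ p1 lambda_gap (h_C1 j) hw dhw ws).
  have [HH _] := weak_solution_H2 GC G_c2 p_integ p1 lambda_gap (h_C1 j) hw dhw ws.
  have [phiw H] := weak_solution_H1 p0 cp ws.
  split; first exact/(L2_l2w _ p_ge0 mp).
  move=> i; exists (weak_partial i phi); split; first by have [] := H i.
  exact/(sobolev1P p0 cp).
Qed.
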